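(* Let $(M,g)$ be a simply-connected complete Cartan-Hadamard Riemannian manifold. Then $(M,g)$ admits no compact minimal submanifold.
   Context: A Cartan-Hadamard manifold here is a Riemannian manifold with non-positive sectional curvature (simple connectedness is stated separately). Submanifolds are immersed, connected, of dimension at least one, and compact submanifolds have no boundary. A submanifold is minimal if its mean curvature vector field vanishes identically. *)

(* Defs.v *)
From HB Require Import structures.
From mathcomp Require Import all_boot all_order all_algebra.
From mathcomp Require Import all_classical all_reals all_analysis.
Import Order.TTheory GRing.Theory Num.Theory.
Import numFieldNormedType.Exports.

Set Implicit Arguments.
Unset Strict Implicit.
Unset Printing Implicit Defensive.

Local Open Scope classical_set_scope.
Local Open Scope ring_scope.

Definition partial (R : realType) (m : nat) (W : normedModType R) (a : 'I_m)
    (F : 'rV[R]_m -> W) : 'rV[R]_m -> W :=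
  fun x => 'D_(delta_mx 0 a) F x.

(* Only used on open sets U, where all derivatives at points of U depend only
   on the restriction of F to U. *)
Fixpoint Ck (R : realType) (m : nat) (W : normedModType R) (r : nat)
    (U : set 'rV[R]_m) (F : 'rV[R]_m -> W) : Prop :=
  if r is s.+1 then
    (forall x, U x -> differentiable F x) /\
    (forall a : 'I_m, Ck s U (partial a F))
  else forall x, U x -> {for x, continuous F}.

Definition smooth_on (R : realType) (m : nat) (W : normedModType R)
    (U : set 'rV[R]_m) (F : 'rV[R]_m -> W) : Prop :=
  forall r, Ck r U F.

(* The chart i is the homeomorphism phi i : dom i -> cdom i := phi i @` dom i
   with inverse psi i; the values of phi i and psi i outside dom i and cdom i
   are irrelevant. *)
Record manifold (R : realType) (n : nat) := Manifold {
  space :> topologicalType;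
  atlas : Type;
  dom : atlas -> set space;
  phi : atlas -> space -> 'rV[R]_n;
  psi : atlas -> 'rV[R]_n -> space;
  manifold_hausdorff : hausdorff_space space;
  manifold_second_countable : @second_countable space;
  atlas_cover : forall p, exists i, dom i p;
  dom_open : forall i, open (dom i);
  cdom_open : forall i, open (phi i @` dom i);
  phiK : forall i p, dom i p -> psi i (phi i p) = p;
  phi_continuous : forall i, {within dom i, continuous (phi i)};
  psi_continuous : forall i, {within phi i @` dom i, continuous (psi i)};
  transition_smooth : forall i j,
    smooth_on [set x | (phi i @` dom i) x /\ dom j (psi i x)]
      (phi j \o psi i)
}.

Definition cdom (R : realType) (n : nat) (M : manifold R n) (i : atlas M) :
    set 'rV[R]_n :=
  phi i @` dom i.

Definition inner (R : realType) (n : nat) (G : 'M[R]_n) (u v : 'rV[R]_n) : R :=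
  (u *m G *m v^T) 0 0.

(* gram i x is the matrix (g(d_a, d_b))_{a,b} in the chart i, at the point of
   coordinates x. Row a of 'J F x is the a-th partial derivative of F at x. *)
Record riemannian_metric (R : realType) (n : nat) (M : manifold R n) :=
  RiemannianMetric {
    gram : atlas M -> 'rV[R]_n -> 'M[R]_n;
    gram_smooth : forall i, smooth_on (cdom i) (gram i);
    gram_sym : forall i x, cdom i x -> (gram i x)^T = gram i x;
    gram_pos : forall i x, cdom i x ->
      forall v, v != 0 -> 0 < inner (gram i x) v v;
    gram_transition : forall i j x, cdom i x -> dom j (psi i x) ->
      let y := phi j \o psi i in
      gram i x = 'J y x *m gram j (y x) *m ('J y x)^T
  }.

(* Coordinates of the Levi-Civita derivative of d_b along d_a. *)
Definition christoffel (R : realType) (n : nat) (G : 'rV[R]_n -> 'M[R]_n)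
    (a b : 'I_n) (x : 'rV[R]_n) : 'rV[R]_n :=
  \row_c (2^-1 * \sum_(d < n) invmx (G x) c d *
    (partial a G x b d + partial b G x a d - partial d G x a b)).

(* R(u, v)w with the sign convention
   R(X, Y)Z = nabla_X nabla_Y Z - nabla_Y nabla_X Z - nabla_[X, Y] Z. *)
Definition curvature (R : realType) (n : nat) (G : 'rV[R]_n -> 'M[R]_n)
    (x u v w : 'rV[R]_n) : 'rV[R]_n :=
  \sum_(a < n) \sum_(b < n) \sum_(c < n) (u 0 a * v 0 b * w 0 c) *:
    (partial a (christoffel G b c) x - partial b (christoffel G a c) x
     + \sum_(e < n) (christoffel G b c x 0 e *: christoffel G a e x
                     - christoffel G a c x 0 e *: christoffel G b e x)).

Definition sectional_curvature (R : realType) (n : nat)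
    (G : 'rV[R]_n -> 'M[R]_n) (x u v : 'rV[R]_n) : R :=
  inner (G x) (curvature G x u v v) u /
  (inner (G x) u u * inner (G x) v v - inner (G x) u v ^+ 2).

Definition cartan_hadamard (R : realType) (n : nat) (M : manifold R n)
    (g : riemannian_metric M) : Prop :=
  forall (i : atlas M) (x u v : 'rV[R]_n), cdom i x ->
    row_free (col_mx u v) -> sectional_curvature (gram g i) x u v <= 0.

Definition geodesic (R : realType) (n : nat) (M : manifold R n)
    (g : riemannian_metric M) (gamma : R -> M) : Prop :=
  continuous gamma /\
  forall (i : atlas M) (t : R), dom i (gamma t) ->
    let c : R -> 'rV[R]_n := phi i \o gamma in
    [/\ derivable c t 1, derivable (derive1 c) t 1 &
        derive1 (derive1 c) t + \sum_(a < n) \sum_(b < n)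
          (derive1 c t 0 a * derive1 c t 0 b) *: christoffel (gram g i) a b (c t) = 0].

(* Geodesic completeness: the exponential map is defined on all of TM. *)
Definition complete_metric (R : realType) (n : nat) (M : manifold R n)
    (g : riemannian_metric M) : Prop :=
  forall (i : atlas M) (x v : 'rV[R]_n), cdom i x ->
    exists gamma : R -> M,
      [/\ geodesic g gamma, gamma 0 = psi i x & derive1 (phi i \o gamma) 0 = v].

Definition is_path (R : realType) (T : topologicalType) (x y : T)
    (gamma : R -> T) : Prop :=
  [/\ {within `[0, 1], continuous gamma}, gamma 0 = x & gamma 1 = y].

Definition null_homotopic (R : realType) (T : topologicalType) (x : T)
    (gamma : R -> T) : Prop :=
  exists H : R * R -> T,
    [/\ {within `[0, 1] `*` `[0, 1], continuous H},
        (forall t : R, t \in `[0, 1] -> H (0, t) = gamma t /\ H (1, t) = x) &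
        (forall s : R, s \in `[0, 1] -> H (s, 0) = x /\ H (s, 1) = x)].

Definition simply_connected (R : realType) (T : topologicalType) : Prop :=
  (forall x y : T, exists gamma : R -> T, is_path x y gamma) /\
  (forall (x : T) (gamma : R -> T), is_path x x gamma ->
     null_homotopic x gamma).

Definition local_rep (R : realType) (k n : nat) (N : manifold R k)
    (M : manifold R n) (f : N -> M) (i : atlas N) (j : atlas M) :
    'rV[R]_k -> 'rV[R]_n :=
  phi j \o f \o psi i.

Definition local_dom (R : realType) (k n : nat) (N : manifold R k)
    (M : manifold R n) (f : N -> M) (i : atlas N) (j : atlas M) :
    set 'rV[R]_k :=
  [set x | cdom i x /\ dom j (f (psi i x))].

Definition immersion (R : realType) (k n : nat) (N : manifold R k)
    (M : manifold R n) (f : N -> M) : Prop :=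
  continuous f /\
  forall (i : atlas N) (j : atlas M),
    smooth_on (local_dom f i j) (local_rep f i j) /\
    forall x, local_dom f i j x -> row_free ('J (local_rep f i j) x).

Definition induced_gram (R : realType) (k n : nat) (G : 'rV[R]_n -> 'M[R]_n)
    (F : 'rV[R]_k -> 'rV[R]_n) (x : 'rV[R]_k) : 'M[R]_k :=
  'J F x *m G (F x) *m ('J F x)^T.

(* Component of w orthogonal, for G (F x), to the span of the rows of 'J F x. *)
Definition normal_part (R : realType) (k n : nat) (G : 'rV[R]_n -> 'M[R]_n)
    (F : 'rV[R]_k -> 'rV[R]_n) (x : 'rV[R]_k) (w : 'rV[R]_n) : 'rV[R]_n :=
  w - w *m G (F x) *m ('J F x)^T *m invmx (induced_gram G F x) *m 'J F x.

(* II(d_i, d_j): normal part of the ambient covariant derivative of d_j F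
   along d_i F. *)
Definition second_fundamental_form (R : realType) (k n : nat)
    (G : 'rV[R]_n -> 'M[R]_n) (F : 'rV[R]_k -> 'rV[R]_n) (i j : 'I_k)
    (x : 'rV[R]_k) : 'rV[R]_n :=
  normal_part G F x
    (partial i (partial j F) x + \sum_(a < n) \sum_(b < n)
       ('J F x i a * 'J F x j b) *: christoffel G a b (F x)).

Definition mean_curvature (R : realType) (k n : nat)
    (G : 'rV[R]_n -> 'M[R]_n) (F : 'rV[R]_k -> 'rV[R]_n) (x : 'rV[R]_k) :
    'rV[R]_n :=
  k%:R^-1 *: \sum_(i < k) \sum_(j < k)
    invmx (induced_gram G F x) i j *: second_fundamental_form G F i j x.

Definition minimal (R : realType) (k n : nat) (N : manifold R k)
    (M : manifold R n) (g : riemannian_metric M) (f : N -> M) : Prop :=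
  forall (i : atlas N) (j : atlas M) (x : 'rV[R]_k), local_dom f i j x ->
    mean_curvature (gram g j) (local_rep f i j) x = 0.

(* Main.v *)
(* Fix a point p of the submanifold N. Nonpositive curvature makes Jacobi fields
   vanishing at p grow at least linearly (Sturm comparison of |J|^2 with t^2), so
   exp_p is a local diffeomorphism that expands lengths. Hence it lifts segments,
   i.e. it is a covering map, and as M is simply connected it is a bijection with
   continuous inverse log_p. By the Gauss lemma the derivative of h = |log_p|^2
   is 2 <eta, .> with eta the radial field, and the same comparison
   (<DJ, J> >= |J|^2) bounds the Hessian of h below by 2 g. At a maximum of h on
   N, eta is normal to N, so for each tangent vector e
     |e|^2 + <eta, II(e, e)> <= 0
   up to tangential terms killed by eta; the trace over an orthonormal basis of
   T N contradicts the vanishing of the mean curvature. *)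
Require Import Defs.
From HB Require Import structures.
From mathcomp Require Import all_boot all_order all_algebra.
From mathcomp Require Import all_classical all_reals all_analysis.
From mathcomp Require Import ring lra.
Import Order.TTheory GRing.Theory Num.Theory.
Import numFieldNormedType.Exports.

Set Implicit Arguments.
Unset Strict Implicit.
Unset Printing Implicit Defensive.

Local Open Scope classical_set_scope.
Local Open Scope ring_scope.

(** * Calculus on the line *)

Section Calculus.
Variable R : realType.

(** Completeness only asserts that some geodesic exists for each initial velocity at p, so the
    family of geodesics from p comes from choice, and nothing is known in advance about its
    dependence on the velocity, except at time 0, where the phase is affine in it. Differentiability
    is therefore carried along each geodesic by Gronwall estimates, chart after chart. What is
    carried is strict differentiability at one point, which suffices for an inverse function theorem
    there. The covering property rests on a uniform statement: near any point of M, expansion bounds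
    the inverse derivative at all preimages by one constant. Lifts of coordinate segments then share
    a Lipschitz constant, so partial lifts stay in a compact ball and extend to the end. No Hessian
    of h is formed: h is differentiated twice along images of coordinate lines of N, and the bound
    is read from <DJ, J> at time 1 for the Jacobi field J that ends at the velocity of the curve.
    The orthonormal basis for the trace comes from a Cholesky factor of the inverse Gram matrix. *)

Lemma half_lt (e : R) : 0 < e -> e / 2 < e.
Proof. by move=> e0; rewrite ltr_pdivrMr // ltr_pMr // ltr1n. Qed.

Lemma norm_coord m n (x : 'M[R]_(m, n)) i j : `|x i j| <= `|x|.
Proof. by rewrite [leRHS]/Num.norm /= mx_normrE (le_bigmax _ _ (i, j)). Qed.

Lemma norm_le_coord m n (x : 'M[R]_(m, n)) e :
  0 <= e -> (forall i j, `|x i j| <= e) -> `|x| <= e.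
Proof.
by move=> e0 xe; rewrite [leLHS]/Num.norm /= mx_normrE bigmax_le.
Qed.

Lemma norm_mulmx m d n (x : 'M[R]_(m, d)) (A : 'M[R]_(d, n)) :
  `|x *m A| <= d%:R * `|x| * `|A|.
Proof.
apply: norm_le_coord => [|i j]; first by rewrite !mulr_ge0.
rewrite mxE (le_trans (ler_norm_sum _ _ _)) //.
rewrite (@le_trans _ _ (\sum_(k < d) `|x| * `|A|)) //.
  apply: ler_sum => k _; rewrite normrM ler_pM ?norm_coord //.
by rewrite sumr_const card_ord -mulrA mulr_natl.
Qed.

Lemma is_derive_coord (V : normedModType R) m n (f : V -> 'M[R]_(m, n)) df t v i j :
  is_derive t v f df -> is_derive t v (fun s => f s i j) (df i j).
Proof.
move=> [fd fE]; split; first exact/(derivable_mxP f t v).1.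
by rewrite -fE (derive_mx fd) mxE.
Qed.

Lemma is_derive_mx (V : normedModType R) m n (f : V -> 'M[R]_(m, n))
    (df : 'M[R]_(m, n)) t v :
  (forall i j, is_derive t v (fun s => f s i j) (df i j)) -> is_derive t v f df.
Proof.
move=> fd; have dd : derivable f t v.
  by apply/derivable_mxP => i j; case: (fd i j).
split=> //; rewrite (derive_mx dd); apply/matrixP => i j; rewrite mxE.
by case: (fd i j).
Qed.

Lemma is_derive_continuous (W : normedModType R) (f : R -> W) (df : W) (t : R) :
  is_derive t (1 : R) f df -> {for t, continuous f}.
Proof.
by move=> [/derivable1_diffP fd _]; exact: differentiable_continuous.
Qed.

Lemma real_mvt_oo (f f' : R -> R) (a b C : R) : a < b ->
  (forall t, a <= t <= b -> is_derive t 1 f (f' t)) ->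
  (forall t, a < t < b -> f' t <= C) -> f b - f a <= C * (b - a).
Proof.
move=> ab fd fC.
have [||c cab ->] := @MVT R f f' a b ab.
- by move=> x /itvP xab; apply: fd; rewrite !xab.
- apply/continuous_in_subspaceT => x; rewrite inE /= => /itvP xab.
  by apply: is_derive_continuous; apply: fd; rewrite !xab.
by rewrite ler_wpM2r ?subr_ge0 ?(ltW ab) // fC // !(itvP cab).
Qed.

Lemma real_mvt_le (f f' : R -> R) (a b C : R) : a <= b ->
  (forall t, a <= t <= b -> is_derive t 1 f (f' t)) ->
  (forall t, a <= t <= b -> f' t <= C) -> f b - f a <= C * (b - a).
Proof.
rewrite le_eqVlt => /predU1P[<- _ _|ab fd fC]; first by rewrite !subrr mulr0.
by apply: real_mvt_oo ab fd _ => t /andP[? ?]; rewrite fC // !ltW.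
Qed.

Lemma vec_mvt_oo m n (f f' : R -> 'M[R]_(m, n)) (a b C : R) : a < b ->
  (forall t, a <= t <= b -> is_derive t 1 f (f' t)) ->
  (forall t, a < t < b -> `|f' t| <= C) -> `|f b - f a| <= C * (b - a).
Proof.
move=> ab fd fC; have C0 : 0 <= C.
  rewrite (le_trans _ (fC ((a + b) / 2) _)) //.
  by apply/andP; split; [rewrite ltr_pdivlMr|rewrite ltr_pdivrMr] => //; lra.
apply: norm_le_coord => [|i j]; first by rewrite mulr_ge0 // subr_ge0 ltW.
have dij t : a <= t <= b -> is_derive t 1 (fun s => f s i j) (f' t i j).
  by move=> /fd; exact: is_derive_coord.
have bij t : a < t < b -> `|f' t i j| <= C.
  by move=> /fC; apply: le_trans; exact: norm_coord.
rewrite !mxE ler_norml; apply/andP; split; last first.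
  by apply: real_mvt_oo ab dij _ => t /bij; exact/le_trans/ler_norm.
have := @real_mvt_oo (fun s => - f s i j) (fun s => - f' s i j) a b C ab.
rewrite -opprD lerNl; apply.
  by move=> t /dij ?; apply: is_deriveN.
by move=> t /bij; rewrite -normrN; exact/le_trans/ler_norm.
Qed.

Lemma vec_mvt m n (f f' : R -> 'M[R]_(m, n)) (a b C : R) : a <= b ->
  (forall t, a <= t <= b -> is_derive t 1 f (f' t)) ->
  (forall t, a <= t <= b -> `|f' t| <= C) -> `|f b - f a| <= C * (b - a).
Proof.
rewrite le_eqVlt => /predU1P[<- _ _|ab fd fC]; first by rewrite !subrr normr0 mulr0.
by apply: vec_mvt_oo ab fd _ => t /andP[? ?]; rewrite fC // !ltW.
Qed.

Lemma vec_mvt_abs m n (f f' : R -> 'M[R]_(m, n)) (a r C : R) :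
  (forall t, `|t - a| < r -> is_derive t 1 f (f' t)) ->
  (forall t, `|t - a| < r -> `|f' t| <= C) ->
  forall s t, `|s - a| < r -> `|t - a| < r -> `|f t - f s| <= C * `|t - s|.
Proof.
move=> fd fC s t sr tr; wlog st : s t sr tr / s <= t.
  move=> H; have [/H->//|/ltW ts] := leP s t.
  by rewrite distrC (distrC t) H.
have btw u : s <= u <= t -> `|u - a| < r.
  move: sr tr; rewrite !ltr_norml => /andP[? ?] /andP[? ?] /andP[? ?].
  by apply/andP; split; lra.
rewrite (ger0_norm (x := t - s)) ?subr_ge0 //.
by apply: vec_mvt => // u /btw; [exact: fd|exact: fC].
Qed.

(** Let T be the supremum of the t such that P holds on [a, t]: [limP] reaches T, and [nextP] would
    pass it if T < b. *)
Lemma real_induction (P : R -> Prop) (a b : R) : a <= b -> P a ->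
  (forall t, a < t <= b -> (forall s, a <= s < t -> P s) -> P t) ->
  (forall t, a <= t < b -> (forall s, a <= s <= t -> P s) ->
     exists2 e : R, 0 < e & forall s, t < s < t + e -> P s) ->
  forall t, a <= t <= b -> P t.
Proof.
move=> ab Pa limP nextP.
pose S := [set t | a <= t <= b /\ forall s, a <= s <= t -> P s].
have Sa : S a.
  split; first by rewrite lexx ab.
  by move=> s /andP[sa1 sa2]; have -> : s = a by apply/eqP; rewrite eq_le sa1 sa2.
have hS : has_sup S.
  by split; [exists a|exists b => x [/andP[]]].
have ST := sup_upper_bound hS.
set T := sup S in ST.
have aT : a <= T by exact: ST.
have Tb : T <= b by apply: ge_sup => //; [exists a|move=> x [/andP[]]].
have PT s : a <= s < T -> P s.
  move=> /andP[as_ sT].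
  have [u Su su] := sup_adherent (eps := T - s) ltac:(by rewrite subr_gt0) hS.
  move: su; rewrite -/T opprB addrC subrK => su.
  by case: Su => _; apply; rewrite as_ ltW.
have PTT s : a <= s <= T -> P s.
  move=> /andP[as_ sT]; have [sT'|Ts] := ltP s T; first by apply: PT; rewrite as_.
  have -> : s = T by apply/eqP; rewrite eq_le sT Ts.
  have [aT'|Ta] := ltP a T; first by apply: limP => //; rewrite aT'.
  by have -> : T = a by apply/eqP; rewrite eq_le aT Ta.
have [Tb'|bT] := ltP T b; last first.
  by move=> t /andP[t1 t2]; apply: PTT; rewrite t1 (le_trans t2).
exfalso; have [||e e0 He] := nextP T => //; first by rewrite aT.
pose u := Num.min b (T + e / 2).
have Tu : T < u by rewrite lt_min Tb' ltrDl divr_gt0.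
have : u <= T.
  apply: ST; split; first by rewrite (le_trans aT (ltW Tu)) ge_min lexx.
  move=> s /andP[as_ su]; have [sT|Ts] := leP s T; first by apply: PTT; rewrite as_.
  apply: He; rewrite Ts /= (le_lt_trans su) // gt_min; apply/orP; right.
  by rewrite ltrD2l half_lt.
by rewrite leNgt Tu.
Qed.

(** Connectedness of the line: near each t a single radius transports P between any two times. Times
    before [a] follow by reflection. *)
Lemma loc_const_induction (P : R -> Prop) (a : R) : P a ->
  (forall t, exists2 e : R, 0 < e & forall s u, `|s - t| < e -> `|u - t| < e -> P s -> P u) ->
  forall t, P t.
Proof.
move=> Pa locP.
have fwd (Q : R -> Prop) b c : b <= c -> Q b ->
    (forall t, exists2 e : R, 0 < e & forall s u, `|s - t| < e -> `|u - t| < e -> Q s -> Q u) ->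
    Q c.
  move=> bc Qb locQ; apply: (@real_induction Q b c) => //.
  - move=> t /andP[bt tc] Hs; have [e e0 He] := locQ t.
    apply: (He (Num.max b (t - e / 2))); last first.
    + by apply: Hs; rewrite le_max lexx gt_max bt /= ltrBlDr ltrDl divr_gt0.
    + by rewrite subrr normr0.
    + have : t - e / 2 <= Num.max b (t - e / 2) by rewrite le_max lexx orbT.
      have : Num.max b (t - e / 2) < t by rewrite gt_max bt /= ltrBlDr ltrDl divr_gt0.
      by move=> ? ?; rewrite ltr_norml; apply/andP; split; lra.
  - move=> t /andP[bt tc] Hs; have [e e0 He] := locQ t; exists e => // s /andP[ts se].
    apply: (He t); rewrite ?subrr ?normr0 //; last by apply: Hs; rewrite bt lexx.
    by rewrite ltr_norml; apply/andP; split; lra.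
  - by rewrite bc lexx.
move=> t; have [at_|/ltW ta] := leP a t; first exact: (fwd P a t).
rewrite -(opprK t); apply: (fwd (fun s => P (- s)) (- a) (- t)).
- by rewrite lerN2.
- by rewrite opprK.
move=> u; have [e e0 He] := locP (- u); exists e => // s s' su s'u.
by apply: He; rewrite -opprD normrN.
Qed.

(** Induction on the distance to [a], run on both sides at once, since [limP] asks for the whole
    open interval of smaller radius. *)
Lemma real_induction_open (P : R -> Prop) (a r : R) : P a ->
  (forall t, 0 < `|t - a| < r -> (forall s, `|s - a| < `|t - a| -> P s) -> P t) ->
  (forall t, `|t - a| < r -> P t -> exists2 e : R, 0 < e & forall s, `|s - t| < e -> P s) ->
  forall t, `|t - a| < r -> P t.
Proof.
move=> Pa limP openP t tr.
pose Q d := P (a + d) /\ P (a - d).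
have dE d : 0 <= d -> `|a + d - a| = d /\ `|a - d - a| = d.
  move=> d0; split; first by (have -> : a + d - a = d by ring); rewrite ger0_norm.
  by (have -> : a - d - a = - d by ring); rewrite normrN ger0_norm.
suff [Q1 Q2] : Q `|t - a|.
  have [at_|ta] := leP a t; first by rewrite ger0_norm ?subr_ge0 // subrKC in Q1.
  by rewrite ltr0_norm ?subr_lt0 // opprK subrKC in Q2.
apply: (@real_induction Q 0 `|t - a|) => //; last by rewrite normr_ge0 lexx.
- by split; rewrite ?addr0 ?subr0.
- move=> d /andP[d0 dt] H; have [e1 e2] := dE d (ltW d0).
  have H' s : `|s - a| < d -> P s.
    move=> sd; have [|Q1 Q2] := H `|s - a|; first by rewrite normr_ge0.
    have [as_|sa] := leP a s; first by rewrite ger0_norm ?subr_ge0 // subrKC in Q1.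
    by rewrite ltr0_norm ?subr_lt0 // opprK subrKC in Q2.
  split; apply: limP; rewrite ?e1 ?e2 ?d0 /= ?(le_lt_trans dt) // => s.
move=> d /andP[d0 dt] H; have [e1 e2] := dE d d0.
have [|Q1 Q2] := H d; first by rewrite d0 lexx.
have [|x x0 Hx] := openP (a + d) _ Q1; first by rewrite e1 (lt_trans dt).
have [|y y0 Hy] := openP (a - d) _ Q2; first by rewrite e2 (lt_trans dt).
exists (Num.min x y); first by rewrite lt_min x0.
move=> s /andP[ds]; rewrite -ltrBlDl lt_min => /andP[sx sy].
have sd0 : 0 <= s - d by rewrite subr_ge0 ltW.
split; [apply: Hx|apply: Hy].
  by (have -> : a + s - (a + d) = s - d by ring); rewrite ger0_norm.
by (have -> : a - s - (a - d) = - (s - d) by ring); rewrite normrN ger0_norm.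
Qed.

End Calculus.

(** * Gronwall inequality and uniform limits *)

Section Gronwall.
Variable R : realType.

Lemma sum_le_card m (F : 'I_m -> R) c : (forall i, F i <= c) -> \sum_i F i <= m%:R * c.
Proof.
move=> Fc; apply: (@le_trans _ _ (\sum_(i < m) c)); first exact: ler_sum.
by rewrite sumr_const card_ord mulr_natl.
Qed.

Lemma is_derive_mulf (f g : R -> R) (df dg t : R) :
  is_derive t 1 f df -> is_derive t 1 g dg ->
  is_derive t 1 (fun s => f s * g s) (df * g t + f t * dg).
Proof.
move=> hf hg; have := is_deriveM hf hg; rewrite /GRing.scale /= addrC (mulrC _ df).
exact.
Qed.

Lemma is_derive_sumf (V W : normedModType R) m (F : 'I_m -> V -> W) dF t v :
  (forall i, is_derive t v (F i) (dF i)) ->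
  is_derive t v (fun s => \sum_i F i s) (\sum_i dF i).
Proof.
move=> hF; have := is_derive_sum hF.
suff -> : (fun s => \sum_i F i s) = \sum_i F i by [].
by apply/funext => s; rewrite fct_sumE.
Qed.

(** The function (f + c) exp (- K (t - a)) is nonincreasing. *)
Lemma gronwall_scalar (f f' : R -> R) (a b K c : R) : a <= b ->
  (forall t, a <= t <= b -> is_derive t 1 f (f' t)) ->
  (forall t, a <= t <= b -> f' t <= K * (f t + c)) ->
  f b + c <= (f a + c) * expR (K * (b - a)).
Proof.
move=> ab df f'le.
pose g t := (f t + c) * expR (- K * (t - a)).
have dg t : a <= t <= b ->
    is_derive t 1 g ((f' t - K * (f t + c)) * expR (- K * (t - a))).
  move=> /df ft.
  have de : is_derive t 1 (fun s => expR (- K * (s - a))) (- K * expR (- K * (t - a))).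
    have h : is_derive t 1 (fun s : R => - K * (s - a)) (- K).
      by apply: is_derive_eq; rewrite subr0 /GRing.scale /= mulr1.
    have := @is_derive1_comp R expR (fun s => - K * (s - a)) t _ _ (is_derive_expR _) h.
    by rewrite mulrC.
  apply: is_derive_eq; rewrite addr0 /GRing.scale /=; ring.
have := @real_mvt_le R g _ a b 0 ab dg.
rewrite mul0r subr_le0 => gle.
have : g b <= g a.
  apply: gle => t /f'le tle; rewrite mulr_le0_ge0 ?expR_ge0 // subr_le0 //.
rewrite /g subrr mulr0 expR0 mulr1 mulNr expRN ler_pdivrMr ?expR_gt0 //.
Qed.

Lemma sum_sqr_bounds m (u : 'rV[R]_m) :
  `|u| ^+ 2 <= \sum_i u 0 i ^+ 2 /\ \sum_i u 0 i ^+ 2 <= m%:R * `|u| ^+ 2.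
Proof.
have s0 : 0 <= \sum_i u 0 i ^+ 2 by apply: sumr_ge0 => i _; exact: sqr_ge0.
split.
  rewrite -(sqr_sqrtr s0) ler_sqr ?nnegrE ?sqrtr_ge0 //.
  apply: norm_le_coord => [|i j]; first exact: sqrtr_ge0.
  rewrite ord1 -sqrtr_sqr ler_wsqrtr // (bigD1 j) //= lerDl.
  by apply: sumr_ge0 => k _; exact: sqr_ge0.
apply: sum_le_card => i.
by rewrite -[leLHS]real_normK ?num_real // ler_sqr ?nnegrE // norm_coord.
Qed.

(** The sup norm is not differentiable, so the scalar inequality is applied to the sum of squares,
    which is comparable to its square up to the factor [m]; hence the constant under the square
    root. *)
Lemma gronwall_fwd m (u u' : R -> 'rV[R]_m) (a b L eta : R) :
  a <= b -> 0 <= L -> 0 <= eta ->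
  (forall t, a <= t <= b -> is_derive t 1 u (u' t)) ->
  (forall t, a <= t <= b -> `|u' t| <= L * `|u t| + eta) ->
  `|u b| <= Num.sqrt (m.+1%:R * expR (m%:R * (2 * L + 1) * (b - a))) * (`|u a| + eta).
Proof.
move=> ab L0 eta0 du u'le.
pose f t := \sum_i u t 0 i ^+ 2.
pose f' t := \sum_i 2 * (u t 0 i * u' t 0 i).
have df t : a <= t <= b -> is_derive t 1 f (f' t).
  move=> /du ut; rewrite /f /f'.
  apply: is_derive_sumf => i; have uti := is_derive_coord 0 i ut.
  have -> : (fun s => u s 0 i ^+ 2) = (fun s => u s 0 i * u s 0 i).
    by apply/funext => s; rewrite expr2.
  by apply: (is_derive_eq (is_derive_mulf uti uti)); ring.
set K := m%:R * (2 * L + 1).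
(* 2 |u| eta <= |u|^2 + eta^2 turns the bound on u' into one on f'; this accounts for the 1 in K. *)
have f'le t : a <= t <= b -> f' t <= K * (f t + eta ^+ 2).
  move=> /u'le ut; have [fu _] := sum_sqr_bounds (u t).
  rewrite -/(f t) in fu.
  have : f' t <= m%:R * (2 * (`|u t| * (L * `|u t| + eta))).
    apply: sum_le_card => i.
    rewrite ler_wpM2l // (le_trans (ler_norm _)) // normrM ler_pM ?norm_coord //.
    by rewrite (le_trans (norm_coord _ _ _)).
  move/le_trans; apply; rewrite /K -mulrA ler_wpM2l //.
  have := sqr_ge0 (`|u t| - eta).
  have h1 : (2 * L + 1) * `|u t| ^+ 2 <= (2 * L + 1) * f t.
    by rewrite ler_wpM2l // addr_ge0 // mulr_ge0.
  have : 0 <= L * eta ^+ 2 by rewrite mulr_ge0 // sqr_ge0.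
  move: h1; nra.
have := gronwall_scalar ab df f'le.
set E := expR _ => fle.
have [fu _] := sum_sqr_bounds (u b); have [_ fa] := sum_sqr_bounds (u a).
rewrite -/(f b) in fu; rewrite -/(f a) in fa.
have E0 : 0 < E by exact: expR_gt0.
rewrite -ler_sqr ?nnegrE ?mulr_ge0 ?sqrtr_ge0 ?addr_ge0 //.
rewrite exprMn sqr_sqrtr ?mulr_ge0 ?(ltW E0) //.
have e2 := sqr_ge0 eta.
apply: (le_trans fu); apply: (@le_trans _ _ ((f a + eta ^+ 2) * E)).
  by apply: le_trans fle; rewrite lerDl.
rewrite (mulrC m.+1%:R) -mulrA mulrC ler_wpM2l ?(ltW E0) //.
apply: (@le_trans _ _ (m.+1%:R * (`|u a| ^+ 2 + eta ^+ 2))).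
  rewrite -natr1 mulrDl mul1r mulrDr.
  have : 0 <= m%:R * eta ^+ 2 by rewrite mulr_ge0.
  have := sqr_ge0 `|u a|; move: fa; lra.
rewrite ler_wpM2l // sqrrD.
have : 0 <= `|u a| * eta by rewrite mulr_ge0.
by rewrite mulr2n; lra.
Qed.

(** The constant depends on m, L and r only, so that it serves all differences of solutions at once.
    Times before [a] are handled by reversing time. *)
Lemma gronwall (m : nat) (L r : R) : 0 <= L -> 0 < r ->
  exists2 C : R, 0 < C & forall (u u' : R -> 'rV[R]_m) (a eta : R), 0 <= eta ->
  (forall t, `|t - a| < r -> is_derive t 1 u (u' t)) ->
  (forall t, `|t - a| < r -> `|u' t| <= L * `|u t| + eta) ->
  forall t, `|t - a| < r -> `|u t| <= C * (`|u a| + eta).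
Proof.
move=> L0 r0; exists (Num.sqrt (m.+1%:R * expR (m%:R * (2 * L + 1) * r))).
  by rewrite sqrtr_gt0 mulr_gt0 // expR_gt0.
move=> u u' a eta eta0 du u'le t tr.
have K0 : 0 <= m%:R * (2 * L + 1) by rewrite mulr_ge0 // addr_ge0 // mulr_ge0.
have mono x : x <= r -> Num.sqrt (m.+1%:R * expR (m%:R * (2 * L + 1) * x)) *
      (`|u a| + eta) <= Num.sqrt (m.+1%:R * expR (m%:R * (2 * L + 1) * r)) *
      (`|u a| + eta).
  move=> xr; rewrite ler_wpM2r ?addr_ge0 // ler_wsqrtr // ler_wpM2l //.
  by rewrite ler_expR ler_wpM2l.
have [at_|/ltW ta] := leP a t.
  have tr' : t - a < r by apply: le_lt_trans tr; exact: ler_norm.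
  have ok s : a <= s <= t -> `|s - a| < r.
    by move=> /andP[? ?]; rewrite ger0_norm ?subr_ge0 //; lra.
  apply: le_trans (mono _ (ltW tr')).
  by apply: gronwall_fwd => // s /ok; [exact: du|exact: u'le].
have tr' : a - t < r by apply: le_lt_trans tr; rewrite distrC; exact: ler_norm.
have ok s : - a <= s <= - t -> `|- s - a| < r.
  by move=> /andP[? ?]; rewrite ler0_norm; lra.
apply: le_trans (mono _ (ltW tr')).
have := @gronwall_fwd m (fun s => u (- s)) (fun s => - u' (- s)) (- a) (- t) L eta.
have -> : - t - - a = a - t by rewrite opprK addrC.
rewrite (opprK t) (opprK a); apply => //; first by rewrite lerN2.
  move=> s /ok /du us.
  have dN : is_derive s 1 (-%R : R -> R) (-1) by apply: is_deriveN.
  apply: is_derive_mx => i j; rewrite mxE.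
  have ui := is_derive_coord i j us.
  have := @is_derive1_comp R (fun s => u s i j) -%R s _ _ ui dN.
  by rewrite mulrN1.
by move=> s /ok /u'le; rewrite normrN.
Qed.

(** The limit inherits the modulus [N]: a modulus shared by a family of sequences makes their
    convergence uniform over the family. *)
Lemma cauchy_mx m n (u : nat -> 'M[R]_(m, n)) (N : R -> nat) :
  (forall e : R, 0 < e -> forall k l, (N e <= k)%N -> (N e <= l)%N -> `|u k - u l| <= e) ->
  exists l, forall e : R, 0 < e -> forall k, (N e <= k)%N -> `|u k - l| <= e.
Proof.
move=> cu.
have cv i j : cvgn (fun k => u k i j).
  apply/cauchy_cvgP/cauchy_ballP => e e0; near_simpl.
  exists ([set k | (N (e / 2) <= k)%N], [set k | (N (e / 2) <= k)%N]).
    by split; exists (N (e / 2)).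
  move=> [k l] /= [Nk Nl]; rewrite /ball /=.
  have e2 := half_lt e0.
  apply: le_lt_trans e2; apply: le_trans (cu _ _ k l Nk Nl); last by rewrite divr_gt0.
  by have := norm_coord (u k - u l) i j; rewrite !mxE.
exists (\matrix_(i, j) limn (fun k => u k i j)) => e e0 k Nk.
apply: norm_le_coord; first exact: ltW.
move=> i j; rewrite !mxE; apply/ler_addgt0Pr => e' e'0.
have /cvgrPdist_le /(_ _ e'0) [K _ HK] := cv i j.
set l := maxn K (N e).
rewrite (le_trans (ler_distD (u l i j) _ _)) // lerD //.
  have := cu _ e0 k l Nk (leq_maxr _ _); apply: le_trans.
  by have := norm_coord (u k - u l) i j; rewrite !mxE.
by rewrite distrC; apply: HK; rewrite /= leq_maxl.
Qed.

Lemma is_derive_eps (W : normedModType R) (f : R -> W) (l : W) (t : R) :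
  (forall e : R, 0 < e -> exists2 d : R, 0 < d &
     forall h, `|h| < d -> `|f (t + h) - f t - h *: l| <= e * `|h|) ->
  is_derive t 1 f l.
Proof.
move=> H.
have cv : (h^-1 *: (f (h *: 1 + t) - f t)) @[h --> 0^'] --> l.
  apply/cvgrPdist_le => e e0; have [d d0 Hd] := H _ e0.
  near=> h.
  have h0 : h != 0 by near: h; exact: nbhs_dnbhs_neq.
  have hd : `|h| < d by near: h; exact: dnbhs0_lt.
  have -> : l - h^-1 *: (f (h *: 1 + t) - f t) = - (h^-1 *: (f (t + h) - f t - h *: l)).
    rewrite [h *: 1]mulr1 (addrC h) [h^-1 *: (_ - h *: l)]scalerBr scalerA mulVf //.
    by rewrite scale1r opprB.
  by rewrite normrN normrZ normfV ler_pdivrMl ?normr_gt0 // mulrC Hd.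
split; first by apply/cvg_ex; exists l.
exact/cvg_lim.
Unshelve. all: by end_near. Qed.

Lemma is_derive_line0 (W : normedModType R) (v : W) (t : R) :
  is_derive t 1 (fun s : R => s *: v) v.
Proof.
apply: is_derive_eps => e e0; exists 1 => // h _.
by rewrite scalerDl (addrAC (t *: v)) subrr add0r subrr normr0 mulr_ge0 // ltW.
Qed.

(** The mean value inequality bounds the increment of q k s - s G(t) by e |h|; q k is replaced by
    its limit J afterwards, at the two ends t and t + h only. *)
Lemma is_derive_lim m n (q q' : nat -> R -> 'M[R]_(m, n)) (J G : R -> 'M[R]_(m, n))
    (a r t : R) :
  (forall k s, `|s - a| < r -> is_derive s 1 (q k) (q' k s)) ->
  (forall e : R, 0 < e -> exists N, forall k, (N <= k)%N ->
     forall s, `|s - a| < r -> `|q k s - J s| <= e /\ `|q' k s - G s| <= e) ->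
  `|t - a| < r ->
  (forall e : R, 0 < e -> exists2 d : R, 0 < d & forall s, `|s - t| < d -> `|G s - G t| <= e) ->
  is_derive t 1 J (G t).
Proof.
move=> dq unif tr contG; apply: is_derive_eps => e e0.
have e2 : 0 < e / 2 by rewrite divr_gt0.
have [d1 d10 Hd1] := contG _ e2.
have [N HN] := unif _ e2.
pose d := Num.min d1 (r - `|t - a|).
have d0 : 0 < d by rewrite lt_min d10 subr_gt0.
exists d => // h hd.
apply/ler_addgt0Pr => e' e'0; have e'2 : 0 < e' / 2 by rewrite divr_gt0.
have [K HK] := unif _ e'2; set k := maxn N K.
have near_t s : `|s - t| < d -> `|s - a| < r /\ `|s - t| < d1.
  rewrite lt_min => /andP[sd1 sr]; split=> //.
  by rewrite (le_lt_trans (ler_distD t _ _)) // -ltrBrDr.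
pose g s := q k s - s *: G t.
have dg s : `|s - t| < d -> is_derive s 1 g (q' k s - G t).
  move=> /near_t[sr _]; have qs := dq k s sr.
  have ds : is_derive s 1 (fun x : R => x *: G t) (G t).
    exact: is_derive_line0.
  exact: is_deriveB.
have bg s : `|s - t| < d -> `|q' k s - G t| <= e.
  move=> /near_t[sr sd]; rewrite (splitr e) -(subrKA (G s)).
  rewrite (le_trans (ler_normD _ _)) // lerD //.
    by have [] := HN k (leq_maxl _ _) s sr.
  exact: Hd1.
have thE : t + h - t = h by rewrite addrAC subrr add0r.
have gh : `|g (t + h) - g t| <= e * `|h|.
  have := @vec_mvt_abs R m n g (fun s => q' k s - G t) t d e dg bg t (t + h).
  by rewrite thE subrr normr0; apply.
have gE : g (t + h) - g t = q k (t + h) - q k t - h *: G t.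
  by rewrite /g scalerDl; apply/matrixP => i j; rewrite !mxE; ring.
have th : `|t + h - a| < r by have [] := near_t (t + h); rewrite // thE.
have [k1 _] := HK k (leq_maxr _ _) _ th; have [k2 _] := HK k (leq_maxr _ _) _ tr.
rewrite gE in gh.
have -> : J (t + h) - J t - h *: G t = (q k (t + h) - q k t - h *: G t)
    + (q k t - J t) - (q k (t + h) - J (t + h)).
  by apply/matrixP => i j; rewrite !mxE; ring.
apply: (le_trans (ler_normB _ _)); have -> : e * `|h| + e' = e * `|h| + e' / 2 + e' / 2 by lra.
apply: lerD k1.
by apply: (le_trans (ler_normD _ _)); exact: lerD.
Qed.

End Gronwall.

(** * Strict differentiability and dependence on initial conditions *)

Section StrictDifferentiability.
Variable R : realType.

Lemma le_div_scale (a b c C : R) : 0 < C -> 0 <= a -> b <= C * c -> a / C * b <= a * c.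
Proof. by move=> C0 a0 h; rewrite mulrAC ler_pdivrMr // -mulrA ler_wpM2l // mulrC. Qed.

Lemma le_mul_div (K a x y : R) : 0 <= K -> 0 <= x -> x <= a / (K + 1) * y -> K * x <= a * y.
Proof.
move=> K0 x0; rewrite mulrAC ler_pdivlMr ?ltr_wpDl // => h.
by apply: le_trans h; rewrite mulrC ler_wpM2l // lerDl.
Qed.

(* Strict differentiability: it gives an inverse function theorem at a single
   point, and it is what differentiability in the initial condition of the
   flow of a C^1 vector field yields directly. *)
Definition sdiff d m (F : 'rV[R]_d -> 'rV[R]_m) (x : 'rV[R]_d) (D : 'M[R]_(d, m)) :=
  forall e : R, 0 < e -> exists2 r : R, 0 < r & forall y z, `|y - x| < r -> `|z - x| < r ->
    `|F y - F z - (y - z) *m D| <= e * `|y - z|.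

Lemma sdiff_lipschitz d m (F : 'rV[R]_d -> 'rV[R]_m) x D : sdiff F x D ->
  exists r C : R, [/\ 0 < r, 0 < C & forall y z, `|y - x| < r -> `|z - x| < r ->
    `|F y - F z| <= C * `|y - z|].
Proof.
move=> /(_ 1 ltr01)[r r0 Hr]; exists r, (1 + d%:R * `|D|); split=> //.
move=> y z yr zr; rewrite -(subrK ((y - z) *m D) (F y - F z)).
rewrite (le_trans (ler_normD _ _)) // mulrDl lerD ?Hr //.
by rewrite (le_trans (norm_mulmx _ _)) // mulrAC.
Qed.

Lemma sdiff_linear d m (D : 'M[R]_(d, m)) x (c : 'rV[R]_m) : sdiff (fun y => y *m D + c) x D.
Proof.
move=> e e0; exists 1 => // y z _ _.
rewrite opprD addrACA subrr addr0 mulmxBl subrr normr0.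
by rewrite mulr_ge0 // ltW.
Qed.

Lemma sdiff_comp d m n (F : 'rV[R]_d -> 'rV[R]_m) (G : 'rV[R]_m -> 'rV[R]_n) x D E :
  sdiff F x D -> sdiff G (F x) E -> sdiff (G \o F) x (D *m E).
Proof.
move=> sF sG e e0.
have [r1 [C [r10 C0 HC]]] := sdiff_lipschitz sF.
have e1 : 0 < e / 2 / C by rewrite !divr_gt0.
have [r2 r20 Hr2] := sG _ e1.
have E0 : 0 < m%:R * `|E| + 1 by rewrite ltr_wpDl // mulr_ge0.
have e2 : 0 < e / 2 / (m%:R * `|E| + 1) by rewrite !divr_gt0.
have [r3 r30 Hr3] := sF _ e2.
exists (Num.min (Num.min r1 r3) (r2 / C)).
  by rewrite !lt_min r10 r30 divr_gt0.
move=> y z; rewrite !lt_min => /andP[/andP[y1 y3] y2] /andP[/andP[z1 z3] z2].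
have x1 : `|x - x| < r1 by rewrite subrr normr0.
have FyC w : `|w - x| < r1 -> `|w - x| < r2 / C -> `|F w - F x| < r2.
  move=> w1 w2; apply: (le_lt_trans (HC _ _ w1 x1)).
  by rewrite mulrC -ltr_pdivlMr.
have -> : (G \o F) y - (G \o F) z - (y - z) *m (D *m E) =
   (G (F y) - G (F z) - (F y - F z) *m E) + (F y - F z - (y - z) *m D) *m E.
  by rewrite mulmxA [(F y - F z - _) *m E]mulmxBl addrA subrK.
rewrite (le_trans (ler_normD _ _)) // (splitr e) mulrDl lerD //.
  apply: (le_trans (Hr2 _ _ (FyC _ y1 y2) (FyC _ z1 z2))).
  by apply: le_div_scale; rewrite ?HC // divr_ge0 // ltW.
apply: (le_trans (norm_mulmx _ _)); rewrite mulrAC.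
by apply: le_mul_div; rewrite ?Hr3 // mulr_ge0.
Qed.

Lemma sdiff_ext d m (F G : 'rV[R]_d -> 'rV[R]_m) x D (r : R) : 0 < r ->
  (forall y, `|y - x| < r -> F y = G y) -> sdiff F x D -> sdiff G x D.
Proof.
move=> r0 FG sF e /sF[r' r'0 H]; exists (Num.min r r'); first by rewrite lt_min r0.
move=> y z; rewrite !lt_min => /andP[yr yr'] /andP[zr zr'].
by rewrite -!FG // H.
Qed.

Lemma is_derive_epsE (W : normedModType R) (c : R -> W) (c' : W) (t e : R) :
  is_derive t 1 c c' -> 0 < e ->
  exists2 r : R, 0 < r & forall h, `|h| < r -> `|c (t + h) - c t - h *: c'| <= e * `|h|.
Proof.
move=> dc e0.
have cE : (fun h => h^-1 *: (c (h *: 1 + t) - c t)) @ 0^' --> c'.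
  by case: dc => dc <-; exact: dc.
move/cvgrPdist_le : cE => /(_ _ e0)[r2 /= r20 H]; exists r2 => // h hr.
have [->|h0] := eqVneq h 0; first by rewrite addr0 subrr scale0r subr0 !normr0 mulr0.
have := H h; rewrite /ball_ /= sub0r normrN => /(_ hr h0).
have -> : c' - h^-1 *: (c (h%:A + t) - c t) = - (h^-1 *: (c (t + h) - c t - h *: c')).
  rewrite [h%:A]mulr1 (addrC h) [h^-1 *: (_ - h *: _)]scalerBr scalerA mulVf //.
  by rewrite scale1r opprB.
by rewrite normrN normrZ normfV ler_pdivrMl ?normr_gt0 // mulrC.
Qed.

Lemma sdiff_curve d m (F : 'rV[R]_d -> 'rV[R]_m) D (c : R -> 'rV[R]_d) (c' : 'rV[R]_d) t :
  sdiff F (c t) D -> is_derive t 1 c c' -> is_derive t 1 (F \o c) (c' *m D).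
Proof.
move=> sF dc; apply: is_derive_eps => e e0.
have D0 : 0 < d%:R * `|D| + 1 by rewrite ltr_wpDl // mulr_ge0.
have N0 : 0 < `|c'| + 1 by rewrite ltr_wpDl.
have e1 : 0 < e / 2 / (`|c'| + 1) by rewrite !divr_gt0.
have [r1 r10 Hr1] := sF _ e1.
pose k := Num.min 1 (e / 2 / (d%:R * `|D| + 1)).
have k0 : 0 < k by rewrite lt_min ltr01 !divr_gt0.
have [r2 r20 Hr2] := is_derive_epsE dc k0.
exists (Num.min r2 (r1 / (`|c'| + 1))); first by rewrite lt_min r20 divr_gt0.
move=> h; rewrite lt_min => /andP[h2 h1].
have hk := Hr2 _ h2.
have hL : `|c (t + h) - c t| <= (`|c'| + 1) * `|h|.
  rewrite -(subrK (h *: c') (c (t + h) - c t)) (le_trans (ler_normD _ _)) //.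
  rewrite mulrDl mul1r addrC normrZ mulrC lerD // (le_trans hk) //.
  by rewrite ler_piMl // ge_min lexx.
have hr : `|c (t + h) - c t| < r1.
  by rewrite (le_lt_trans hL) // mulrC -ltr_pdivlMr.
have := Hr1 _ _ hr (_ : `|c t - c t| < r1); rewrite subrr normr0 => /(_ r10) H1.
have -> : (F \o c) (t + h) - (F \o c) t - h *: (c' *m D) =
   (F (c (t + h)) - F (c t) - (c (t + h) - c t) *m D) + (c (t + h) - c t - h *: c') *m D.
  by rewrite [(c (t + h) - c t - _) *m D]mulmxBl addrA subrK scalemxAl.
rewrite (le_trans (ler_normD _ _)) // (splitr e) mulrDl lerD //.
  by apply: (le_trans H1); apply: le_div_scale; rewrite // divr_ge0 // ltW.
apply: (le_trans (norm_mulmx _ _)); rewrite mulrAC.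
apply: le_mul_div; rewrite ?mulr_ge0 // (le_trans hk) //.
by rewrite ler_wpM2r // ge_min lexx orbT.
Qed.

End StrictDifferentiability.

(** * Differentiable dependence of a family of integral curves on a parameter *)

Section ParameterDependence.
Variable R : realType.
Variables (d m : nat) (X : 'rV[R]_m -> 'rV[R]_m) (A : 'rV[R]_m -> 'M[R]_m).
Variables (B : set 'rV[R]_m) (Z : 'rV[R]_d -> R -> 'rV[R]_m) (v0 : 'rV[R]_d).
Variables (a r L d0 : R) (D0 : 'M[R]_(d, m)).
Hypothesis r0 : 0 < r.
Hypothesis d00 : 0 < d0.
Hypothesis L0 : 0 <= L.
Hypothesis X_lin : forall e : R, 0 < e -> exists2 s : R, 0 < s & forall z z1 z2,
  B z -> B z1 -> B z2 -> `|z1 - z| < s -> `|z2 - z| < s ->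
  `|X z1 - X z2 - (z1 - z2) *m A z| <= e * `|z1 - z2|.
Hypothesis X_lip : forall z1 z2, B z1 -> B z2 -> `|X z1 - X z2| <= L * `|z1 - z2|.
Hypothesis X_bnd : forall z, B z -> `|X z| <= L.
Hypothesis A_bnd : forall z, B z -> `|A z| <= L.
Hypothesis A_cont : forall e : R, 0 < e -> exists2 s : R, 0 < s & forall z1 z2,
  B z1 -> B z2 -> `|z1 - z2| < s -> `|A z1 - A z2| <= e.
Hypothesis ZB : forall v t, `|v - v0| < d0 -> `|t - a| < r -> B (Z v t).
Hypothesis ZX : forall v t, `|v - v0| < d0 -> `|t - a| < r ->
  is_derive t 1 (Z v) (X (Z v t)).
Hypothesis Za : sdiff (Z^~ a) v0 D0.

Let v00 : `|v0 - v0| < d0. Proof. by rewrite subrr normr0. Qed.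
Let aa : `|a - a| < r. Proof. by rewrite subrr normr0. Qed.

Let A_bndZ t : `|t - a| < r -> `|A (Z v0 t)| <= L.
Proof. by move=> tr; apply: A_bnd; exact: ZB. Qed.

Let ode_lip : exists s K : R, [/\ 0 < s, s <= d0, 0 < K & forall v w t, `|v - v0| < s ->
  `|w - v0| < s -> `|t - a| < r -> `|Z v t - Z w t| <= K * `|v - w|].
Proof.
have [s [K [s0 K0 HK]]] := sdiff_lipschitz Za.
have [C C0 HC] := gronwall m L0 r0.
exists (Num.min s d0), (C * K); rewrite ge_min lexx orbT lt_min s0 d00 mulr_gt0 //.
split=> // v w t; rewrite !lt_min => /andP[vs vd] /andP[ws wd] tr.
have := HC (fun t => Z v t - Z w t) (fun t => X (Z v t) - X (Z w t)) a 0 (lexx _).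
rewrite addr0 => H; rewrite -mulrA; apply: le_trans (H _ _ t tr) _.
- by move=> u ur; apply: is_deriveB; exact: ZX.
- by move=> u ur; rewrite addr0; apply: X_lip; exact: ZB.
by rewrite ler_wpM2l ?(ltW C0) // HK.
Qed.

(** The field is linearised along the reference solution [Z v0] for any two nearby solutions;
    [ode_lip] converts the error into a bound in |v - w|, uniform in t. *)
Let ode_lin : forall e : R, 0 < e -> exists2 s : R, 0 < s /\ s <= d0 &
  forall v w, `|v - v0| < s -> `|w - v0| < s ->
  (forall t, `|t - a| < r ->
    `|X (Z v t) - X (Z w t) - (Z v t - Z w t) *m A (Z v0 t)| <= e * `|v - w|) /\
  `|Z v a - Z w a - (v - w) *m D0| <= e * `|v - w|.
Proof.
move=> e e0; have [s [K [s0 sd K0 HK]]] := ode_lip.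
have [s1 s10 Hs1] := Za e0.
have [s2 s20 Hs2] := X_lin (divr_gt0 e0 K0).
exists (Num.min (Num.min s s1) (s2 / K)).
  by rewrite !lt_min s0 s10 divr_gt0 // !ge_min sd.
move=> v w; rewrite !lt_min => /andP[/andP[vs vs1] vs2] /andP[/andP[ws ws1] ws2].
split=> [t tr|]; last exact: Hs1.
have near u : `|u - v0| < s -> `|u - v0| < s2 / K -> `|Z u t - Z v0 t| < s2.
  move=> us us2; apply: (le_lt_trans (HK _ _ _ us _ tr)); first by rewrite subrr normr0.
  by rewrite mulrC -ltr_pdivlMr.
have d_ u : `|u - v0| < s -> `|u - v0| < d0 by move=> us; exact: lt_le_trans sd.
have := Hs2 (Z v0 t) (Z v t) (Z w t) (ZB v00 tr) (ZB (d_ _ vs) tr) (ZB (d_ _ ws) tr)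
  (near _ vs vs2) (near _ ws ws2).
move/le_trans; apply; rewrite mulrAC ler_pdivrMr // -mulrA ler_wpM2l ?(ltW e0) //.
by rewrite mulrC HK.
Qed.

(** The solution of the variational equation is obtained as the limit of the difference quotients of
    Z between v0 and v0 + h / (k + 1). They solve the equation up to an error tending to 0, and
    Gronwall makes them uniformly Cauchy. *)
Let ode_row : forall h : 'rV[R]_d, exists J : R -> 'rV[R]_m, J a = h *m D0 /\
  forall t, `|t - a| < r -> is_derive t 1 J (J t *m A (Z v0 t)).
Proof.
move=> h.
have [s [K [s0 sd K0 HK]]] := ode_lip.
have mL0 : 0 <= m%:R * L by rewrite mulr_ge0.
have [C C0 HC] := gronwall m mL0 r0.
pose u k := v0 + k.+1%:R^-1 *: h.
have uv0 k : u k - v0 = k.+1%:R^-1 *: h by rewrite /u addrC addKr.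
have small e : 0 < e -> exists N, forall k, (N <= k)%N -> `|u k - v0| < e.
  move=> e0; exists (Num.truncn (`|h| / e)) => k Nk.
  rewrite uv0 normrZ normfV ger0_norm // ltr_pdivrMl ?ltr0n //.
  rewrite -ltr_pdivrMr //; apply: (lt_le_trans (truncnS_gt _)).
  by rewrite ler_nat ltnS.
have [N1 HN1] := small s s0.
(* The shift by [N1] puts every parameter [u (N1 + k)] in the ball where [ode_lip] applies, so the
   quotients are bounded from k = 0 on. *)
pose q k t := (N1 + k).+1%:R *: (Z (u (N1 + k)%N) t - Z v0 t).
pose q' k t := (N1 + k).+1%:R *: (X (Z (u (N1 + k)%N) t) - X (Z v0 t)).
have us k : `|u (N1 + k)%N - v0| < s by apply: HN1; rewrite leq_addr.
have ud k : `|u (N1 + k)%N - v0| < d0 by exact: lt_le_trans sd.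
have scl k : (N1 + k).+1%:R * `|u (N1 + k)%N - v0| = `|h|.
  by rewrite uv0 normrZ normfV ger0_norm // mulVKf.
have dq k t : `|t - a| < r -> is_derive t 1 (q k) (q' k t).
  by move=> tr; apply: is_deriveZ; apply: is_deriveB; apply: ZX.
have qK k t : `|t - a| < r -> `|q k t| <= K * `|h|.
  move=> tr; rewrite normrZ ger0_norm // -(scl k) mulrCA ler_wpM2l //.
  by apply: HK => //; rewrite subrr normr0.
have q'K k t : `|t - a| < r -> `|q' k t| <= L * (K * `|h|).
  move=> tr; rewrite normrZ ger0_norm //.
  apply: (@le_trans _ _ ((N1 + k).+1%:R * (L * `|Z (u (N1 + k)%N) t - Z v0 t|))).
    by rewrite ler_wpM2l // X_lip //; apply: ZB.
  rewrite mulrCA ler_wpM2l //; have := qK k t tr.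
  by rewrite normrZ ger0_norm.
have err e : 0 < e -> exists N, forall k, (N <= k)%N ->
    (forall t, `|t - a| < r -> `|q' k t - q k t *m A (Z v0 t)| <= e) /\
    `|q k a - h *m D0| <= e.
  move=> e0; have e1 : 0 < e / (`|h| + 1) by rewrite divr_gt0 // ltr_wpDl.
  have [s1 [s10 _] Hs1] := ode_lin e1.
  have [N HN] := small _ s10; exists N => k Nk.
  have [|H1 H2] := Hs1 (u (N1 + k)%N) v0 (HN _ (leq_trans Nk (leq_addl _ _))).
    by rewrite subrr normr0.
  have fin (x : 'rV[R]_m) :
      `|x| <= e / (`|h| + 1) * `|u (N1 + k)%N - v0| -> `|(N1 + k).+1%:R *: x| <= e.
    move=> xle; rewrite normrZ ger0_norm //.
    apply: (@le_trans _ _ ((N1 + k).+1%:R * (e / (`|h| + 1) * `|u (N1 + k)%N - v0|))).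
      by rewrite ler_wpM2l.
    rewrite mulrCA scl mulrAC ler_pdivrMr ?ltr_wpDl // ler_wpM2l ?(ltW e0) //.
    by rewrite lerDl.
  split=> [t tr|].
    have -> : q' k t - q k t *m A (Z v0 t) = (N1 + k).+1%:R *:
       (X (Z (u (N1 + k)%N) t) - X (Z v0 t) - (Z (u (N1 + k)%N) t - Z v0 t) *m A (Z v0 t)).
      by rewrite /q' /q -scalemxAl -scalerBr.
    exact/fin/H1.
  have -> : q k a - h *m D0 = (N1 + k).+1%:R *:
       (Z (u (N1 + k)%N) a - Z v0 a - (u (N1 + k)%N - v0) *m D0).
    by rewrite uv0 -scalemxAl [in RHS]scalerBr scalerA mulfV // scale1r.
  exact/fin/H2.
have cau e : 0 < e -> exists N, forall t, `|t - a| < r -> forall k l,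
    (N <= k)%N -> (N <= l)%N -> `|q k t - q l t| <= e.
  move=> e0; have e1 : 0 < e / C / 4 by rewrite !divr_gt0.
  have [N HN] := err _ e1; exists N => t tr k l Nk Nl.
  have [k1 k2] := HN _ Nk; have [l1 l2] := HN _ Nl.
  have eta0 : 0 <= e / C / 2 by rewrite !divr_ge0 // ltW.
  have := HC (fun t => q k t - q l t) (fun t => q' k t - q' l t) a (e / C / 2) eta0.
  move=> H; apply: le_trans (H _ _ t tr) _.
  - by move=> x xr; apply: is_deriveB; exact: dq.
  - move=> x xr.
    have -> : q' k x - q' l x = (q k x - q l x) *m A (Z v0 x) +
      ((q' k x - q k x *m A (Z v0 x)) - (q' l x - q l x *m A (Z v0 x))).
      by rewrite mulmxBl; apply/matrixP => i j; rewrite !mxE; ring.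
    rewrite (le_trans (ler_normD _ _)) // lerD //.
      rewrite (le_trans (norm_mulmx _ _)) // mulrAC ler_wpM2r // ler_wpM2l //.
      by rewrite A_bndZ.
    apply: (le_trans (ler_normB _ _)).
    have -> : e / C / 2 = e / C / 4 + e / C / 4 by field; rewrite gt_eqF.
    by apply: lerD; [exact: k1|exact: l1].
  have : `|q k a - q l a| <= e / C / 2.
    rewrite (le_trans (ler_distD (h *m D0) _ _)) //.
    have -> : e / C / 2 = e / C / 4 + e / C / 4 by field; rewrite gt_eqF.
    by rewrite (distrC _ (q l a)); apply: lerD; [exact: k2|exact: l2].
  move=> qa; apply: (@le_trans _ _ (C * (e / C / 2 + e / C / 2))).
    by rewrite ler_wpM2l ?(ltW C0) // lerD2r.
  by rewrite -splitr mulrC divfK // gt_eqF.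
(* One modulus for all t, so that the pointwise limits J t are uniform; the value for e <= 0 is a
   dummy. *)
pose N e : nat := if pselect (0 < e) is left e0 then projT1 (cid (cau e e0)) else 0%N.
have HN e t : 0 < e -> `|t - a| < r -> forall k l, (N e <= k)%N -> (N e <= l)%N ->
    `|q k t - q l t| <= e.
  move=> e0 tr; rewrite /N; case: pselect => // e0'.
  by case: cid => /= n Hn; exact: Hn.
have lim t : exists l : 'rV[R]_m, `|t - a| < r -> forall e : R, 0 < e -> forall k,
    (N e <= k)%N -> `|q k t - l| <= e.
  have [tr|tr] := pselect (`|t - a| < r); last by exists 0.
  have [l Hl] := @cauchy_mx R 1 m (q^~ t) N (fun e e0 => HN e t e0 tr).
  by exists l.
pose J t := projT1 (cid (lim t)).
have HJ t e k : `|t - a| < r -> 0 < e -> (N e <= k)%N -> `|q k t - J t| <= e.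
  by move=> tr e0 Nk; rewrite /J; case: cid => l /= Hl; exact: Hl.
exists J; split.
  apply/eqP; rewrite -subr_eq0 -normr_le0; apply/ler_addgt0Pr => e e0; rewrite add0r.
  have e2 : 0 < e / 2 by rewrite divr_gt0.
  have [N2 HN2] := err _ e2; pose k := maxn N2 (N (e / 2)).
  have [_ h2] := HN2 k (leq_maxl _ _).
  have h1 := HJ a _ k aa e2 (leq_maxr _ _).
  rewrite (le_trans (ler_distD (q k a) _ _)) // (splitr e) lerD //.
  by rewrite distrC.
(* J inherits a Lipschitz constant common to the quotients; this provides the continuity of J A that
   [is_derive_lim] asks for. *)
have Jlip t t' : `|t - a| < r -> `|t' - a| < r -> `|J t - J t'| <= L * (K * `|h|) * `|t - t'|.
  move=> tr t'r; apply/ler_addgt0Pr => e e0.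
  have e2 : 0 < e / 2 by rewrite divr_gt0.
  pose k := N (e / 2).
  have h1 := HJ t _ k tr e2 (leqnn _); have h2 := HJ t' _ k t'r e2 (leqnn _).
  have h3 := @vec_mvt_abs R 1 m (q k) (q' k) a r (L * (K * `|h|)) (dq k) (q'K k) t' t t'r tr.
  have -> : J t - J t' = (q k t - q k t') - (q k t - J t) + (q k t' - J t').
    by apply/matrixP => i j; rewrite !mxE; ring.
  rewrite [X in _ <= _ + X](splitr e) [leRHS]addrA; apply: (le_trans (ler_normD _ _)).
  apply: lerD; last exact: h2.
  by apply: (le_trans (ler_normB _ _)); apply: lerD; [exact: h3|exact: h1].
move=> t tr.
apply: (@is_derive_lim R 1 m q q' J (fun t => J t *m A (Z v0 t)) a r t) => //.
  move=> e e0; have e1 : 0 < e / 2 / (m%:R * L + 1).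
    by rewrite !divr_gt0 // ltr_wpDl.
  have e2 : 0 < e / 2 by rewrite divr_gt0.
  have [N2 HN2] := err _ e2.
  exists (maxn (N e) (maxn N2 (N (e / 2 / (m%:R * L + 1))))) => k.
  rewrite !geq_max => /and3P[Nk N2k N3k] x xr; split; first exact: HJ.
  have [h2 _] := HN2 k N2k; have h1 := HJ x _ k xr e1 N3k.
  rewrite (le_trans (ler_distD (q k x *m A (Z v0 x)) _ _)) //.
  rewrite (splitr e) lerD ?h2 // -mulmxBl (le_trans (norm_mulmx _ _)) //.
  rewrite mulrAC -[leRHS]mulr1; apply: (@le_trans _ _ (m%:R * L * `|q k x - J x|)).
    by rewrite ler_wpM2r // ler_wpM2l // A_bndZ.
  by apply: le_mul_div; rewrite ?mulr1.
move=> e e0.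
have M0 : 0 < m%:R * (`|J t| + 1) + 1 by rewrite ltr_wpDl // mulr_ge0.
have e1 : 0 < e / 2 / (m%:R * (`|J t| + 1) + 1) by rewrite !divr_gt0.
have [s1 s10 Hs1] := A_cont e1.
have P0 : 0 < m%:R * L + 1 by rewrite ltr_wpDl.
have Q0 : 0 < L * (K * `|h|) + 1 by rewrite ltr_wpDl // !mulr_ge0 // ltW.
pose k := Num.min (Num.min (r - `|t - a|) (s1 / (L + 1)))
  (e / 2 / (m%:R * L + 1) / (L * (K * `|h|) + 1)).
exists k; first by rewrite !lt_min subr_gt0 tr !divr_gt0 // ltr_wpDl.
move=> x; rewrite !lt_min => /andP[/andP[x1 x2] x3].
have xr : `|x - a| < r.
  by rewrite (le_lt_trans (ler_distD t _ _)) // -ltrBrDr.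
have zz : `|Z v0 x - Z v0 t| < s1.
  have := @vec_mvt_abs R 1 m (Z v0) (fun t => X (Z v0 t)) a r L _ _ t x tr xr.
  move=> H; apply: (le_lt_trans (H _ _)).
  - by move=> y yr; exact: ZX.
  - by move=> y yr; apply: X_bnd; exact: ZB.
  apply: (@le_lt_trans _ _ ((L + 1) * `|x - t|)).
    by rewrite ler_wpM2r // lerDl.
  by rewrite mulrC -ltr_pdivlMr // ltr_wpDl.
have -> : J x *m A (Z v0 x) - J t *m A (Z v0 t) =
  (J x - J t) *m A (Z v0 x) + J t *m (A (Z v0 x) - A (Z v0 t)).
  by rewrite mulmxBl mulmxBr addrA subrK.
rewrite (le_trans (ler_normD _ _)) // (splitr e) lerD //.
  apply: (le_trans (norm_mulmx _ _)).
  rewrite mulrAC -[leRHS]mulr1; apply: (@le_trans _ _ (m%:R * L * `|J x - J t|)).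
    by rewrite ler_wpM2r // ler_wpM2l // A_bndZ.
  apply: le_mul_div; rewrite ?mulr_ge0 // (le_trans (Jlip x t xr tr)) // mulr1.
  rewrite -[leRHS]mulr1; apply: le_mul_div; rewrite ?mulr_ge0 ?(ltW K0) // mulr1.
  exact: ltW.
apply: (le_trans (norm_mulmx _ _)); rewrite -[leRHS]mulr1.
apply: (@le_trans _ _ (m%:R * (`|J t| + 1) * `|A (Z v0 x) - A (Z v0 t)|)).
  by rewrite ler_wpM2r // ler_wpM2l // lerDl.
apply: le_mul_div; rewrite ?mulr_ge0 ?addr_ge0 // mulr1.
exact: (Hs1 _ _ (ZB v00 xr) (ZB v00 tr) zz).
Qed.

(** The rows of D are the solutions of [ode_row] for the basis vectors. Strict differentiability at
    time t is Gronwall for Z v - Z w - (v - w) D, which solves the variational equation up to the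
    error of [ode_lin]. *)
Lemma ode_dependence : exists D : R -> 'M[R]_(d, m), D a = D0 /\
  forall t, `|t - a| < r -> sdiff (Z^~ t) v0 (D t) /\
    is_derive t 1 D (D t *m A (Z v0 t)).
Proof.
pose J i := projT1 (cid (ode_row (delta_mx 0 i))).
have Ja i : J i a = delta_mx 0 i *m D0 by rewrite /J; case: cid => ? /= [].
have dJ i t : `|t - a| < r -> is_derive t 1 (J i) (J i t *m A (Z v0 t)).
  by move=> tr; rewrite /J; case: cid => ? /= [_]; apply.
pose D t : 'M[R]_(d, m) := \matrix_(i, j) J i t 0 j.
have rowD i t : row i (D t) = J i t by apply/rowP => j; rewrite !mxE.
have Da : D a = D0 by apply/row_matrixP => i; rewrite rowD Ja rowE.
have dD t : `|t - a| < r -> is_derive t 1 D (D t *m A (Z v0 t)).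
  move=> tr; apply: is_derive_mx => i j.
  have -> : (fun s => D s i j) = (fun s => J i s 0 j) by apply/funext => s; rewrite mxE.
  have := is_derive_coord 0 j (dJ i t tr).
  by rewrite -rowD -row_mul mxE.
exists D; split=> // t tr; split; last exact: dD.
move=> e e0.
have mL0 : 0 <= m%:R * L by rewrite mulr_ge0.
have [C C0 HC] := gronwall m mL0 r0.
have e1 : 0 < e / C / 2 by rewrite !divr_gt0.
have [s [s0 sd] Hs] := ode_lin e1.
exists s => // v w vs ws; have [H1 H2] := Hs v w vs ws.
have eta0 : 0 <= e / C / 2 * `|v - w| by rewrite mulr_ge0 // ltW.
have vd : `|v - v0| < d0 by exact: lt_le_trans sd.
have wd : `|w - v0| < d0 by exact: lt_le_trans sd.
have dvD x : `|x - a| < r ->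
    is_derive x 1 (fun x => (v - w) *m D x) ((v - w) *m (D x *m A (Z v0 x))).
  move=> /dD dx; apply: is_derive_mx => i j; rewrite mxE.
  have -> : (fun s => ((v - w) *m D s) i j) = (fun s => \sum_k (v - w) i k * D s k j).
    by apply/funext => y; rewrite mxE.
  apply: is_derive_sumf => k; have := is_derive_coord k j dx => h.
  by apply: (is_derive_eq (is_derive_mulf (is_derive_cst _ _ _) h)); rewrite mul0r add0r.
have := HC (fun t => Z v t - Z w t - (v - w) *m D t)
  (fun t => X (Z v t) - X (Z w t) - (v - w) *m (D t *m A (Z v0 t))) a _ eta0.
move=> H; apply: le_trans (H _ _ t tr) _.
- by move=> x xr; apply: is_deriveB; [apply: is_deriveB; exact: ZX|exact: dvD].
- move=> x xr.
  have -> : X (Z v x) - X (Z w x) - (v - w) *m (D x *m A (Z v0 x)) =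
    (Z v x - Z w x - (v - w) *m D x) *m A (Z v0 x) +
    (X (Z v x) - X (Z w x) - (Z v x - Z w x) *m A (Z v0 x)).
    by rewrite [(_ - _ - (v - w) *m D x) *m _]mulmxBl mulmxA [RHS]addrC [RHS]addrA subrK.
  rewrite (le_trans (ler_normD _ _)) // lerD ?H1 //.
  rewrite (le_trans (norm_mulmx _ _)) // mulrAC ler_wpM2r // ler_wpM2l //.
  by rewrite A_bndZ.
rewrite Da; apply: (@le_trans _ _ (C * (e / C / 2 * `|v - w| + e / C / 2 * `|v - w|))).
  by rewrite ler_wpM2l ?(ltW C0) // lerD2r.
rewrite -mulrDl -splitr mulrA (mulrC C) divfK // gt_eqF //.
Qed.

End ParameterDependence.

(** * Sturm comparison *)

Section Sturm.
Variable R : realType.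

Lemma real_mvt_ge (f f' : R -> R) (a b C : R) : a <= b ->
  (forall t, a <= t <= b -> is_derive t 1 f (f' t)) ->
  (forall t, a <= t <= b -> C <= f' t) -> C * (b - a) <= f b - f a.
Proof.
move=> ab fd fC.
have := @real_mvt_le R (fun t => - f t) (fun t => - f' t) a b (- C) ab.
rewrite mulNr -opprD lerN2; apply.
  by move=> t /fd ?; apply: is_deriveN.
by move=> t /fC; rewrite lerN2.
Qed.

Lemma is_derive_pow2 (a t : R) : is_derive t 1 (fun s => a * (s * s)) (2 * a * t).
Proof.
have h := is_derive_mulf (is_derive_cst a t 1) (is_derive_mulf (is_derive_id t 1) (is_derive_id t 1)).
by apply: (is_derive_eq h) => /=; ring.
Qed.

Lemma is_derive_div (f : R -> R) (f' t : R) : t != 0 -> is_derive t 1 f f' ->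
  is_derive t 1 (fun s => f s / s) (f' / t - f t / (t * t)).
Proof.
move=> t0 df.
have dV : is_derive t 1 (fun s : R => s^-1) (- (t * t)^-1).
  have := is_deriveV (f := id) t0 (is_derive_id t 1).
  by move=> h; apply: (is_derive_eq h); rewrite /GRing.scale /= mulr1 expr2.
by apply: (is_derive_eq (is_derive_mulf df dV)); rewrite mulrN.
Qed.

(* phi = |J|^2 and psi = <DJ, J>: the inequality on psi' is the Jacobi equation
   in nonpositive curvature together with |DJ - l J|^2 >= 0, used at l = 1/t. *)
Lemma sturm (phi psi psi' : R -> R) (c : R) :
  (forall t : R, 0 <= t -> is_derive t 1 phi (2 * psi t)) ->
  (forall t : R, 0 <= t -> is_derive t 1 psi (psi' t)) ->
  (forall t l : R, 0 <= t -> 2 * l * psi t - l ^+ 2 * phi t <= psi' t) ->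
  phi 0 = 0 -> psi 0 = 0 -> psi' 0 = c ->
  phi 1 <= psi 1 /\ c <= phi 1.
Proof.
move=> dphi dpsi Hpsi phi0 psi0 psi'0.
(* The derivative of phi / t^2 is 2 eta / t^2, and the first conclusion says that eta 1 >= 0. *)
pose eta t := psi t - phi t / t.
have deta (t : R) : 0 < t -> is_derive t 1 eta (psi' t - (2 * psi t / t - phi t / (t * t))).
  move=> t0; apply: is_deriveB; first by apply: dpsi; exact: ltW.
  by apply: is_derive_div; [rewrite gt_eqF|apply: dphi; exact: ltW].
have eta_nd (s t : R) : 0 < s -> s <= t -> eta s <= eta t.
  move=> s0 st; rewrite -subr_ge0.
  have pos u : s <= u <= t -> 0 < u by move=> /andP[su _]; exact: lt_le_trans su.
  have := @real_mvt_ge eta _ s t 0 st (fun u ut => deta u (pos u ut)).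
  rewrite mul0r; apply=> u ut; have u0 := pos u ut.
  rewrite subr_ge0; apply: le_trans (Hpsi u u^-1 (ltW u0)).
  by rewrite exprVn expr2 mulrAC (mulrC (phi u)) lexx.
have small (e : R) : 0 < e -> exists2 d : R, 0 < d & forall t, 0 < t < d ->
    (c - e) * t <= psi t <= (c + e) * t.
  move=> e0; have [d d0 Hd] := is_derive_epsE (dpsi 0 (lexx 0)) e0.
  exists d => // t /andP[t0 td]; have := Hd t.
  rewrite add0r psi0 subr0 psi'0 ger0_norm ?(ltW t0) // => /(_ td).
  by rewrite /GRing.scale /= ler_norml => /andP[]; lra.
have phi_small (e : R) : 0 < e -> exists2 d : R, 0 < d & forall t, 0 < t < d ->
    (c - e) * (t * t) <= phi t <= (c + e) * (t * t).
  move=> e0; have [d d0 Hd] := small e e0; exists d => // t /andP[t0 td].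
  have dg (k u : R) : 0 <= u <= t ->
      is_derive u 1 (fun s => phi s - k * (s * s)) (2 * psi u - 2 * k * u).
    move=> /andP[u0 _]; apply: is_deriveB; first exact: dphi.
    exact: is_derive_pow2.
  have bd u : 0 <= u <= t -> (c - e) * u <= psi u <= (c + e) * u.
    move=> /andP[u0 ut]; move: u0; rewrite le_eqVlt => /predU1P[<-|u0].
      by rewrite psi0 !mulr0 lexx.
    by apply: Hd; rewrite u0 (le_lt_trans ut).
  have := @real_mvt_ge _ _ 0 t 0 (ltW t0) (dg (c - e)).
  have := @real_mvt_le R _ _ 0 t 0 (ltW t0) (dg (c + e)).
  rewrite !mul0r !mulr0 phi0 !subr0 => H1 H2; apply/andP; split.
    rewrite -subr_ge0; apply: H2 => u /bd /andP[h _]; move: h; lra.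
  rewrite -subr_le0; apply: H1 => u /bd /andP[_ h]; move: h; lra.
(* Near 0, psi is close to c t and phi to c t^2, so eta s >= - 2 e s there; a value eta t = - 4 e <
   0 would contradict monotonicity. *)
have eta_ge0 (t : R) : 0 < t -> 0 <= eta t.
  move=> t0; rewrite leNgt; apply/negP => et.
  pose e := - eta t / 4; have e0 : 0 < e by rewrite /e; lra.
  have [d1 d10 H1] := small e e0; have [d2 d20 H2] := phi_small e e0.
  pose s := Num.min (Num.min 1 t) (Num.min d1 d2) / 2.
  have m0 : 0 < Num.min (Num.min 1 t) (Num.min d1 d2) by rewrite !lt_min ltr01 t0 d10 d20.
  have s0 : 0 < s by rewrite /s; lra.
  have sm : s < Num.min (Num.min 1 t) (Num.min d1 d2) by rewrite /s; lra.
  move: (sm); rewrite !lt_min => /andP[/andP[s1 st] /andP[sd1 sd2]].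
  have := eta_nd s t s0 (ltW st); rewrite /eta => h.
  have [/andP[h1 _] /andP[_ h2]] : (c - e) * s <= psi s <= (c + e) * s /\
      (c - e) * (s * s) <= phi s <= (c + e) * (s * s).
    by split; [apply: H1|apply: H2]; rewrite s0.
  have h3 : phi s / s <= (c + e) * s by rewrite ler_pdivrMr // -mulrA.
  have : - (2 * e * s) <= eta t by rewrite /eta; lra.
  have : e * s <= e by rewrite ler_piMr ?ltW.
  by rewrite /e; move: et; lra.
split; first by have := eta_ge0 1 ltr01; rewrite /eta divr1 subr_ge0.
(* As eta >= 0, phi / t^2 is nondecreasing; it tends to c at 0, so a small time s is compared with
   time 1. *)
apply/ler_addgt0Pr => e e0.
have [d d0 Hd] := phi_small e e0.
pose s := Num.min 1 d / 2.
have m0 : 0 < Num.min 1 d by rewrite !lt_min ltr01 d0.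
have s0 : 0 < s by rewrite /s; lra.
have : s < Num.min 1 d by rewrite /s; lra.
rewrite lt_min => /andP[s1 sd].
have dth (t : R) : 0 < t -> is_derive t 1 (fun t => phi t / t / t) (2 / (t * t) * eta t).
  move=> t0; have tn : t != 0 by rewrite gt_eqF.
  apply: (is_derive_eq (is_derive_div tn (is_derive_div tn (dphi t (ltW t0))))).
  by rewrite /eta; field.
have : phi s / s / s <= phi 1 / 1 / 1.
  rewrite -subr_ge0.
  have pos u : s <= u <= 1 -> 0 < u by move=> /andP[su _]; exact: lt_le_trans su.
  have := @real_mvt_ge _ _ s 1 0 (ltW s1) (fun u ut => dth u (pos u ut)).
  rewrite mul0r; apply=> u ut; have u0 := pos u ut.
  by rewrite mulr_ge0 ?eta_ge0 // divr_ge0 // mulr_ge0 // ltW.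
rewrite !divr1 => h; have : c - e <= phi s / s / s.
  rewrite !ler_pdivlMr // -mulrA.
  by have /andP[] : (c - e) * (s * s) <= phi s <= (c + e) * (s * s) by apply: Hd; rewrite s0.
by move: h; lra.
Qed.

End Sturm.

(** * Uniform estimates for C^1 maps on compact balls *)

Section C1.
Variable R : realType.

Lemma is_derive_chain (V W : normedModType R) (F : V -> W) (c : R -> V) (c' : V) (t : R) :
  differentiable F (c t) -> is_derive t 1 c c' ->
  is_derive t 1 (fun s => F (c s)) ('d F (c t) c').
Proof.
move=> dF [dc cE]; have dc' := dc.
move/derivable1_diffP in dc'.
have dFc : differentiable (F \o c) t by exact: differentiable_comp.
split; first exact/derivable1_diffP.
rewrite deriveE // diff_comp //=; congr ('d F _ _).
by rewrite -deriveE.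
Qed.

Lemma near_eps (V : normedModType R) (x : V) (A : set V) :
  nbhs x A <-> exists2 e : R, 0 < e & forall y, `|y - x| < e -> A y.
Proof.
split=> [/nbhs_ballP[e /= e0 He]|[e e0 He]].
  by exists e => // y yx; apply: He; rewrite -ball_normE /ball_ /= distrC.
by apply/nbhs_ballP; exists e => // y; rewrite -ball_normE /ball_ /= distrC => /He.
Qed.

Lemma continuous_epsP (V W : normedModType R) (f : V -> W) (x : V) :
  {for x, continuous f} <-> (forall e : R, 0 < e -> exists2 d : R, 0 < d &
     forall y, `|y - x| < d -> `|f y - f x| <= e).
Proof.
split=> [/cvgrPdist_le H e e0|H].
  have /near_eps[d d0 Hd] := H e e0.
  by exists d => // y yd; rewrite distrC; exact: Hd.
apply/cvgrPdist_le => e e0; have [d d0 Hd] := H e e0.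
by apply/near_eps; exists d => // y /Hd; rewrite distrC.
Qed.

Lemma open_cball (V : normedModType R) (U : set V) x : open U -> U x ->
  exists2 r : R, 0 < r & forall y, `|y - x| <= r -> U y.
Proof.
move=> oU Ux; have /near_eps[r r0 Hr] : nbhs x U by exact: open_nbhs_nbhs.
exists (r / 2); first by rewrite divr_gt0.
by move=> y yr; apply: Hr; rewrite (le_lt_trans yr) ?half_lt.
Qed.

Lemma cball_closed n (z0 : 'rV[R]_n) (r : R) : closed [set z | `|z - z0| <= r].
Proof.
have -> : [set z | `|z - z0| <= r] = (fun z => `|z - z0|) @^-1` [set x | x <= r] by [].
apply: closed_comp; last exact: closed_le.
move=> z _; apply/(@continuous_epsP 'rV[R]_n R (fun z => `|z - z0|)) => e e0.
exists e => // y ye; apply: (le_trans (ler_dist_dist _ _)).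
by rewrite opprB addrA subrK ltW.
Qed.

Lemma cball_compact n (z0 : 'rV[R]_n) (r : R) : compact [set z | `|z - z0| <= r].
Proof.
apply: bounded_closed_compact; last exact: cball_closed.
exists (r + `|z0|); split; first exact: num_real.
move=> x xr z /= zr; rewrite -(subrK z0 z) (le_trans (ler_normD _ _)) //.
by rewrite (le_trans _ (ltW xr)) // lerD2r.
Qed.

(** Continuity at the points of K is meant in the ambient space, which lets y lie outside K. *)
Lemma compact_unif_cont (V W : normedModType R) (f : V -> W) (K : set V) :
  compact K -> (forall x, K x -> {for x, continuous f}) ->
  forall e : R, 0 < e -> exists2 d : R, 0 < d &
    forall x y, K x -> `|y - x| < d -> `|f y - f x| <= e.
Proof.
move=> /compact_near_coveringP cK fK e e0.
pose P (d : R) (x : V) := forall y, `|y - x| < d -> `|f y - f x| <= e.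
have cov x : K x -> \forall x' \near x & d \near 0^'+, P d x'.
  move=> Kx.
  have e2 : 0 < e / 2 by rewrite divr_gt0.
  have [d d0 Hd] := (continuous_epsP f x).1 (fK x Kx) _ e2.
  have d2 : 0 < d / 2 by rewrite divr_gt0.
  exists (ball x (d / 2), [set z | z < d / 2]).
    split; first exact: nbhsx_ballx.
    by exists (d / 2) => //= z; rewrite /ball_ /= sub0r normrN => /(le_lt_trans (ler_norm _)).
  move=> [x' d'] /= []; rewrite -ball_normE /ball_ /= => xx' d'd y yx'.
  have yx : `|y - x| < d.
    rewrite (le_lt_trans (ler_distD x' _ _)) // (splitr d) ltrD //.
      exact: lt_trans d'd.
    by rewrite distrC.
  rewrite (le_trans (ler_distD (f x) _ _)) // (splitr e) lerD ?Hd //.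
  by rewrite distrC Hd // distrC (lt_le_trans xx') // ler_pdivrMr // ler_peMr ?(ltW d0) // ler1n.
have [d /= d0 Hd] := cK R (0^'+) P _ cov.
exists (d / 2); first by rewrite divr_gt0.
move=> x y Kx; apply: (Hd (d / 2)) => //=.
  rewrite sub0r normrN ger0_norm ?divr_ge0 ?(ltW d0) //.
  exact: half_lt.
by rewrite divr_gt0.
Qed.

Lemma compact_bound (V W : normedModType R) (f : V -> W) (K : set V) :
  compact K -> (forall x, K x -> {for x, continuous f}) ->
  exists2 M : R, 0 < M & forall x, K x -> `|f x| <= M.
Proof.
move=> cK fK; have cfK : {within K, continuous f}.
  by apply: continuous_in_subspaceT => x /set_mem; exact: fK.
have [M [_ HM]] := compact_bounded (continuous_compact cfK cK).
exists (`|M| + 1); first by rewrite ltr_wpDl.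
by move=> x Kx; apply: (HM (`|M| + 1)); [rewrite ltr_pwDr // ler_norm|exists x].
Qed.

Lemma jacobian_partial d m (F : 'rV[R]_d -> 'rV[R]_m) x i :
  differentiable F x -> row i ('J F x) = partial i F x.
Proof. by move=> dF; rewrite /partial deriveEjacobian // rowE. Qed.

Lemma diffE_jacobian d m (F : 'rV[R]_d -> 'rV[R]_m) x v :
  differentiable F x -> 'd F x v = v *m 'J F x.
Proof. by move=> dF; rewrite -deriveEjacobian // deriveE. Qed.

Lemma jacobian_continuous d m (F : 'rV[R]_d -> 'rV[R]_m) x :
  (\forall y \near x, differentiable F y) ->
  (forall i, {for x, continuous (partial i F)}) -> {for x, continuous (fun y => 'J F y)}.
Proof.
move=> dF pF; apply/continuous_epsP => e e0.
have /near_eps[r r0 Hr] := dF.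
have [r' r'0 Hr'] : exists2 r' : R, 0 < r' & forall i y, `|y - x| < r' ->
    `|partial i F y - partial i F x| <= e.
  have H i := (continuous_epsP _ _).1 (pF i) e e0.
  pose g i := projT1 (cid2 (H i)).
  have g0 i : 0 < g i by rewrite /g; case: cid2.
  have Hg i y : `|y - x| < g i -> `|partial i F y - partial i F x| <= e.
    by rewrite /g; case: cid2 => /= ? _; apply.
  exists (\big[Num.min/1]_i g i).
    by apply/bigmin_gtP; split=> // i _; exact: g0.
  move=> i y yr; apply: Hg; apply: (lt_le_trans yr); exact: bigmin_le.
exists (Num.min r r'); first by rewrite lt_min r0.
move=> y; rewrite lt_min => /andP[yr yr'].
apply: norm_le_coord => [|i j]; first exact: ltW.
have dy : differentiable F y.
  exact: Hr.
have dx : differentiable F x by exact: nbhs_singleton dF.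
have := Hr' i y yr'; rewrite -!jacobian_partial //.
by apply: le_trans; have := norm_coord (row i ('J F y) - row i ('J F x)) 0 j; rewrite !mxE.
Qed.

Lemma cball_convex n (z0 z1 z2 : 'rV[R]_n) (r s : R) : 0 <= s <= 1 ->
  `|z1 - z0| <= r -> `|z2 - z0| <= r -> `|z2 + s *: (z1 - z2) - z0| <= r.
Proof.
move=> /andP[s0 s1] h1 h2.
have -> : z2 + s *: (z1 - z2) - z0 = s *: (z1 - z0) + (1 - s) *: (z2 - z0).
  by apply/rowP => i; rewrite !mxE; ring.
rewrite (le_trans (ler_normD _ _)) // !normrZ (ger0_norm s0) ger0_norm ?subr_ge0 //.
have -> : r = s * r + (1 - s) * r by ring.
by rewrite lerD // ler_wpM2l // subr_ge0.
Qed.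

Lemma is_derive_line (V : normedModType R) (x v : V) (s : R) :
  is_derive s 1 (fun s => x + s *: v) v.
Proof.
by have := is_deriveD (is_derive_cst x s 1) (is_derive_line0 v s); rewrite add0r.
Qed.

(** Mean value inequality for F minus the linear map D along a segment; the factor [d] comes from
    the sup norm of a product. Taking D = 0 yields Lipschitz bounds. *)
Lemma linear_error d m (F : 'rV[R]_d -> 'rV[R]_m) (D : 'M[R]_(d, m)) (e : R) z1 z2 :
  (forall s : R, 0 <= s <= 1 -> differentiable F (z2 + s *: (z1 - z2))) ->
  (forall s : R, 0 <= s <= 1 -> `|'J F (z2 + s *: (z1 - z2)) - D| <= e) ->
  `|F z1 - F z2 - (z1 - z2) *m D| <= d%:R * `|z1 - z2| * e.
Proof.
move=> dF JD.
pose g (s : R) := F (z2 + s *: (z1 - z2)) - s *: ((z1 - z2) *m D).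
have dg (s : R) : 0 <= s <= 1 ->
    is_derive s 1 g ((z1 - z2) *m ('J F (z2 + s *: (z1 - z2)) - D)).
  move=> /dF ds; rewrite mulmxBr; apply: is_deriveB; last exact: is_derive_line0.
  by have := is_derive_chain ds (is_derive_line z2 (z1 - z2) s); rewrite diffE_jacobian.
have := @vec_mvt R 1 m g _ 0 1 (d%:R * `|z1 - z2| * e) ler01 dg.
rewrite subr0 mulr1 /g scale1r scale0r addr0 scale1r scale0r subr0 subrKC.
rewrite addrAC; apply.
move=> t /JD Jt; apply: (le_trans (norm_mulmx _ _)).
by rewrite ler_wpM2l ?mulr_ge0.
Qed.

(** The five conclusions are the estimates on a field and its derivative that the parameter
    dependence of integral curves takes as hypotheses, on a closed ball. *)
Lemma C1_compact d m (F : 'rV[R]_d -> 'rV[R]_m) z0 (r : R) :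
  (forall z, `|z - z0| <= r -> differentiable F z) ->
  (forall z, `|z - z0| <= r -> {for z, continuous (fun y => 'J F y)}) ->
  exists2 L : R, 0 < L & [/\
    forall e : R, 0 < e -> exists2 s : R, 0 < s & forall z z1 z2, `|z - z0| <= r ->
      `|z1 - z0| <= r -> `|z2 - z0| <= r -> `|z1 - z| < s -> `|z2 - z| < s ->
      `|F z1 - F z2 - (z1 - z2) *m 'J F z| <= e * `|z1 - z2|,
    forall z1 z2, `|z1 - z0| <= r -> `|z2 - z0| <= r -> `|F z1 - F z2| <= L * `|z1 - z2|,
    forall z, `|z - z0| <= r -> `|F z| <= L,
    forall z, `|z - z0| <= r -> `|'J F z| <= L &
    forall e : R, 0 < e -> exists2 s : R, 0 < s & forall z1 z2, `|z1 - z0| <= r ->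
      `|z2 - z0| <= r -> `|z1 - z2| < s -> `|'J F z1 - 'J F z2| <= e].
Proof.
move=> dF cJ; have cB := @cball_compact d z0 r.
have [M1 M10 HM1] := compact_bound cB (fun z zr => differentiable_continuous (dF z zr)).
have [M2 M20 HM2] := compact_bound cB cJ.
have UC := compact_unif_cont cB cJ.
have d10 : 0 < d%:R + 1 :> R by rewrite ltr_wpDl.
exists (M1 + (d%:R + 1) * M2); first by rewrite addr_gt0 // mulr_gt0.
have M2L : M2 <= M1 + (d%:R + 1) * M2.
  by rewrite mulrDl mul1r addrA lerDr addr_ge0 ?(ltW M10) // mulr_ge0 // ltW.
split.
- move=> e e0; have e1 : 0 < e / (d%:R + 1) by rewrite divr_gt0.
  have [s s0 Hs] := UC _ e1; exists s => // z z1 z2 zr z1r z2r z1s z2s.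
  have inter w : `|w - z| <= Num.max `|z1 - z| `|z2 - z| -> `|w - z| < s.
    by move=> h; apply: (le_lt_trans h); rewrite gt_max z1s.
  apply: (le_trans (@linear_error d m F ('J F z) (e / (d%:R + 1)) z1 z2 _ _)).
  + by move=> t t01; apply: dF; exact: cball_convex.
  + move=> t t01; apply: Hs => //; apply: inter; apply: cball_convex => //;
    by rewrite le_max lexx ?orbT.
  rewrite -[leLHS]mulrA; apply: le_mul_div => //; last by rewrite mulrC.
  by rewrite mulr_ge0 // ltW.
- move=> z1 z2 h1 h2.
  have := @linear_error d m F 0 M2 z1 z2.
  rewrite mulmx0 subr0 => H; apply: le_trans (H _ _) _.
  + by move=> t t01; apply: dF; exact: cball_convex.
  + by move=> t t01; rewrite subr0; apply: HM2; exact: cball_convex.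
  rewrite mulrAC ler_wpM2r // (le_trans _ (_ : (d%:R + 1) * M2 <= _)) //.
    by rewrite ler_wpM2r ?(ltW M20) // lerDl.
  by rewrite lerDr ltW.
- move=> z zr; apply: (le_trans (HM1 z zr)).
  by rewrite lerDl mulr_ge0 // ltW.
- by move=> z zr; apply: (le_trans (HM2 z zr)).
- move=> e e0; have [s s0 Hs] := UC _ e0; exists s => // z1 z2 _ h2 h; exact: Hs.
Qed.

Lemma C1_sdiff d m (F : 'rV[R]_d -> 'rV[R]_m) z0 (r : R) : 0 < r ->
  (forall z, `|z - z0| <= r -> differentiable F z) ->
  (forall z, `|z - z0| <= r -> {for z, continuous (fun y => 'J F y)}) ->
  sdiff F z0 ('J F z0).
Proof.
move=> r0 dF cJ; have [L L0 [H _ _ _ _]] := C1_compact dF cJ.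
move=> e e0; have [s s0 Hs] := H e e0.
exists (Num.min r s); first by rewrite lt_min r0.
move=> y z; rewrite !lt_min => /andP[yr ys] /andP[zr zs].
by apply: Hs => //; rewrite ?subrr ?normr0 ltW.
Qed.

Lemma is_derive_unique (V : normedModType R) (f : R -> V) (a b : V) (t : R) :
  is_derive t 1 f a -> is_derive t 1 f b -> a = b.
Proof. by move=> [_ <-] [_ <-]. Qed.

Lemma is_derive_near (V : normedModType R) (f h : R -> V) (df : V) (t e : R) : 0 < e ->
  (forall s, `|s - t| < e -> f s = h s) -> is_derive t 1 f df -> is_derive t 1 h df.
Proof.
move=> e0 fh; have n1 : (1 : R) != 0 by exact: oner_neq0.
apply: near_eq_is_derive => //.
by apply/near_eps; exists e.
Qed.

Lemma is_derive_row_mx p q (u : R -> 'rV[R]_p) (v : R -> 'rV[R]_q) u' v' (t : R) :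
  is_derive t 1 u u' -> is_derive t 1 v v' ->
  is_derive t 1 (fun s => row_mx (u s) (v s)) (row_mx u' v').
Proof.
move=> du dv; apply: is_derive_mx => i j.
case: (fintype.split j) (fintype.splitK j) => k /= <-.
  rewrite row_mxEl; have := is_derive_coord i k du.
  by congr is_derive; apply/funext => s; rewrite row_mxEl.
rewrite row_mxEr; have := is_derive_coord i k dv.
by congr is_derive; apply/funext => s; rewrite row_mxEr.
Qed.

Lemma is_derive_lsubmx p q (u : R -> 'rV[R]_(p + q)) u' (t : R) :
  is_derive t 1 u u' -> is_derive t 1 (fun s => lsubmx (u s)) (lsubmx u').
Proof.
move=> du; apply: is_derive_mx => i j; rewrite mxE.
have := is_derive_coord i (lshift q j) du.
by congr is_derive; apply/funext => s; rewrite mxE.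
Qed.

Lemma is_derive_rsubmx p q (u : R -> 'rV[R]_(p + q)) u' (t : R) :
  is_derive t 1 u u' -> is_derive t 1 (fun s => rsubmx (u s)) (rsubmx u').
Proof.
move=> du; apply: is_derive_mx => i j; rewrite mxE.
have := is_derive_coord i (rshift p j) du.
by congr is_derive; apply/funext => s; rewrite mxE.
Qed.

End C1.

(** * Inverse function theorem at a point *)

Section InverseFunction.
Variable R : realType.

Lemma expanding_unitmx n (A : 'M[R]_n) (C : R) :
  (forall w : 'rV[R]_n, `|w| <= C * `|w *m A|) -> A \in unitmx.
Proof.
move=> HA; rewrite unitmxE unitfE; apply/negP => /det0P[w w0 wA].
by have := HA w; rewrite wA normr0 mulr0 normr_le0 (negbTE w0).
Qed.

(** Newton iteration with the derivative frozen at v: accuracy 1 / (2 C) in the strict derivative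
    makes T a contraction of ratio 1/2. The constants stay explicit because the covering argument
    needs the same 2 C at all preimages. *)
Lemma inverse_function n (F : 'rV[R]_n -> 'rV[R]_n) v (A : 'M[R]_n) (C : R) : 0 < C ->
  sdiff F v A -> (forall w : 'rV[R]_n, `|w| <= C * `|w *m A|) ->
  exists2 r : R, 0 < r &
    (forall a b, `|a - v| < r -> `|b - v| < r -> `|a - b| <= 2 * C * `|F a - F b|) /\
    (forall y, 2 * C * `|y - F v| < r -> exists2 a, `|a - v| <= 2 * C * `|y - F v| & F a = y).
Proof.
move=> C0 sF HA.
have C20 : 0 < (2 * C)^-1 by rewrite invr_gt0 mulr_gt0.
have [r1 r10 Hr1] := sF _ C20.
have [r2 [K [r20 K0 HK]]] := sdiff_lipschitz sF.
exists (Num.min r1 r2); first by rewrite lt_min r10.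
split=> [a b|y].
  rewrite !lt_min => /andP[a1 _] /andP[b1 _].
  have h1 := HA (a - b); have h2 := Hr1 a b a1 b1.
  have h3 : `|(a - b) *m A| <= `|F a - F b| + (2 * C)^-1 * `|a - b|.
    have -> : (a - b) *m A = (F a - F b) - (F a - F b - (a - b) *m A) by rewrite subKr.
    by apply: le_trans (ler_normB _ _) _; rewrite lerD2l.
  have h4 : `|a - b| <= C * `|F a - F b| + 2^-1 * `|a - b|.
    apply: (le_trans h1); apply: (le_trans (ler_wpM2l (ltW C0) h3)).
    by rewrite mulrDr mulrA invfM (mulrC 2^-1) mulrA mulfV ?gt_eqF // mul1r.
  by move: h4; lra.
set rho := 2 * C * _ => rho_r.
have rho0 : 0 <= rho by rewrite mulr_ge0 // mulr_ge0 // ltW.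
have uA := expanding_unitmx HA.
have invA (z : 'rV[R]_n) : `|z *m invmx A| <= C * `|z|.
  by have := HA (z *m invmx A); rewrite mulmxKV.
pose T a := a - (F a - y) *m invmx A.
have T_ctr a b : `|a - v| <= rho -> `|b - v| <= rho -> `|T a - T b| <= 2^-1 * `|a - b|.
  move=> ar br; have a1 : `|a - v| < r1.
    by rewrite (le_lt_trans ar) // (lt_le_trans rho_r) // ge_min lexx.
  have b1 : `|b - v| < r1.
    by rewrite (le_lt_trans br) // (lt_le_trans rho_r) // ge_min lexx.
  have -> : T a - T b = - ((F a - F b - (a - b) *m A) *m invmx A).
    rewrite mulmxBl mulmxK // /T.
    have -> : (F a - F b) *m invmx A = (F a - y) *m invmx A - (F b - y) *m invmx A.
      by rewrite -mulmxBl; congr (_ *m _); rewrite opprB addrA subrK.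
    by apply/rowP => i; rewrite !mxE; ring.
  rewrite normrN; apply: (le_trans (invA _)); have := Hr1 a b a1 b1 => h.
  apply: (le_trans (ler_wpM2l (ltW C0) h)).
  by rewrite mulrA invfM (mulrC 2^-1) mulrA mulfV ?gt_eqF // mul1r.
pose u k := iter k T v.
have Tv : `|T v - v| <= rho / 2.
  rewrite /T addrAC subrr add0r normrN; apply: (le_trans (invA _)).
  by rewrite /rho distrC; have := normr_ge0 (y - F v); lra.
have uS k : u k.+1 = T (u k) by [].
have u_in k : `|u k - v| <= rho.
  elim: k => [|k IH]; first by rewrite subrr normr0.
  rewrite uS (le_trans (ler_distD (T v) _ _)) //.
  have vv : `|v - v| <= rho by rewrite subrr normr0.
  have := T_ctr _ _ IH vv; move: Tv IH; lra.
have u_step k : `|u k.+1 - u k| <= rho * 2^-1 ^+ k.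
  elim: k => [|k IH].
    by rewrite expr0 mulr1 (le_trans Tv) // ler_pdivrMr // ler_peMr // ler1n.
  have h := T_ctr (u k.+1) (u k) (u_in k.+1) (u_in k).
  rewrite (uS k.+1) [X in _ - X](uS k); apply: (le_trans h).
  by rewrite exprS mulrCA ler_wpM2l.
have u_dist k l : `|u (k + l)%N - u k| <= 2 * rho * 2^-1 ^+ k.
  have : `|u (k + l)%N - u k| <= 2 * rho * 2^-1 ^+ k - 2 * rho * 2^-1 ^+ (k + l).
    elim: l => [|l IH]; first by rewrite addn0 !subrr normr0.
    rewrite addnS (le_trans (ler_distD (u (k + l)%N) _ _)) //.
    have := u_step (k + l)%N; rewrite exprS; move: IH.
    by set p := 2^-1 ^+ (k + l); lra.
  move/le_trans; apply; rewrite gerBl; apply: mulr_ge0; first exact: mulr_ge0.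
  by rewrite exprn_ge0 ?invr_ge0.
have pow_small (e : R) : 0 < e -> exists N, 2 * rho * 2^-1 ^+ N <= e / 2.
  move=> e0; pose t := Num.truncn (4 * rho / e); exists t.+1.
  have h1 : 4 * rho / e < t.+1%:R by exact: truncnS_gt.
  have h2 : t.+1%:R <= 2 ^+ t.+1 :> R by rewrite -natrX ler_nat ltnW // ltn_expl.
  rewrite exprVn ler_pdivrMr ?exprn_gt0 //.
  move: (lt_le_trans h1 h2); rewrite ltr_pdivrMr // => h3.
  by move: (2 ^+ t.+1) h3 {h1 h2} => p; clear t; lra.
pose N e : nat := if pselect (0 < e) is left e0 then projT1 (cid (pow_small e e0)) else 0%N.
have HN e : 0 < e -> 2 * rho * 2^-1 ^+ N e <= e / 2.
  by move=> e0; rewrite /N; case: pselect => // e0'; case: cid.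
have u_cau e : 0 < e -> forall k l, (N e <= k)%N -> (N e <= l)%N -> `|u k - u l| <= e.
  move=> e0; have d k : (N e <= k)%N -> `|u k - u (N e)| <= e / 2.
    by move=> Nk; have := u_dist (N e) (k - N e)%N; rewrite subnKC // => /le_trans; apply; exact: HN.
  move=> k l Nk Nl; rewrite (le_trans (ler_distD (u (N e)) _ _)) //.
  apply: (@le_trans _ _ (e / 2 + e / 2)); last by rewrite -splitr.
  by apply: lerD; [exact: d|rewrite distrC; exact: d].
have [a Ha] := @cauchy_mx R 1 n u N u_cau.
have a_in : `|a - v| <= rho.
  apply/ler_addgt0Pr => e e0; have := Ha e e0 _ (leqnn _); have := u_in (N e).
  move=> h1 h2; rewrite (le_trans (ler_distD (u (N e)) _ _)) // addrC.
  by rewrite lerD // distrC.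
have r2' z : `|z - v| <= rho -> `|z - v| < r2.
  by move=> zr; rewrite (le_lt_trans zr) // (lt_le_trans rho_r) // ge_min lexx orbT.
exists a => //; apply/eqP; rewrite -subr_eq0 -normr_le0; apply/ler_addgt0Pr => e e0.
rewrite add0r.
pose e1 := e / 2 / (K + 2 * (n%:R * `|A|) + 1).
have D0 : 0 < K + 2 * (n%:R * `|A|) + 1.
  by rewrite ltr_wpDl // addr_ge0 ?mulr_ge0 // ltW.
have e10 : 0 < e1 by rewrite !divr_gt0.
(* F (u k) - y is the increment u k - u (k + 1) multiplied by A, so it tends to 0 and the limit
   solves F a = y. *)
pose k := N e1; have h1 := Ha e1 e10 k (leqnn _); have h2 := Ha e1 e10 k.+1 (leqnSn _).
have h3 := HK _ _ (r2' _ a_in) (r2' _ (u_in k)).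
have h4 : F (u k) - y = (u k - u k.+1) *m A.
  by rewrite uS /T subKr mulmxKV.
have h5 : `|F (u k) - y| <= n%:R * `|A| * (2 * e1).
  rewrite h4 (le_trans (norm_mulmx _ _)) // mulrAC ler_wpM2l ?mulr_ge0 //.
  rewrite (le_trans (ler_distD a _ _)) // (distrC a).
  by move: h1 h2; lra.
rewrite (le_trans (ler_distD (F (u k)) _ _)) //.
have h6 : `|F a - F (u k)| <= K * e1.
  by apply: (le_trans h3); rewrite distrC ler_wpM2l // ltW.
apply: (le_trans (lerD h6 h5)).
have : (K + 2 * (n%:R * `|A|) + 1) * e1 = e / 2.
  by rewrite mulrC divfK // gt_eqF.
by move: e10 e0; set c := n%:R * `|A|; lra.
Qed.

End InverseFunction.

(** * Functions of class C^k *)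

Section FrechetEps.
Variable R : realType.

Lemma differentiable_eps (V W : normedModType R) (f : V -> W) (df : {linear V -> W}) x :
  continuous df ->
  (forall e : R, 0 < e -> exists2 r : R, 0 < r & forall y, `|y - x| < r ->
     `|f y - f x - df (y - x)| <= e * `|y - x|) ->
  differentiable f x /\ 'd f x = df :> (V -> W).
Proof.
move=> cdf H.
have E : f \o shift x = cst (f x) + df +o_ 0 id.
  apply/eqaddoP => e e0; have [r r0 Hr] := H e e0.
  apply/near_eps; exists r => //= y; rewrite subr0 => yr.
  have := Hr (y + x); rewrite addrK => /(_ yr).
  by congr (`|_| <= _); rewrite [RHS]/= opprD addrA.
have D := diff_unique cdf E; split=> //.
by apply/diff_locallyP; rewrite D.
Qed.

Lemma differentiable_epsE (V W : normedModType R) (f : V -> W) x :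
  differentiable f x ->
  forall e : R, 0 < e -> exists2 r : R, 0 < r & forall y, `|y - x| < r ->
     `|f y - f x - 'd f x (y - x)| <= e * `|y - x|.
Proof.
move=> /diff_locallyP [_ /eqaddoP H] e e0.
have /near_eps[r r0 Hr] := H e e0; exists r => // y yr.
have := Hr (y - x); rewrite subr0 => /(_ yr).
rewrite -[X in `|X| <= _]/(f (y - x + x) - (f x + 'd f x (y - x))) subrK.
by rewrite opprD addrA.
Qed.

Lemma differentiable_near (V W : normedModType R) (f g : V -> W) x :
  (\forall y \near x, f y = g y) -> differentiable f x -> differentiable g x.
Proof.
move=> fg df; have fgx : f x = g x by exact: nbhs_singleton fg.
have /near_eps[r r0 Hr] := fg.
apply: (proj1 (differentiable_eps (df := 'd f x) (diff_continuous df) _)) => e e0.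
 have [r' r'0 Hr'] := differentiable_epsE df e0.
exists (Num.min r r'); first by rewrite lt_min r0.
move=> y; rewrite lt_min => /andP[yr yr'].
by rewrite -fgx -Hr ?Hr'.
Qed.

Lemma sdiff_differentiable d m (F : 'rV[R]_d -> 'rV[R]_m) x D : sdiff F x D ->
  differentiable F x /\ 'J F x = D.
Proof.
move=> sF.
have [||dF E] := @differentiable_eps _ _ F (mulmxr D) x.
- move=> z; apply/(@continuous_epsP R 'rV[R]_d 'rV[R]_m (mulmxr D) z) => e e0.
  exists (e / (d%:R * `|D| + 1)); first by rewrite divr_gt0 // ltr_wpDl // mulr_ge0.
  move=> y yr; rewrite -linearB /= (le_trans (norm_mulmx _ _)) // mulrAC.
  rewrite -[leRHS]mulr1; apply: le_mul_div; rewrite ?mulr_ge0 // mulr1 ltW //.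
- move=> e e0; have [r r0 Hr] := sF e e0; exists r => // y yr.
  by apply: Hr; rewrite // subrr normr0.
split=> //; apply/row_matrixP => i.
by rewrite !rowE -diffE_jacobian // E.
Qed.

End FrechetEps.

Section CkAlgebra.
Variables (R : realType) (d : nat) (U : set 'rV[R]_d).
Hypothesis U_open : open U.

Let nearU x : U x -> \forall y \near x, U y.
Proof. by move=> Ux; apply: open_nbhs_nbhs; split. Qed.

Lemma partial_ext (W : normedModType R) (F G : 'rV[R]_d -> W) a :
  (forall x, U x -> F x = G x) -> forall x, U x -> partial a F x = partial a G x.
Proof.
move=> FG x Ux; rewrite /partial; have [v0|v0] := eqVneq (delta_mx 0 a : 'rV[R]_d) 0.
  by rewrite v0 !derive0.
by apply: near_eq_derive => //; apply: filterS (nearU Ux) => y; exact: FG.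
Qed.

Lemma Ck_ext (W : normedModType R) r : forall F G : 'rV[R]_d -> W,
  (forall x, U x -> F x = G x) -> Ck r U F -> Ck r U G.
Proof.
elim: r => [|r IH] F G FG /=.
  move=> cF x Ux; have nFG : \forall y \near x, F y = G y.
    by apply: filterS (nearU Ux) => y; exact: FG.
  by rewrite /prop_for /continuous_at -FG //; exact: (cvg_trans (near_eq_cvg nFG) (cF x Ux)).
move=> [dF pF]; split=> [x Ux|a].
  by apply: differentiable_near (dF x Ux); apply: filterS (nearU Ux) => y; exact: FG.
by apply: (IH (partial a F)); [exact: partial_ext|exact: pF].
Qed.

Lemma Ck_weak (W : normedModType R) r : forall F : 'rV[R]_d -> W, Ck r.+1 U F -> Ck r U F.
Proof.
elim: r => [|r IH] F [dF pF]; first by move=> x /dF; exact: differentiable_continuous.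
by split=> // a; apply: IH; exact: pF.
Qed.

Lemma Ck_cst (W : normedModType R) (c : W) r : Ck r U (fun=> c).
Proof.
elim: r c => [|r IH] c; first by move=> x _; exact: cst_continuous.
split=> [x _|a]; first exact: differentiable_cst.
have -> : partial a (fun=> c) = (fun=> 0) by apply/funext => x; rewrite /partial derive_cst.
exact: IH.
Qed.

Lemma Ck_id r : Ck r U (@id 'rV[R]_d).
Proof.
case: r => [|r]; first by move=> x _; exact: cvg_id.
split=> [x _|a]; first exact: ex_diff.
have -> : partial a id = (fun=> delta_mx 0 a : 'rV[R]_d).
  by apply/funext => x; rewrite /partial derive_id.
exact: Ck_cst.
Qed.

Lemma Ck_add (W : normedModType R) r : forall f g : 'rV[R]_d -> W,
  Ck r U f -> Ck r U g -> Ck r U (fun x => f x + g x).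
Proof.
elim: r => [|r IH] f g; first by move=> cf cg x Ux; exact: (continuousD (cf x Ux) (cg x Ux)).
move=> [df pf] [dg pg]; split=> [x Ux|a].
  by apply: (@differentiableD _ _ _ f g); [exact: df|exact: dg].
apply: (@Ck_ext _ _ (fun x => partial a f x + partial a g x)); last first.
  by apply: IH; [exact: pf|exact: pg].
move=> x Ux; rewrite /partial -(@deriveD _ _ _ f g) //.
- exact/diff_derivable/df.
- exact/diff_derivable/dg.
Qed.

Lemma Ck_mul r : forall f g : 'rV[R]_d -> R,
  Ck r U f -> Ck r U g -> Ck r U (fun x => f x * g x).
Proof.
elim: r => [|r IH] f g; first by move=> cf cg x Ux; exact: (continuousM (cf x Ux) (cg x Ux)).
move=> Cf Cg; have [df pf] := Cf; have [dg pg] := Cg; split=> [x Ux|a].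
  by apply: (@differentiableM _ _ f g); [exact: df|exact: dg].
apply: (@Ck_ext _ _ (fun x => f x * partial a g x + g x * partial a f x)); last first.
  by apply: Ck_add; apply: IH; [exact: Ck_weak|exact: pg|exact: Ck_weak|exact: pf].
move=> x Ux; rewrite /partial (@deriveM _ _ f g) //.
- exact/diff_derivable/df.
- exact/diff_derivable/dg.
Qed.

Lemma Ck_inv r : forall f : 'rV[R]_d -> R, (forall x, U x -> f x != 0) ->
  Ck r U f -> Ck r U (fun x => (f x)^-1).
Proof.
elim: r => [|r IH] f f0; first by move=> cf x Ux; exact: (continuousV (f0 x Ux) (cf x Ux)).
move=> Cf; have [df pf] := Cf; split=> [x Ux|a].
  by apply: (@differentiableV _ _ f); [exact: df|exact: f0].
apply: (@Ck_ext _ _ (fun x => - 1 * ((f x)^-1 * (f x)^-1) * partial a f x)); last first.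
  apply: Ck_mul; last exact: pf; apply: Ck_mul; first exact: Ck_cst.
  by apply: Ck_mul; apply: IH => //; exact: Ck_weak.
move=> x Ux; rewrite /partial (@deriveV _ _ f) ?f0 //; last exact/diff_derivable/df.
by rewrite /GRing.scale /= mulN1r -expr2 exprVn.
Qed.

Lemma Ck_sum (W : normedModType R) (I : Type) (s : seq I) (P : pred I) (F : I -> 'rV[R]_d -> W) r :
  (forall i, Ck r U (F i)) -> Ck r U (fun x => \sum_(i <- s | P i) F i x).
Proof.
move=> CF; elim: s => [|i s IH].
  by apply: (@Ck_ext W r (fun=> 0)) => [x _|]; [rewrite big_nil|exact: Ck_cst].
apply: (@Ck_ext _ _ (fun x => (if P i then F i x else 0) + \sum_(i <- s | P i) F i x)).
  by move=> x _; rewrite big_cons; case: (P i); rewrite ?add0r.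
by apply: Ck_add => //; case: (P i); [exact: CF|exact: Ck_cst].
Qed.

Lemma Ck_prod (I : Type) (s : seq I) (F : I -> 'rV[R]_d -> R) r :
  (forall i, Ck r U (F i)) -> Ck r U (fun x => \prod_(i <- s) F i x).
Proof.
move=> CF; elim: s => [|i s IH].
  by apply: (@Ck_ext R r (fun=> 1)) => [x _|]; [rewrite big_nil|exact: Ck_cst].
apply: (@Ck_ext _ _ (fun x => F i x * \prod_(i <- s) F i x)).
  by move=> x _; rewrite big_cons.
exact: Ck_mul.
Qed.

Lemma Ck_coord m n r : forall (F : 'rV[R]_d -> 'M[R]_(m, n)) i j,
  Ck r U F -> Ck r U (fun x => F x i j).
Proof.
elim: r => [|r IH] F i j.
  move=> cF x Ux; apply: (@continuous_comp _ _ _ F (fun A : 'M[R]_(m, n) => A i j)).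
    exact: cF.
  exact: coord_continuous.
move=> [dF pF]; split=> [x Ux|a].
  apply: (@differentiable_comp _ _ _ _ F (fun A : 'M[R]_(m, n) => A i j)); first exact: dF.
  exact: differentiable_coord.
apply: (@Ck_ext _ _ (fun x => partial a F x i j)); last exact: (IH (partial a F) i j (pF a)).
move=> x Ux; rewrite /partial derive_mx ?mxE //.
exact/diff_derivable/dF.
Qed.

Lemma Ck_scaler (W : normedModType R) (w : W) r : forall f : 'rV[R]_d -> R,
  Ck r U f -> Ck r U (fun x => f x *: w).
Proof.
elim: r => [|r IH] f; first by move=> cf x Ux; exact: (continuousZr_tmp (cf x Ux)).
move=> [df pf]; have dZ x : U x -> differentiable (fun x => f x *: w) x.
  by move=> Ux; exact: (differentiableZl w (df x Ux)).
split=> // a.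
apply: (@Ck_ext _ _ (fun x => partial a f x *: w)); last exact: (IH (partial a f) (pf a)).
move=> x Ux; rewrite /partial deriveE; last exact: df.
by rewrite deriveE ?(diffZl w (df x Ux)) //; exact: dZ.
Qed.

Lemma Ck_mx m n (F : 'rV[R]_d -> 'M[R]_(m, n)) r :
  (forall i j, Ck r U (fun x => F x i j)) -> Ck r U F.
Proof.
move=> CF; apply: (@Ck_ext _ _ (fun x => \sum_i \sum_j F x i j *: delta_mx i j)).
  by move=> x _; rewrite -matrix_sum_delta.
by apply: Ck_sum => i; apply: Ck_sum => j; apply: Ck_scaler.
Qed.

Lemma Ck_det n (A : 'rV[R]_d -> 'M[R]_n) r :
  (forall i j, Ck r U (fun x => A x i j)) -> Ck r U (fun x => \det (A x)).
Proof.
move=> CA; apply: Ck_sum => s; apply: Ck_mul; first exact: Ck_cst.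
by apply: Ck_prod => i; exact: CA.
Qed.

(** Cramer's rule: each entry is a signed cofactor divided by the determinant. *)
Lemma Ck_invmx n (A : 'rV[R]_d -> 'M[R]_n) r i j :
  (forall x, U x -> A x \in unitmx) ->
  (forall i j, Ck r U (fun x => A x i j)) -> Ck r U (fun x => invmx (A x) i j).
Proof.
move=> uA CA.
apply: (@Ck_ext _ _ (fun x => (\det (A x))^-1 *
   ((-1) ^+ (j + i) * \det (row' j (col' i (A x)))))).
  by move=> x Ux; rewrite /invmx uA // !mxE.
apply: Ck_mul.
  apply: Ck_inv; last exact: Ck_det.
  by move=> x /uA; rewrite unitmxE unitfE.
apply: Ck_mul; first exact: Ck_cst.
apply: Ck_det => k l.
by apply: (@Ck_ext R r _ _ _ (CA (lift j k) (lift i l))) => x _; rewrite !mxE.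
Qed.

Lemma Ck1_near m (F : 'rV[R]_d -> 'rV[R]_m) x : Ck 1 U F -> U x ->
  exists2 r : R, 0 < r & [/\ forall z, `|z - x| <= r -> U z,
    forall z, `|z - x| <= r -> differentiable F z &
    forall z, `|z - x| <= r -> {for z, continuous (fun y => 'J F y)}].
Proof.
move=> [dF pF] Ux.
have [r r0 rU] := open_cball U_open Ux; exists r => //.
split=> // z zr; first exact/dF/rU.
apply: jacobian_continuous; last by move=> i; apply: pF; exact: rU.
by apply: filterS (nearU (rU z zr)) => y; exact: dF.
Qed.

Lemma Ck1_sdiff m (F : 'rV[R]_d -> 'rV[R]_m) x : Ck 1 U F -> U x -> sdiff F x ('J F x).
Proof.
by move=> CF Ux; have [r r0 [_ dF cJ]] := Ck1_near CF Ux; exact: C1_sdiff cJ.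
Qed.

End CkAlgebra.

(** * Functions of the position on phase space *)

Section CkPhase.
Variables (R : realType) (n p : nat) (U : set 'rV[R]_n).
Hypothesis U_open : open U.

Lemma lsubmx_cont : continuous (fun z : 'rV[R]_(n + p) => lsubmx z).
Proof. by move=> z; apply: differentiable_continuous; exact: differentiable_lsubmx. Qed.

Lemma open_lsubmx : open [set z : 'rV[R]_(n + p) | U (lsubmx z)].
Proof. by apply: open_comp => // z _; exact: lsubmx_cont. Qed.

(** Derivatives in position directions commute with the composition and those in velocity directions
    vanish, which lets the induction on r run. *)
Lemma Ck_lsubmx (W : normedModType R) r : forall f : 'rV[R]_n -> W, Ck r U f ->
  Ck r [set z : 'rV[R]_(n + p) | U (lsubmx z)] (fun z => f (lsubmx z)).
Proof.
elim: r => [|r IH] f.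
  move=> cf z Uz; apply: (@continuous_comp _ _ _ (fun z : 'rV[R]_(n + p) => lsubmx z) f).
    exact: lsubmx_cont.
  exact: cf.
move=> [df pf].
have dl z : differentiable (fun z : 'rV[R]_(n + p) => lsubmx z) z by exact: differentiable_lsubmx.
have dfl z : U (lsubmx z) -> differentiable (fun z : 'rV[R]_(n + p) => f (lsubmx z)) z.
  by move=> Uz; apply: (@differentiable_comp _ _ _ _ (fun z => lsubmx z) f); [exact: dl|exact: df].
split=> // a.
have dE z v : U (lsubmx z) ->
    'D_v (fun z : 'rV[R]_(n + p) => f (lsubmx z)) z = 'd f (lsubmx z) (lsubmx v).
  move=> Uz; rewrite deriveE; last exact: dfl.
  rewrite (@diff_comp _ _ _ _ (fun z : 'rV[R]_(n + p) => lsubmx z) f) //=; last exact: df.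
  congr ('d f _ _).
  by rewrite (@diff_lin _ _ _ (@lsubmx R 1 n p) z) //; exact: lsubmx_cont.
have oU := open_lsubmx.
case: (fintype.split a) (fintype.splitK a) => i /= <-.
  apply: (@Ck_ext _ _ _ oU _ _ (fun z => partial i f (lsubmx z))); last exact/IH/pf.
  move=> z Uz; rewrite /partial dE // deriveE; last exact: df.
  congr ('d f _ _); apply/rowP => j; rewrite !mxE /=.
  by rewrite (inj_eq (@lshift_inj _ _)).
apply: (@Ck_ext _ _ _ oU _ _ (fun=> 0)); last exact: Ck_cst.
have l0 : lsubmx (delta_mx 0 (rshift n i) : 'rV[R]_(n + p)) = 0.
  by apply/rowP => j; rewrite !mxE /= eq_lrshift.
by move=> z Uz; rewrite /partial dE // l0 linear0.
Qed.

End CkPhase.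

(** * Coverings by a vector space *)

Section Clipping.
Variable R : realType.

(** Retraction of the line onto [a, b] when a <= b; composing with it turns maps known on an
    interval into total continuous ones. *)
Definition clip (a b t : R) := Num.max a (Num.min b t).

Lemma clip_in a b t : a <= b -> a <= clip a b t <= b.
Proof. by move=> ab; rewrite /clip le_max lexx /= ge_max ab ge_min lexx. Qed.

Lemma clip_id a b t : a <= t <= b -> clip a b t = t.
Proof. by move=> /andP[at_ tb]; rewrite /clip min_r // max_r. Qed.

Lemma clip_lip a b t t' : a <= b -> `|clip a b t - clip a b t'| <= `|t - t'|.
Proof.
move=> ab; wlog tt' : t t' / t <= t'.
  move=> H; have [/H//|/ltW t't] := leP t t'.
  by rewrite distrC (distrC t) H.
rewrite (ler0_norm (x := t - t')) ?subr_le0 // ler_norml /clip /Num.max /Num.min.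
case: (ltP b t) => ?; case: (ltP b t') => ?; case: ltP => ?; case: ltP => ?;
  by apply/andP; split; lra.
Qed.

Lemma clip_cont a b : a <= b -> continuous (clip a b).
Proof.
move=> ab t; apply/(@continuous_epsP R R R (clip a b) t) => e e0.
by exists e => // s se; apply: (le_trans (clip_lip _ _ ab)); exact: ltW.
Qed.

Lemma pair_cont (X Y Z : topologicalType) (f : X -> Y) (h : X -> Z) :
  continuous f -> continuous h -> continuous (fun x => (f x, h x)).
Proof.
move=> cf ch x A [[B C] /= [nB nC] BC].
have nBC : nbhs x ((f @^-1` B) `&` (h @^-1` C)) by apply: filterI; [exact: cf|exact: ch].
have sub : (f @^-1` B) `&` (h @^-1` C) `<=` (fun x => (f x, h x)) @^-1` A.
  by move=> y [By Cy]; exact: (BC (f y, h y)).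
exact: (filterS sub nBC).
Qed.

Lemma within_comp_cont (X Y Z : topologicalType) (A : set Y) (c : X -> Y) (f : Y -> Z) :
  {within A, continuous f} -> continuous c -> (forall x, A (c x)) -> continuous (f \o c).
Proof.
move=> /subspace_continuousP cf cc Ac x.
have h := cf (c x) (Ac x) .
move=> V nV; have := h V nV; rewrite /= /nbhs /= /within /= => nb.
have := cc x _ nb; rewrite /nbhs /=; apply: filterS => y /= H.
exact: H (Ac y).
Qed.

Lemma comp_clip_cont (W : topologicalType) (f : R -> W) a b : a <= b ->
  (forall t, a <= t <= b -> {for t, continuous f}) -> continuous (f \o clip a b).
Proof.
move=> ab cf t; apply: continuous_comp; first exact: clip_cont.
by apply: cf; exact: clip_in.
Qed.

Lemma continuous_glue (W : topologicalType) (f h : R -> W) (a : R) :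
  continuous f -> continuous h -> f a = h a -> continuous (fun t => if t <= a then f t else h t).
Proof.
move=> cf ch fh t A /=; have [ta|ta|->] := ltgtP t a => nA.
- have /near_eps[e e0 He] := cf t _ nA.
  apply/near_eps; exists (Num.min e (a - t)); first by rewrite lt_min e0 subr_gt0.
  move=> s; rewrite lt_min => /andP[se sa] /=; have -> : s <= a.
    by move: sa; rewrite ltr_norml => /andP[? ?]; lra.
  exact: He.
- have /near_eps[e e0 He] := ch t _ nA.
  apply/near_eps; exists (Num.min e (t - a)); first by rewrite lt_min e0 subr_gt0.
  move=> s; rewrite lt_min => /andP[se sa] /=; have -> : (s <= a) = false.
    by apply/negbTE; rewrite -ltNge; move: sa; rewrite ltr_norml => /andP[? ?]; lra.
  exact: He.
have nA' := nA; rewrite fh in nA'.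
have /near_eps[e e0 He] := cf a _ nA; have /near_eps[e' e'0 He'] := ch a _ nA'.
apply/near_eps; exists (Num.min e e'); first by rewrite lt_min e0.
move=> s; rewrite lt_min => /andP[se se'] /=.
by case: ifP => _; [exact: He|exact: He'].
Qed.

End Clipping.

(** * Lifting paths and homotopies *)

Section Covering.
Variables (R : realType) (n : nat) (T : topologicalType) (E : 'rV[R]_n -> T).
Hypothesis E_cont : continuous E.
Hypothesis E_inj : forall v, exists2 r : R, 0 < r & forall a b, `|a - v| < r ->
  `|b - v| < r -> E a = E b -> a = b.
(** A form of even covering that does not speak of disjoint sheets. U is chosen before v, so that
    one U serves every point of the fibre. *)
Hypothesis E_sec : forall q : T, exists2 U : set T, open U /\ U q &
  forall v, U (E v) -> exists s : T -> 'rV[R]_n, s (E v) = v /\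
    forall q', U q' -> E (s q') = q' /\ {for q', continuous s}.

(** Near a time where the lifts agree, local injectivity keeps them together; near a time where they
    differ, continuity keeps them apart. Agreement is thus locally constant. *)
Lemma unique_lift (w1 w2 : R -> 'rV[R]_n) t0 :
  continuous w1 -> continuous w2 -> (forall t, E (w1 t) = E (w2 t)) ->
  w1 t0 = w2 t0 -> forall t, w1 t = w2 t.
Proof.
move=> c1 c2 Ew w0; apply: (@loc_const_induction R _ t0 w0) => t.
have [r r0 Hr] := E_inj (w1 t).
have [e1 e10 H1] := (continuous_epsP w1 t).1 (c1 t) (r / 4) (ltac:(by rewrite divr_gt0)).
have [weq|wne] := eqVneq (w1 t) (w2 t).
  have [e2 e20 H2] := (continuous_epsP w2 t).1 (c2 t) (r / 4) (ltac:(by rewrite divr_gt0)).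
  exists (Num.min e1 e2); first by rewrite lt_min e10.
  move=> s u _; rewrite lt_min => /andP[u1 u2] _; apply: Hr => //.
    by apply: (le_lt_trans (H1 u u1)); rewrite ltr_pdivrMr // ltr_pMr // ltr1n.
  by rewrite weq; apply: (le_lt_trans (H2 u u2)); rewrite ltr_pdivrMr // ltr_pMr // ltr1n.
have D0 : 0 < `|w1 t - w2 t| by rewrite normr_gt0 subr_eq0.
have D4 : 0 < `|w1 t - w2 t| / 4 by rewrite divr_gt0.
have [e3 e30 H3] := (continuous_epsP w1 t).1 (c1 t) _ D4.
have [e4 e40 H4] := (continuous_epsP w2 t).1 (c2 t) _ D4.
exists (Num.min e3 e4); first by rewrite lt_min e30.
move=> s u; rewrite lt_min => /andP[s1 s2] _ ws; exfalso.
have h3 := H3 s s1; have h4 := H4 s s2; rewrite -ws in h4.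
have : `|w1 t - w2 t| <= `|w1 t - w2 t| / 4 + `|w1 t - w2 t| / 4.
  rewrite -[X in `|X| <= _](subrKA (w1 s)) (le_trans (ler_normD _ _)) // lerD //.
  by rewrite distrC.
by move: D0; lra.
Qed.

Lemma unique_lift_on (w1 w2 : R -> 'rV[R]_n) a b t0 : a <= t0 <= b ->
  (forall t, a <= t <= b -> {for t, continuous w1}) ->
  (forall t, a <= t <= b -> {for t, continuous w2}) ->
  (forall t, a <= t <= b -> E (w1 t) = E (w2 t)) -> w1 t0 = w2 t0 ->
  forall t, a <= t <= b -> w1 t = w2 t.
Proof.
move=> t0ab c1 c2 Ew w0 t tab.
have ab : a <= b by case/andP: t0ab; exact: le_trans.
have := @unique_lift (w1 \o clip a b) (w2 \o clip a b) t0
  (comp_clip_cont ab c1) (comp_clip_cont ab c2).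
rewrite /= => /(_ (fun t => Ew _ (clip_in t ab))); rewrite !clip_id // => /(_ w0 t).
by rewrite clip_id.
Qed.

(** Having a lift on [0, t] is locally constant in t: over one neighbourhood U of sig t, a section
    extends any lift, whatever its end point. *)
Lemma lift_path (sig : R -> T) v0 : continuous sig -> E v0 = sig 0 ->
  exists w, [/\ continuous w, w 0 = v0 & forall t : R, 0 <= t <= 1 -> E (w t) = sig t].
Proof.
move=> cs E0.
pose P t := exists w, [/\ continuous w, w 0 = v0 & forall s : R, 0 <= s <= t -> E (w s) = sig s].
suff : P 1 by [].
apply: (@loc_const_induction R P 0).
  exists (fun=> v0); split=> // [|s]; first exact: cst_continuous.
  by move=> /andP[s1 s2]; have -> : s = 0 by apply/eqP; rewrite eq_le s1 s2.
move=> t; have [U [oU Ut] HU] := E_sec (sig t).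
have /near_eps[e e0 He] : nbhs t (sig @^-1` U) by apply: cs; exact: open_nbhs_nbhs.
exists e => // s u se ue [w [cw w0 Ew]].
have [us|su] := leP u s.
  by exists w; split=> // x /andP[x0 xu]; apply: Ew; rewrite x0 (le_trans xu).
(* For s < 0 the lift on [0, s] carries no information, and the new one starts afresh from v0. *)
have [s0|s0] := ltP s 0.
  have [u0|u0] := ltP u 0.
    exists (fun=> v0); split=> // [|x]; first exact: cst_continuous.
    by move=> /andP[x1 x2]; have := le_trans x1 x2; rewrite leNgt u0.
  have z0 : `|0 - t| < e.
    by move: se ue; rewrite !ltr_norml => /andP[? ?] /andP[? ?]; apply/andP; split; lra.
  have [sc [sc0 Hsc]] := HU v0 (ltac:(by rewrite E0; exact: He)).
  have inU x : 0 <= x <= u -> U (sig x).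
    move=> /andP[x1 x2]; apply: He; move: z0 ue; rewrite !ltr_norml => /andP[? ?] /andP[? ?].
    by apply/andP; split; lra.
  exists ((sc \o sig) \o clip 0 u); split.
  - apply: (@comp_clip_cont R _ (sc \o sig) 0 u u0) => x xu.
    apply: (@continuous_comp _ _ _ sig sc); first exact: cs.
    exact: (Hsc _ (inU x xu)).2.
  - by rewrite /= clip_id ?lexx // -E0.
  by move=> x xu; rewrite /= clip_id //; have [] := Hsc _ (inU x xu).
have [sc [sc0 Hsc]] := HU (w s) (ltac:(by rewrite Ew ?s0 ?lexx //; exact: He)).
rewrite Ew ?s0 ?lexx // in sc0.
have inU x : s <= x <= u -> U (sig x).
  move=> /andP[x1 x2]; apply: He; move: se ue; rewrite !ltr_norml => /andP[? ?] /andP[? ?].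
  by apply/andP; split; lra.
have su' := ltW su.
have cA : continuous (w \o clip 0 s) by apply: (@comp_clip_cont R _ w 0 s s0) => x _; exact: cw.
have cB : continuous ((sc \o sig) \o clip s u).
  apply: (@comp_clip_cont R _ (sc \o sig) s u su') => x xu.
  apply: (@continuous_comp _ _ _ sig sc); first exact: cs.
  exact: (Hsc _ (inU x xu)).2.
(* Concatenation by addition in the vector space: on each side of s one of the two clipped paths is
   constant, equal to w s. *)
exists (fun x => (w \o clip 0 s) x + ((sc \o sig) \o clip s u) x - w s); split.
- move=> x; apply: (@continuousB _ _ _
      (fun x => (w \o clip 0 s) x + ((sc \o sig) \o clip s u) x) (fun=> w s)).
    exact: (continuousD (cA x) (cB x)).
  exact: cst_continuous.
- rewrite /= clip_id ?lexx ?s0 // /clip min_r ?(le_trans s0) // max_l // sc0.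
  by rewrite addrK.
move=> x /andP[x0 xu] /=; have [xs|sx] := leP x s.
  rewrite clip_id ?x0 // /clip min_r // max_l // sc0 addrK.
  by apply: Ew; rewrite x0.
rewrite (clip_id (a := s)) ?(ltW sx) // /clip (min_l (ltW sx)) max_r // addrC addKr.
by have [] := Hsc (sig x) (inU x (ltac:(by rewrite ltW))).
Qed.

(** A lift of K s is chosen for each s separately; continuity in s at fixed t is then propagated in
    t. Continuity in each variable separately is what uniqueness of lifts consumes. *)
Lemma lift_homotopy (K : R -> R -> T) v0 : continuous (fun st : R * R => K st.1 st.2) ->
  (forall s, K s 0 = E v0) ->
  exists L : R -> R -> 'rV[R]_n,
    [/\ forall s, L s 0 = v0, forall s t : R, 0 <= t <= 1 -> E (L s t) = K s t,
        forall s, continuous (L s) & forall t : R, 0 <= t <= 1 -> continuous (L^~ t)].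
Proof.
move=> cK K0.
have cKs s : continuous (K s).
  move=> t; apply: (@continuous_comp _ _ _ (fun t : R => (s, t)) (fun st : R * R => K st.1 st.2)).
    by apply: (@pair_cont _ _ _ (fun=> s) id) => ?; [exact: cst_continuous|exact: cvg_id].
  exact: cK.
have ex s : exists w, [/\ continuous w, w 0 = v0 & forall t : R, 0 <= t <= 1 -> E (w t) = K s t].
  by apply: lift_path => //; rewrite K0.
pose L s := projT1 (cid (ex s)).
have HL s : [/\ continuous (L s), L s 0 = v0 & forall t : R, 0 <= t <= 1 -> E (L s t) = K s t].
  by rewrite /L; case: cid.
exists L; split.
- by move=> s; have [] := HL s.
- by move=> s t; have [_ _] := HL s; apply.
- by move=> s; have [] := HL s.
have L0 s : L s 0 = v0 by have [] := HL s.
have cL s : continuous (L s) by have [] := HL s.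
have EL s t : 0 <= t <= 1 -> E (L s t) = K s t by have [_ _] := HL s; apply.
move=> t1 t1i s0.
pose P t := {for s0, continuous (fun s => L s (clip 0 1 t))}.
suff : P t1 by rewrite /P clip_id.
apply: (@loc_const_induction R P 0).
  rewrite /P clip_id ?lexx ?ler01 //.
  have -> : (fun s => L s 0) = (fun=> v0) by apply/funext.
  exact: cst_continuous.
move=> t; set c := clip 0 1 t; have c01 : 0 <= c <= 1 by exact: clip_in.
have [U [oU Uc] HU] := E_sec (K s0 c).
have : nbhs (s0, c) ((fun st : R * R => K st.1 st.2) @^-1` U).
  by apply: cK; exact: open_nbhs_nbhs.
move=> [[A B] /= [/near_eps[e1 e10 H1] /near_eps[e2 e20 H2]] AB].
have KU s u : `|s - s0| < e1 -> `|u - c| < e2 -> U (K s u).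
  by move=> sA uB; apply: (AB (s, u)); split; [exact: H1|exact: H2].
have s00 : `|s0 - s0| < e1 by rewrite subrr normr0.
have [sc [sc0 Hsc]] := HU (L s0 c) (ltac:(by rewrite EL //; apply: KU => //; rewrite subrr normr0)).
rewrite EL // in sc0.
exists e2; first exact: e20.
move=> p q pt qt; rewrite /P.
set p' := clip 0 1 p; set q' := clip 0 1 q => cp.
have p01 : 0 <= p' <= 1 by exact: clip_in.
have q01 : 0 <= q' <= 1 by exact: clip_in.
have pc : `|p' - c| < e2 by apply: le_lt_trans pt; exact: clip_lip.
have qc : `|q' - c| < e2 by apply: le_lt_trans qt; exact: clip_lip.
have inB (x a b : R) : `|a - c| < e2 -> `|b - c| < e2 -> Num.min a b <= x <= Num.max a b -> `|x - c| < e2.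
  rewrite !ltr_norml ge_min le_max => /andP[a1 a2] /andP[b1 b2] /andP[h1 h2].
  by clear -a1 a2 b1 b2 h1 h2; case/orP: h1 => ?; case/orP: h2 => ?; apply/andP; split; lra.
have in01 (x a b : R) : 0 <= a <= 1 -> 0 <= b <= 1 -> Num.min a b <= x <= Num.max a b -> 0 <= x <= 1.
  rewrite ge_min le_max => /andP[a1 a2] /andP[b1 b2] /andP[h1 h2].
  by clear -a1 a2 b1 b2 h1 h2; case/orP: h1 => ?; case/orP: h2 => ?; apply/andP; split; lra.
have minmax (a b : R) : Num.min a b <= a <= Num.max a b /\ Num.min a b <= b <= Num.max a b.
  by rewrite !ge_min !le_max !lexx !orbT.
(* Over U, a lift that meets the section [sc] at time a follows it up to time b, by uniqueness on
   the interval between them. *)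
have agree s a b : `|s - s0| < e1 -> `|a - c| < e2 -> `|b - c| < e2 ->
    0 <= a <= 1 -> 0 <= b <= 1 -> L s a = sc (K s a) -> L s b = sc (K s b).
  move=> se ac bc a01 b01 La.
  have [m1 m2] := minmax a b.
  have UK x : Num.min a b <= x <= Num.max a b -> U (K s x).
    by move=> xab; exact: (KU s x se (inB _ _ _ ac bc xab)).
  have c2 x : Num.min a b <= x <= Num.max a b -> {for x, continuous (fun x => sc (K s x))}.
    move=> xab; apply: (@continuous_comp _ _ _ (K s) sc); first exact: cKs.
    exact: (Hsc _ (UK x xab)).2.
  have e2' x : Num.min a b <= x <= Num.max a b -> E (L s x) = E (sc (K s x)).
    move=> xab; rewrite EL; last exact: in01 xab.
    by rewrite (Hsc _ (UK x xab)).1.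
  exact: (@unique_lift_on (L s) (fun x => sc (K s x)) _ _ a m1 (fun x _ => cL s x) c2 e2' La b m2).
have cc : `|c - c| < e2 by rewrite subrr normr0.
have Lp : L s0 p' = sc (K s0 p') by exact: (agree s0 c p' s00 cc pc c01 p01 (esym sc0)).
have cKp u : `|u - c| < e2 -> {for s0, continuous (fun s => sc (K s u))}.
  move=> uc; apply: (@continuous_comp _ _ _ (fun s => K s u) sc).
    apply: (@continuous_comp _ _ _ (fun s : R => (s, u)) (fun st : R * R => K st.1 st.2)).
      by apply: (@pair_cont _ _ _ id (fun=> u)) => ?; [exact: cvg_id|exact: cst_continuous].
    exact: cK.
  by have [] := Hsc _ (KU s0 u s00 uc).
have [r r0 Hr] := E_inj (L s0 p').
have r2 : 0 < r / 2 by rewrite divr_gt0.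
have rr := half_lt r0.
have [d1 d10 D1] := (continuous_epsP _ _).1 cp _ r2.
have [d2 d20 D2] := (continuous_epsP _ _).1 (cKp p' pc) _ r2.
(* At time p' the lift and the section are both near L s0 p' and have the same image, hence agree by
   local injectivity; [agree] moves this to time q'. *)
have near_eq s : `|s - s0| < Num.min e1 (Num.min d1 d2) -> sc (K s q') = L s q'.
  rewrite !lt_min => /and3P[se sd1 sd2]; apply/esym/(agree s p' q' se pc qc p01 q01).
  apply: Hr.
  - by apply: le_lt_trans rr; exact: D1.
  - by apply: le_lt_trans rr; rewrite Lp; exact: D2.
  rewrite EL //; by have [-> _] := Hsc _ (KU s p' se pc).
have nE : \forall s \near s0, sc (K s q') = L s q'.
  apply/near_eps; exists (Num.min e1 (Num.min d1 d2)); first by rewrite !lt_min e10 d10.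
  exact: near_eq.
have := cKp q' qc; rewrite /prop_for /continuous_at (near_eq s0); last first.
  by rewrite subrr normr0 !lt_min e10 d10.
by move=> h; exact: (cvg_trans (near_eq_cvg nE) h).
Qed.

Hypothesis T_sc : simply_connected R T.

(** The loop follows the image of the segment from 0 to v and returns along the image of the segment
    from w to 0. As the loop contracts, its lift from 0 ends at 0; read forwards this lift is the
    first segment, read backwards the second, so at time 1/2 it is both v and w. *)
Lemma covering_injective : injective E.
Proof.
move=> v w Evw.
pose f (t : R) := E ((2 * t) *: v); pose h (t : R) := E ((2 - 2 * t) *: w).
have cl (a b : R) (x : 'rV[R]_n) : continuous (fun t : R => (a + b * t) *: x).
  move=> t; have -> : (fun t : R => (a + b * t) *: x) = (fun t => a *: x + t *: (b *: x)).
    by apply/funext => s; rewrite scalerDl scalerA (mulrC s).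
  exact: is_derive_continuous (is_derive_line (a *: x) (b *: x) t).
have cl1 (x : 'rV[R]_n) : continuous (fun t : R => (2 * t) *: x).
  have -> : (fun t : R => (2 * t) *: x) = (fun t => (0 + 2 * t) *: x).
    by apply/funext => s; rewrite add0r.
  exact: cl.
have cl2 (x : 'rV[R]_n) : continuous (fun t : R => (2 - 2 * t) *: x).
  have -> : (fun t : R => (2 - 2 * t) *: x) = (fun t => (2 + (-2) * t) *: x).
    by apply/funext => s; rewrite mulNr.
  exact: cl.
have cf : continuous f.
  move=> t; apply: (@continuous_comp _ _ _ (fun t : R => (2 * t) *: v) E); last exact: E_cont.
  exact: cl1.
have ch : continuous h.
  move=> t; apply: (@continuous_comp _ _ _ (fun t : R => (2 - 2 * t) *: w) E); last exact: E_cont.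
  exact: cl2.
have h21 : (1 <= 2^-1 :> R) = false by apply/negbTE; rewrite -ltNge invf_lt1 // ltr1n.
have h22 : 2 - 1 = 1 :> R by rewrite mulr2n addrK.
have half2 : 2 * 2^-1 = 1 :> R by rewrite divff.
have fh : f (2^-1) = h (2^-1).
  by rewrite /f /h half2 scale1r Evw; congr E; rewrite h22 scale1r.
pose gam t := if t <= 2^-1 then f t else h t.
have cgam : continuous gam by exact: continuous_glue.
have half : 0 <= (2^-1 : R) <= 1 by apply/andP; split; lra.
have g0 : gam 0 = E 0.
  by rewrite /gam; case: ifP => [_|/negbT]; [rewrite /f mulr0 scale0r|case/andP: half => ->].
have g1 : gam 1 = E 0.
  rewrite /gam; case: ifP => [|_]; first by rewrite h21.
  by rewrite /h mulr1 subrr scale0r.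
have [_ sc] := T_sc.
have [|H [cH H01 Hs]] := sc (E 0) gam; first by split=> //; exact: continuous_subspaceT.
pose K s t := H (clip 0 1 s, clip 0 1 t).
have cK : continuous (fun st : R * R => K st.1 st.2).
  have cc : continuous (fun st : R * R => (clip 0 1 st.1, clip 0 1 st.2) : R * R).
    apply: (@pair_cont _ _ _ (fun st : R * R => clip 0 1 st.1) (fun st : R * R => clip 0 1 st.2)) => st.
      by apply: (@continuous_comp _ _ _ fst (clip 0 1)); [exact: cvg_fst|exact: clip_cont].
    by apply: (@continuous_comp _ _ _ snd (clip 0 1)); [exact: cvg_snd|exact: clip_cont].
  suff in_sq (st : R * R) : (`[0, 1] `*` `[0, 1])%classic (clip 0 1 st.1, clip 0 1 st.2).
    exact: (within_comp_cont cH cc in_sq).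
  by split; rewrite /= in_itv /=; exact: clip_in.
have i01 (t : R) : clip 0 1 t \in `[0, 1]%R by rewrite in_itv /=; exact: clip_in.
have K0 s : K s 0 = E 0.
  by rewrite /K (clip_id (t := 0)) ?lexx ?ler01 //; have [] := Hs _ (i01 s).
have K1 s : K s 1 = E 0.
  by rewrite /K (clip_id (t := 1)) ?lexx ?ler01 //; have [] := Hs _ (i01 s).
have [L [L0 EL cL cLs]] := lift_homotopy cK K0.
have z01 : 0 <= (0 : R) <= 1 by rewrite lexx ler01.
have o01 : 0 <= (1 : R) <= 1 by rewrite lexx ler01.
(* The constant loop lifts to a constant, and the end points L s 1 form a continuous curve over the
   single point E 0, hence do not move. *)
have L11 : L 1 1 = 0.
  rewrite -(L0 1); apply: (@unique_lift_on (L 1) (fun=> L 1 0) 0 1 0 z01) => //.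
  - by move=> t _; exact: cL.
  - by move=> t _; exact: cst_continuous.
  move=> t t01; rewrite EL // L0 /K (clip_id (t := 1)) //.
  by have [_ ->] := H01 _ (i01 t).
have L01 : L 0 1 = 0.
  rewrite -L11; apply: (@unique_lift (L^~ 1) (fun=> L 1 1) 1) => //.
  - exact: cLs.
  - exact: cst_continuous.
  by move=> s; rewrite L11 EL // K1.
have E0t t : 0 <= t <= 1 -> E (L 0 t) = gam t.
  move=> t01; rewrite EL // /K (clip_id (t := 0)) // clip_id //.
  by have [-> _] := H01 t (ltac:(by rewrite in_itv)).
have Lv : L 0 2^-1 = v.
  have z2 : 0 <= (0 : R) <= 2^-1 by rewrite lexx; case/andP: half.
  have h2 : 0 <= (2^-1 : R) <= 2^-1 by rewrite lexx andbT; case/andP: half.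
  have eqE t : 0 <= t <= 2^-1 -> E (L 0 t) = E ((2 * t) *: v).
    move=> /andP[t0 th]; rewrite E0t /gam ?th // t0 (le_trans th) //.
    by case/andP: half.
  have L00 : L 0 0 = (2 * 0) *: v by rewrite L0 mulr0 scale0r.
  have := @unique_lift_on (L 0) (fun t => (2 * t) *: v) 0 2^-1 0 z2
    (fun t _ => cL 0 t) (fun t _ => cl1 v t) eqE L00 2^-1 h2.
  by rewrite half2 scale1r.
have Lw : L 0 2^-1 = w.
  have o2 : 2^-1 <= (1 : R) <= 1 by rewrite lexx andbT; case/andP: half.
  have h2 : 2^-1 <= (2^-1 : R) <= 1 by rewrite lexx; case/andP: half.
  have eqE t : 2^-1 <= t <= 1 -> E (L 0 t) = E ((2 - 2 * t) *: w).
    move=> /andP[th t1]; rewrite E0t; last by rewrite t1 andbT (le_trans _ th) //; case/andP: half.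
    rewrite /gam; case: ifP => // th'.
    have -> : t = 2^-1 by apply/eqP; rewrite eq_le th th'.
    exact: fh.
  have L01' : L 0 1 = (2 - 2 * 1) *: w by rewrite L01 mulr1 subrr scale0r.
  have := @unique_lift_on (L 0) (fun t => (2 - 2 * t) *: w) 2^-1 1 1 o2
    (fun t _ => cL 0 t) (fun t _ => cl2 w t) eqE L01' 2^-1 h2.
  by rewrite half2 h22 scale1r.
by rewrite -Lv -Lw.
Qed.

Lemma covering_surjective q : exists v, E v = q.
Proof.
have [pc _] := T_sc; have [gam [cg g0 g1]] := pc (E 0) q.
have cg' : continuous (gam \o clip 0 1).
  apply: (within_comp_cont cg); first exact: clip_cont.
  by move=> t; rewrite /= in_itv /=; exact: clip_in.
have [|w [_ _ Ew]] := @lift_path _ 0 cg'; first by rewrite /= clip_id ?lexx ?ler01.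
by exists (w 1); rewrite Ew ?lexx ?ler01 //= clip_id ?lexx ?ler01.
Qed.

End Covering.

(** * Riemannian metrics in coordinates *)

Section Inner.
Variables (R : realType) (n : nat).
Implicit Types (G : 'M[R]_n) (u v w : 'rV[R]_n).

Lemma innerE G u v : inner G u v = \sum_a \sum_b u 0 a * G a b * v 0 b.
Proof.
rewrite /inner mxE exchange_big /=; apply: eq_bigr => b _.
by rewrite !mxE mulr_suml.
Qed.

Lemma innerDl G u u' v : inner G (u + u') v = inner G u v + inner G u' v.
Proof. by rewrite /inner !mulmxDl mxE. Qed.

Lemma innerDr G u v v' : inner G u (v + v') = inner G u v + inner G u v'.
Proof. by rewrite /inner linearD mulmxDr mxE. Qed.

Lemma innerZl G a u v : inner G (a *: u) v = a * inner G u v.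
Proof. by rewrite /inner -!scalemxAl mxE. Qed.

Lemma innerZr G a u v : inner G u (a *: v) = a * inner G u v.
Proof. by rewrite /inner linearZ -scalemxAr mxE. Qed.

Lemma innerNl G u v : inner G (- u) v = - inner G u v.
Proof. by rewrite -scaleN1r innerZl mulN1r. Qed.

Lemma innerNr G u v : inner G u (- v) = - inner G u v.
Proof. by rewrite -scaleN1r innerZr mulN1r. Qed.

Lemma inner0l G v : inner G 0 v = 0.
Proof. by rewrite /inner !mul0mx mxE. Qed.

Lemma inner0r G u : inner G u 0 = 0.
Proof. by rewrite /inner trmx0 mulmx0 mxE. Qed.

Lemma inner_suml G I (s : seq I) (P : pred I) (F : I -> 'rV[R]_n) v :
  inner G (\sum_(i <- s | P i) F i) v = \sum_(i <- s | P i) inner G (F i) v.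
Proof. by elim/big_rec2: _ => [|i x y _ <-]; rewrite ?inner0l ?innerDl. Qed.

Lemma inner_sumr G I (s : seq I) (P : pred I) (F : I -> 'rV[R]_n) u :
  inner G u (\sum_(i <- s | P i) F i) = \sum_(i <- s | P i) inner G u (F i).
Proof. by elim/big_rec2: _ => [|i x y _ <-]; rewrite ?inner0r ?innerDr. Qed.

Lemma innerC G u v : G^T = G -> inner G u v = inner G v u.
Proof.
move=> GT; rewrite /inner -[u *m G *m v^T]trmxK mxE.
by rewrite !trmx_mul trmxK GT mulmxA.
Qed.

Definition posdef G := forall v, v != 0 -> 0 < inner G v v.

Lemma posdef_ge0 G v : posdef G -> 0 <= inner G v v.
Proof.
by move=> Gp; have [->|/Gp/ltW//] := eqVneq v 0; rewrite inner0l.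
Qed.

Lemma posdef_unit G : posdef G -> G \in unitmx.
Proof.
move=> Gp; rewrite unitmxE unitfE; apply/negP => /det0P[v v0 vG].
by have := Gp v v0; rewrite /inner vG mul0mx mxE ltxx.
Qed.

Lemma gram_det_ge0 G u v : G^T = G -> posdef G ->
  0 <= inner G u u * inner G v v - inner G u v ^+ 2.
Proof.
move=> GT Gp; have [->|v0] := eqVneq v 0; first by rewrite !inner0r mulr0 expr0n subr0.
have vv := Gp v v0.
(* The square norm of this vector is [inner G v v] times the Gram determinant. *)
have := posdef_ge0 (inner G v v *: u - inner G u v *: v) Gp.
rewrite !(innerDl, innerDr, innerNl, innerNr, innerZl, innerZr) (innerC v u GT) => h.
rewrite -(pmulr_rge0 _ vv); apply: le_trans h _; rewrite le_eqVlt; apply/orP; left.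
by apply/eqP; ring.
Qed.

Lemma gram_det_gt0 G u v : G^T = G -> posdef G -> v != 0 ->
  (forall a, u != a *: v) -> 0 < inner G u u * inner G v v - inner G u v ^+ 2.
Proof.
move=> GT Gp v0 uv; have vv := Gp v v0.
have nz : inner G v v *: u - inner G u v *: v != 0.
  rewrite subr_eq0; apply/eqP => h; have := uv ((inner G v v)^-1 * inner G u v).
  by rewrite -scalerA -h scalerA mulVf ?scale1r ?eqxx // gt_eqF.
have := Gp _ nz.
rewrite !(innerDl, innerDr, innerNl, innerNr, innerZl, innerZr) (innerC v u GT) => h.
rewrite -(pmulr_rgt0 _ vv); apply: lt_le_trans h _; rewrite le_eqVlt; apply/orP; left.
by apply/eqP; ring.
Qed.

(* Cauchy-Schwarz against the dual basis vectors. *)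
Lemma posdef_coord G v i : G^T = G -> posdef G ->
  v 0 i ^+ 2 <= invmx G i i * inner G v v.
Proof.
move=> GT Gp; have Gu := posdef_unit Gp.
have vi (w : 'rV[R]_n) : inner G w (row i (invmx G)) = w 0 i.
  rewrite /inner -mulmxA -{1}GT -trmx_mul rowE -mulmxA mulVmx // mulmx1.
  by rewrite trmx_delta -colE mxE.
have := gram_det_ge0 v (row i (invmx G)) GT Gp.
by rewrite !vi subr_ge0 mulrC mxE.
Qed.

Lemma is_derive_inner (V W : R -> 'rV[R]_n) (A : R -> 'M[R]_n) (V' W' : 'rV[R]_n) (A' : 'M[R]_n) (t : R) :
  is_derive t 1 V V' -> is_derive t 1 W W' -> is_derive t 1 A A' ->
  is_derive t 1 (fun s => inner (A s) (V s) (W s))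
    (inner A' (V t) (W t) + inner (A t) V' (W t) + inner (A t) (V t) W').
Proof.
move=> dV dW dA.
have -> : (fun s => inner (A s) (V s) (W s)) =
    (fun s => \sum_a \sum_b V s 0 a * A s a b * W s 0 b).
  by apply/funext => s; rewrite innerE.
rewrite !innerE -!big_split /=; apply: is_derive_sumf => a.
rewrite -!big_split /=; apply: is_derive_sumf => b.
have h := is_derive_mulf (is_derive_mulf (is_derive_coord 0 a dV) (is_derive_coord a b dA))
  (is_derive_coord 0 b dW).
by apply: (is_derive_eq h); ring.
Qed.

End Inner.

Lemma diff_sum_partial (R : realType) n (W : normedModType R) (F : 'rV[R]_n -> W) x v :
  differentiable F x -> 'd F x v = \sum_i v 0 i *: partial i F x.
Proof.
move=> dF; rewrite {1}(matrix_sum_delta v) big_ord1 linear_sum.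
by apply: eq_bigr => i _; rewrite linearZ /= /partial deriveE.
Qed.

(** * Christoffel symbols, curvature and covariant derivatives *)

Section Coordinates.
Variables (R : realType) (n : nat) (U : set 'rV[R]_n) (G : 'rV[R]_n -> 'M[R]_n).
Hypothesis U_open : open U.
Hypothesis G_smooth : smooth_on U G.
Hypothesis G_sym : forall x, U x -> (G x)^T = G x.
Hypothesis G_pos : forall x, U x -> posdef (G x).
Local Notation Gam := (christoffel G).

(* chr x u v and dchr x h u v are the bilinear form Gamma_x(u, v) and its
   derivative in x along h. *)
Definition chr x (u v : 'rV[R]_n) : 'rV[R]_n :=
  \sum_a \sum_b (u 0 a * v 0 b) *: Gam a b x.

Definition dchr x (h u v : 'rV[R]_n) : 'rV[R]_n :=
  \sum_a \sum_b (u 0 a * v 0 b) *: \sum_i h 0 i *: partial i (Gam a b) x.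

Definition dgram x (h : 'rV[R]_n) : 'M[R]_n := \sum_i h 0 i *: partial i G x.

Lemma gram_diff x : U x -> differentiable G x.
Proof. by move=> Ux; have [dG _] := G_smooth 1; exact: dG. Qed.

Lemma partial_gramE x a i j : U x -> partial a G x i j = partial a (fun y => G y i j) x.
Proof.
move=> Ux; rewrite /partial derive_mx ?mxE //.
exact/diff_derivable/gram_diff.
Qed.

Lemma partial_gram_sym x a i j : U x -> partial a G x i j = partial a G x j i.
Proof.
move=> Ux; rewrite !partial_gramE //; apply: (partial_ext U_open) => // y Uy.
by rewrite -[in LHS](G_sym Uy) mxE.
Qed.

Lemma chr_smooth a b r : Ck r U (Gam a b).
Proof.
apply: (Ck_mx U_open) => i c; rewrite ord1.
apply: (@Ck_ext _ _ _ U_open _ _ (fun x => 2^-1 * \sum_(d < n) invmx (G x) c d *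
    (partial a G x b d + partial b G x a d + -1 * partial d G x a b))).
  by move=> x _; rewrite mxE; congr (_ * _); apply: eq_bigr => d _; rewrite mulN1r.
apply: (Ck_mul U_open); first exact: Ck_cst.
apply: (Ck_sum U_open) => d.
have pG k i' j' : Ck r U (fun x => partial k G x i' j').
  by apply: (Ck_coord U_open); have [_] := G_smooth r.+1; apply.
apply: (Ck_mul U_open).
  apply: (Ck_invmx U_open); first by move=> x /G_pos; exact: posdef_unit.
  by move=> k l; apply: (Ck_coord U_open); exact: G_smooth.
apply: (Ck_add U_open); first by apply: (Ck_add U_open).
by apply: (Ck_mul U_open) => //; exact: Ck_cst.
Qed.

Lemma chr_diff a b x : U x -> differentiable (Gam a b) x.
Proof. by move=> Ux; have [dG _] := chr_smooth a b 1; exact: dG. Qed.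

Lemma chr_symG a b x : U x -> Gam a b x = Gam b a x.
Proof.
move=> Ux; apply/rowP => c; rewrite !mxE; congr (_ * _); apply: eq_bigr => d _.
move: (partial_gram_sym d a b Ux).
by move: (partial a G x) (partial b G x) (partial d G x) => P Q S ->; rewrite (addrC (P b d)).
Qed.

(** Lowering the index cancels the inverse Gram matrix and leaves the Christoffel symbols of the
    first kind, which are linear in the derivatives of G. *)
Lemma chr_lower a b e x : U x -> inner (G x) (Gam a b x) (delta_mx 0 e) =
  2^-1 * (partial a G x b e + partial b G x a e - partial e G x a b).
Proof.
move=> Ux; rewrite /inner trmx_delta -colE mxE.
set S := fun d => partial a G x b d + partial b G x a d - partial d G x a b.
have -> : (Gam a b x *m G x) 0 e = 2^-1 * \sum_d S d * (invmx (G x) *m G x) d e.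
  rewrite mxE; transitivity (2^-1 * \sum_c \sum_d S d * (invmx (G x) d c * G x c e)).
    rewrite mulr_sumr; apply: eq_bigr => c _; rewrite mxE -mulrA; congr (_ * _).
    rewrite mulr_suml; apply: eq_bigr => d _.
    have -> : invmx (G x) c d = invmx (G x) d c.
      by rewrite -{1}(G_sym Ux) -trmx_inv mxE.
    by rewrite /S; ring.
  congr (_ * _); rewrite exchange_big /=; apply: eq_bigr => d _.
  by rewrite -mulr_sumr; congr (_ * _); rewrite mxE.
congr (_ * _); rewrite mulVmx ?posdef_unit //; last exact: G_pos.
rewrite (bigD1 e) //= big1 => [|d de]; first by rewrite !mxE eqxx mulr1 addr0.
by rewrite !mxE (negbTE de) mulr0.
Qed.

Lemma chrDl x u u' v : chr x (u + u') v = chr x u v + chr x u' v.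
Proof.
rewrite /chr -big_split; apply: eq_bigr => a _; rewrite -big_split.
by apply: eq_bigr => b _; rewrite mxE mulrDl scalerDl.
Qed.

Lemma chrDr x u v v' : chr x u (v + v') = chr x u v + chr x u v'.
Proof.
rewrite /chr -big_split; apply: eq_bigr => a _; rewrite -big_split.
by apply: eq_bigr => b _; rewrite mxE mulrDr scalerDl.
Qed.

Lemma chrZl x k u v : chr x (k *: u) v = k *: chr x u v.
Proof.
rewrite /chr scaler_sumr; apply: eq_bigr => a _; rewrite scaler_sumr.
by apply: eq_bigr => b _; rewrite mxE scalerA mulrA.
Qed.

Lemma chrZr x k u v : chr x u (k *: v) = k *: chr x u v.
Proof.
rewrite /chr scaler_sumr; apply: eq_bigr => a _; rewrite scaler_sumr.
by apply: eq_bigr => b _; rewrite mxE scalerA mulrCA.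
Qed.

Lemma chrNl x u v : chr x (- u) v = - chr x u v.
Proof. by rewrite -scaleN1r chrZl scaleN1r. Qed.

Lemma chrC x u v : U x -> chr x u v = chr x v u.
Proof.
move=> Ux; rewrite /chr exchange_big /=; apply: eq_bigr => a _; apply: eq_bigr => b _.
by rewrite chr_symG // mulrC.
Qed.

Lemma partial_chr_sym x i a b : U x -> partial i (Gam a b) x = partial i (Gam b a) x.
Proof. by move=> Ux; apply: (partial_ext U_open) => // y Uy; exact: chr_symG. Qed.

Lemma dchrC x h u v : U x -> dchr x h u v = dchr x h v u.
Proof.
move=> Ux; rewrite /dchr exchange_big /=; apply: eq_bigr => a _; apply: eq_bigr => b _.
apply: (f_equal2 (fun (p : R) (q : 'rV[R]_n) => p *: q) (mulrC _ _)).
apply: eq_bigr => i _; apply: (f_equal (fun q : 'rV[R]_n => h 0 i *: q)).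
exact: partial_chr_sym.
Qed.

Lemma dchrZl x k h u v : dchr x (k *: h) u v = k *: dchr x h u v.
Proof.
rewrite /dchr scaler_sumr; apply: eq_bigr => a _; rewrite scaler_sumr.
apply: eq_bigr => b _; rewrite [RHS]scalerA (mulrC k) -[RHS]scalerA.
apply: (f_equal (fun q : 'rV[R]_n => (u 0 a * v 0 b) *: q)).
by rewrite scaler_sumr; apply: eq_bigr => i _; rewrite mxE scalerA.
Qed.

Lemma dchrZm x k h u v : dchr x h (k *: u) v = k *: dchr x h u v.
Proof.
rewrite /dchr scaler_sumr; apply: eq_bigr => a _; rewrite scaler_sumr.
by apply: eq_bigr => b _; rewrite mxE scalerA mulrA.
Qed.

Lemma chr_sumr x u I (r : seq I) (F : I -> 'rV[R]_n) :
  chr x u (\sum_(i <- r) F i) = \sum_(i <- r) chr x u (F i).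
Proof.
elim/big_rec2: _ => [|i y z _ <-]; last by rewrite chrDr.
by have := chrZr x 0 u 0; rewrite !scale0r.
Qed.

(** With the curvature expressed by the bilinear maps, its antisymmetry and the Jacobi equation
    follow from bilinearity instead of index sums. *)
Lemma curvatureE x u v w : curvature G x u v w =
  dchr x u v w - dchr x v u w + chr x u (chr x v w) - chr x v (chr x u w).
Proof.
have e1 p q r : dchr x p q r = \sum_a \sum_b \sum_c (p 0 a * q 0 b * r 0 c) *:
    partial a (Gam b c) x.
  rewrite /dchr exchange_big [RHS]exchange_big /= exchange_big /=; apply: eq_bigr => b _.
  rewrite [RHS]exchange_big /=; apply: eq_bigr => c _; rewrite scaler_sumr.
  by apply: eq_bigr => a _; rewrite scalerA; congr (_ *: _); ring.
(* The same sum with the outer indices exchanged, to match the terms in which u and v are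
   swapped. *)
have e2 p q r : dchr x p q r = \sum_b \sum_a \sum_c (p 0 a * q 0 b * r 0 c) *:
    partial a (Gam b c) x by rewrite e1; exact: exchange_big.
have e3 p q r : chr x p (chr x q r) = \sum_a \sum_b \sum_c (p 0 a * q 0 b * r 0 c) *:
    \sum_e Gam b c x 0 e *: Gam a e x.
  rewrite {2}/chr chr_sumr [RHS]exchange_big /=; apply: eq_bigr => b _.
  rewrite chr_sumr [RHS]exchange_big /=; apply: eq_bigr => c _.
  rewrite chrZr /chr scaler_sumr; apply: eq_bigr => a _.
  rewrite !scaler_sumr; apply: eq_bigr => e _.
  by rewrite !scalerA; congr (_ *: _); ring.
have e4 p q r : chr x p (chr x q r) = \sum_b \sum_a \sum_c (p 0 a * q 0 b * r 0 c) *: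
    \sum_e Gam b c x 0 e *: Gam a e x by rewrite e3; exact: exchange_big.
rewrite (e1 u) (e2 v) (e3 u) (e4 v) -!sumrN -!big_split; apply: eq_bigr => a _ /=.
rewrite -!sumrN -!big_split; apply: eq_bigr => b _ /=.
rewrite -!sumrN -!big_split; apply: eq_bigr => c _ /=.
by rewrite (mulrC (v 0 b)) sumrB !scalerDr !scalerN !addrA.
Qed.

(** On basis vectors, the sum of the first-kind symbols Gamma_ab,e and Gamma_ae,b is the derivative
    of G_be in direction a; the rest is trilinearity. *)
Lemma metric_compat x h u v : U x ->
  inner (dgram x h) u v = inner (G x) (chr x h u) v + inner (G x) u (chr x h v).
Proof.
move=> Ux.
have base a b e : partial a G x b e =
    inner (G x) (Gam a b x) (delta_mx 0 e) + inner (G x) (delta_mx 0 b) (Gam a e x).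
  rewrite (innerC (delta_mx 0 b)) ?G_sym // !chr_lower //.
  have := partial_gram_sym a e b Ux.
  by move: (partial a G x) (partial b G x) (partial e G x) => P Q S ->; field.
have -> : inner (dgram x h) u v = \sum_a \sum_b \sum_e h 0 a * u 0 b * v 0 e * partial a G x b e.
  rewrite innerE exchange_big exchange_big [RHS]exchange_big; apply: eq_bigr => b _ /=.
  rewrite [RHS]exchange_big; apply: eq_bigr => e _ /=.
  rewrite /dgram summxE mulr_sumr mulr_suml; apply: eq_bigr => a _.
  by rewrite mxE; ring.
have -> : inner (G x) (chr x h u) v = \sum_a \sum_b \sum_e h 0 a * u 0 b * v 0 e *
    inner (G x) (Gam a b x) (delta_mx 0 e).
  rewrite /chr inner_suml; apply: eq_bigr => a _; rewrite inner_suml; apply: eq_bigr => b _.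
  rewrite innerZl {1}(row_sum_delta v) inner_sumr mulr_sumr; apply: eq_bigr => e _.
  by rewrite innerZr mulrA.
have -> : inner (G x) u (chr x h v) = \sum_a \sum_b \sum_e h 0 a * u 0 b * v 0 e *
    inner (G x) (delta_mx 0 b) (Gam a e x).
  rewrite /chr inner_sumr; apply: eq_bigr => a _; rewrite inner_sumr [RHS]exchange_big.
  apply: eq_bigr => e _ /=.
  rewrite innerZr {1}(row_sum_delta u) inner_suml mulr_sumr; apply: eq_bigr => b _.
  by rewrite innerZl; ring.
rewrite -big_split; apply: eq_bigr => a _; rewrite -big_split; apply: eq_bigr => b _.
rewrite -big_split; apply: eq_bigr => e _ /=.
by rewrite base mulrDr.
Qed.

Lemma is_derive_chr (c u v : R -> 'rV[R]_n) (c' u' v' : 'rV[R]_n) (t : R) : U (c t) ->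
  is_derive t 1 c c' -> is_derive t 1 u u' -> is_derive t 1 v v' ->
  is_derive t 1 (fun s => chr (c s) (u s) (v s))
    (dchr (c t) c' (u t) (v t) + chr (c t) u' (v t) + chr (c t) (u t) v').
Proof.
move=> Uc dc du dv; apply: is_derive_mx => i j; rewrite ord1.
have -> : (fun s => chr (c s) (u s) (v s) 0 j) =
    (fun s => \sum_a \sum_b (u s 0 a * v s 0 b) * Gam a b (c s) 0 j).
  apply/funext => s; rewrite /chr summxE; apply: eq_bigr => a _.
  by rewrite summxE; apply: eq_bigr => b _; rewrite mxE.
rewrite !mxE !summxE -!big_split; apply: is_derive_sumf => a.
rewrite !summxE -!big_split; apply: is_derive_sumf => b /=.
have dG := is_derive_chain (chr_diff a b Uc) dc.
rewrite diff_sum_partial in dG; last exact: chr_diff.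
have h := is_derive_mulf (is_derive_mulf (is_derive_coord 0 a du) (is_derive_coord 0 b dv))
  (is_derive_coord 0 j dG).
apply: (is_derive_eq h).
have Zj (k : R) (w : 'rV[R]_n) : (k *: w) 0 j = k * w 0 j by rewrite mxE.
by rewrite !Zj; ring.
Qed.

Lemma is_derive_gram (c : R -> 'rV[R]_n) (c' : 'rV[R]_n) (t : R) : U (c t) ->
  is_derive t 1 c c' -> is_derive t 1 (fun s => G (c s)) (dgram (c t) c').
Proof.
move=> Uc dc; have := is_derive_chain (gram_diff Uc) dc.
by rewrite diff_sum_partial //; exact: gram_diff.
Qed.

(** [u' + chr (c t) c' (u t)] is the covariant derivative of u along c; metric compatibility absorbs
    the derivative of G into the two such terms. *)
Lemma is_derive_inner_cov (c u v : R -> 'rV[R]_n) (c' u' v' : 'rV[R]_n) (t : R) : U (c t) ->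
  is_derive t 1 c c' -> is_derive t 1 u u' -> is_derive t 1 v v' ->
  is_derive t 1 (fun s => inner (G (c s)) (u s) (v s))
    (inner (G (c t)) (u' + chr (c t) c' (u t)) (v t) +
     inner (G (c t)) (u t) (v' + chr (c t) c' (v t))).
Proof.
move=> Uc dc du dv.
apply: (is_derive_eq (is_derive_inner du dv (is_derive_gram Uc dc))).
by rewrite metric_compat // innerDl innerDr; ring.
Qed.

(* The left-hand side is DDJ with K = J', along a geodesic with velocity y: its
   first line is K', given by the linearised geodesic equation. *)
Lemma jacobi_cov (x y J K : 'rV[R]_n) : U x ->
  - (dchr x J y y + 2 *: chr x y K) +
  (dchr x y y J + chr x (- chr x y y) J + chr x y K) + chr x y (K + chr x y J) =
  - curvature G x J y y.
Proof.
move=> Ux; rewrite curvatureE (dchrC y J y Ux) (chrC J y Ux) (chrC J (chr x y y) Ux).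
rewrite chrNl chrDr.
by apply/rowP => i; rewrite !mxE; ring.
Qed.

(** The sectional curvature is a quotient, controlled for independent vectors, where its denominator
    is a positive Gram determinant. For proportional vectors the curvature term vanishes by
    antisymmetry, so the numerator has a sign everywhere. *)
Lemma curvature_le0 :
  (forall x u v, U x -> row_free (col_mx u v) -> sectional_curvature G x u v <= 0) ->
  forall x u v, U x -> inner (G x) (curvature G x u v v) u <= 0.
Proof.
move=> sec x u v Ux.
have curv0 k : curvature G x (k *: v) v v = 0.
  by rewrite curvatureE dchrZl dchrZm !chrZl chrZr subrr add0r subrr.
have [->|v0] := eqVneq v 0.
  have z1 w : chr x w 0 = 0 by have := chrZr x 0 w 0; rewrite !scale0r.
  have z3 w : dchr x u 0 w = 0 by have := dchrZm x 0 u 0 w; rewrite !scale0r.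
  have z4 p w : dchr x 0 p w = 0 by have := dchrZl x 0 0 p w; rewrite !scale0r.
  by rewrite curvatureE !z1 z3 z4 !subr0 !addr0 inner0l.
have [[k ->]|uv] := pselect (exists k, u = k *: v); first by rewrite curv0 inner0l.
have uv' k : u != k *: v by apply/eqP => h; apply: uv; exists k.
have D0 := gram_det_gt0 (G_sym Ux) (G_pos Ux) v0 uv'.
have := sec x u v Ux; rewrite /sectional_curvature pmulr_lle0 ?invr_gt0 //; apply.
apply/row_freeP.
suff : row_free (col_mx u v) by move/row_freeP.
rewrite -kermx_eq0; apply/eqP/row_matrixP => i; rewrite row0.
have := mulmx_ker (col_mx u v) => /(congr1 (row i)); rewrite row_mul row0.
move: (row i _) => w; rewrite -[w]hsubmxK mul_row_col => h.
rewrite [lsubmx w]mx11_scalar [rsubmx w]mx11_scalar !mul_scalar_mx in h *.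
set a := lsubmx w 0 0 in h *; set b := rsubmx w 0 0 in h *.
have a0 : a = 0.
  apply/eqP/negPn/negP => a0; have := uv' (- (a^-1 * b)).
  rewrite -subr_eq0 scaleNr opprK -scalerA -{1}(scale1r u) -{1}(mulVf a0) -scalerA.
  by rewrite -scalerDr h scaler0 eqxx.
move: h; rewrite a0 scale0r add0r => /eqP; rewrite scaler_eq0 (negbTE v0) orbF => /eqP ->.
by rewrite -[RHS]hsubmxK; congr row_mx; apply/matrixP => p q; rewrite !mxE mul0rn.
Qed.

End Coordinates.

(** * Positive forms, differentiation of inverse maps along curves, and maxima *)

Section PositiveForms.
Variable R : realType.

(** Summing [posdef_coord] over the coordinates gives the trace of the inverse matrix as constant;
    the added 1 keeps it positive even in dimension 0. *)
Lemma posdef_lower_bound n (G : 'M[R]_n) : G^T = G -> posdef G ->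
  exists2 C : R, 0 < C & forall w : 'rV[R]_n, `|w| ^+ 2 <= C * inner G w w.
Proof.
move=> GT Gp; exists (`|\sum_i invmx G i i| + 1) => [|w]; first by rewrite ltr_wpDl.
apply: (le_trans (sum_sqr_bounds w).1).
apply: (@le_trans _ _ ((\sum_i invmx G i i) * inner G w w)).
  by rewrite mulr_suml; apply: ler_sum => i _; exact: posdef_coord.
by rewrite ler_wpM2r ?posdef_ge0 // ler_wpDr // ler_norm.
Qed.

Lemma inner_le_norm n (G : 'M[R]_n) (u : 'rV[R]_n) :
  inner G u u <= n%:R ^+ 2 * `|G| * `|u| ^+ 2.
Proof.
apply: (le_trans (ler_norm _)); rewrite /inner; apply: (le_trans (norm_coord _ 0 0)).
apply: (le_trans (norm_mulmx _ _)).
have uT : `|u^T| <= `|u| by apply: norm_le_coord => // i j; rewrite mxE norm_coord.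
have h1 := norm_mulmx u G.
apply: (le_trans (ler_wpM2l _ uT)); first by rewrite mulr_ge0.
apply: (@le_trans _ _ (n%:R * (n%:R * `|u| * `|G|) * `|u|)).
  by rewrite ler_wpM2r // ler_wpM2l.
by rewrite le_eqVlt; apply/orP; left; apply/eqP; ring.
Qed.

Lemma continuous_inner n (G : 'M[R]_n) : continuous (fun u : 'rV[R]_n => inner G u u).
Proof.
move=> u; suff : Ck 0 setT (fun u : 'rV[R]_n => inner G u u) by exact.
have oT : open (@setT 'rV[R]_n) by exact: openT.
have cX i : Ck 0 setT (fun u : 'rV[R]_n => u 0 i) by apply: Ck_coord => //; exact: Ck_id.
apply: (@Ck_ext _ _ _ oT _ 0 (fun u => \sum_a \sum_b u 0 a * G a b * u 0 b)).
  by move=> y _; rewrite innerE.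
apply: Ck_sum => // a; apply: Ck_sum => // b; apply: Ck_mul => //.
by apply: Ck_mul => //; exact: Ck_cst.
Qed.

(** The inverse is differentiated along one continuous curve of preimages, without an inverse map on
    a neighbourhood: [inverse_function] bounds the increment of v by that of F v, and strict
    differentiability does the rest. *)
Lemma is_derive_inverse n (F : 'rV[R]_n -> 'rV[R]_n) (D : 'M[R]_n) (C : R)
    (v : R -> 'rV[R]_n) (y' : 'rV[R]_n) (t : R) : 0 < C ->
  sdiff F (v t) D -> (forall w : 'rV[R]_n, `|w| <= C * `|w *m D|) ->
  {for t, continuous v} -> is_derive t 1 (F \o v) y' ->
  is_derive t 1 v (y' *m invmx D).
Proof.
move=> C0 sF HD cv dy; have uD := expanding_unitmx HD.
have [r1 r10 [inj _]] := inverse_function C0 sF HD.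
apply: is_derive_eps => e e0.
pose K := 2 * C * (`|y'| + 1).
have K0 : 0 < K by rewrite !mulr_gt0 // ltr_wpDl.
have e1 : 0 < e / 2 / C / K by rewrite !divr_gt0.
have e2 : 0 < e / 2 / C by rewrite !divr_gt0.
have [r2 r20 Hr2] := sF _ e1.
have [d1 d10 Hd1] := is_derive_epsE dy e2.
have [d2 d20 Hd2] := is_derive_epsE dy (@ltr01 R).
have r120 : 0 < Num.min r1 r2 / 2 by rewrite divr_gt0 // lt_min r10.
have [d3 d30 Hd3] := (continuous_epsP v t).1 cv _ r120.
exists (Num.min (Num.min d1 d2) d3); first by rewrite !lt_min d10 d20.
move=> h; rewrite !lt_min => /andP[/andP[h1 h2] h3].
have := Hd3 (t + h); rewrite addrAC subrr add0r => /(_ h3) => vr.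
have vr' : `|v (t + h) - v t| < Num.min r1 r2.
  by apply: (le_lt_trans vr); rewrite ltr_pdivrMr // ltr_pMr ?ltr1n // lt_min r10.
move: vr'; rewrite lt_min => /andP[v1 v2].
have z1 : `|v t - v t| < r1 by rewrite subrr normr0.
have z2 : `|v t - v t| < r2 by rewrite subrr normr0.
have I := inj _ _ v1 z1.
have S := Hr2 _ _ v2 z2.
have Y1 := Hd1 h h1; have Y2 := Hd2 h h2; rewrite /= mul1r in Y1 Y2.
set dv := v (t + h) - v t in I S *; set dF := F (v (t + h)) - F (v t) in I S Y1 Y2.
have dF_le : `|dF| <= (`|y'| + 1) * `|h|.
  have -> : dF = (dF - h *: y') + h *: y' by rewrite subrK.
  apply: (le_trans (ler_normD _ _)); rewrite normrZ mulrDl mul1r mulrC addrC.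
  by rewrite lerD2l.
have dv_le : `|dv| <= K * `|h|.
  apply: (le_trans I); rewrite /K -(mulrA (2 * C)); apply: ler_wpM2l => //.
  by rewrite mulr_ge0 // ltW.
have -> : dv - h *: (y' *m invmx D) = (dv *m D - h *: y') *m invmx D.
  by rewrite mulmxBl mulmxK // scalemxAl.
apply: (le_trans (HD _)); rewrite mulmxKV //.
have -> : dv *m D - h *: y' = (dF - h *: y') - (dF - dv *m D).
  by rewrite opprB [RHS]addrC addrA subrK.
have S' : `|dF - dv *m D| <= e / 2 / C * `|h|.
  apply: (le_trans S); apply: (le_trans (ler_wpM2l (ltW e1) dv_le)).
  by rewrite mulrA divfK // gt_eqF.
have T := le_trans (ler_normB _ _) (lerD Y1 S').
apply: (le_trans (ler_wpM2l (ltW C0) T)).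
have -> // : C * (e / 2 / C * `|h| + e / 2 / C * `|h|) = e * `|h|.
by field; rewrite gt_eqF.
Qed.

(** k' is differentiated at 0 only: were k'' positive, k' would be positive just after 0, and the
    mean value theorem would give k s > k 0. *)
Lemma second_derivative_test (k k' : R -> R) (k'' d : R) : 0 < d ->
  (forall s : R, `|s| < d -> is_derive s 1 k (k' s)) -> is_derive (0 : R) 1 k' k'' ->
  (forall s : R, `|s| < d -> k s <= k 0) -> k' 0 = 0 /\ k'' <= 0.
Proof.
move=> d0 dk dk' kmax.
have in_d (s : R) : s \in `](- d), d[ -> `|s| < d by rewrite in_itv /= ltr_norml.
have k'0 : k' 0 = 0.
  have z : (0 : R) \in `](- d), d[ by rewrite in_itv /= oppr_lt0 d0.
  have nd : - d < d by rewrite gtrN.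
  have D0 : is_derive (0 : R) 1 k 0.
    apply: (derive1_at_max (ltW nd) _ z) => s /in_d sd; last exact: kmax.
    by have := dk s sd; case.
  have z0 : `|0 : R| < d by rewrite normr0.
  exact: is_derive_unique (dk 0 z0) D0.
split=> //; rewrite leNgt; apply/negP => k2.
have k22 : 0 < k'' / 2 by rewrite divr_gt0.
have [r r0 Hr] := is_derive_epsE dk' k22.
pose s := Num.min d r / 2.
have s0 : 0 < s by rewrite divr_gt0 // lt_min d0.
have : s < Num.min d r by rewrite ltr_pdivrMr ?ltr_pMr ?ltr1n // lt_min d0.
rewrite lt_min => /andP[sd sr].
have in_s u : 0 <= u <= s -> `|u| < d.
  by move=> /andP[u0 us]; rewrite ger0_norm // (le_lt_trans us).
have pos u : 0 < u < s -> 0 < k' u.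
  move=> /andP[u0 us]; have ur : `|u| < r by rewrite gtr0_norm // (lt_trans us).
  have := Hr u ur; rewrite add0r k'0 subr0 (gtr0_norm u0) ler_norml => /andP[h _].
  have : 0 < k'' * u by rewrite mulr_gt0.
  by move: h; rewrite /GRing.scale /=; clear; lra.
have [c cs Hc] := @MVT R k k' 0 s s0
  (fun u us => dk u (in_s u (ltac:(by move: us; rewrite in_itv /= => /andP[/ltW -> /ltW ->]))))
  (ltac:(by apply: derivable_within_continuous => u us;
     have := dk u (in_s u (ltac:(by move: us; rewrite in_itv)));case)).
have c0 : 0 < k' c by apply: pos; move: cs; rewrite in_itv.
have := kmax s (in_s s (ltac:(by rewrite (ltW s0) lexx))).
by rewrite -subr_le0 Hc subr0 leNgt mulr_gt0.
Qed.

Lemma inner_block n (a x : R) (b v : 'rV[R]_n) (D : 'M[R]_n) :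
  inner (block_mx a%:M b b^T D) (row_mx x%:M v) (row_mx x%:M v) =
  a * x ^+ 2 + 2 * (x * (b *m v^T) 0 0) + inner D v v.
Proof.
rewrite /inner tr_row_mx mul_row_block mul_row_col tr_scalar_mx !mul_mx_scalar !mul_scalar_mx.
have -> : v *m b^T = (b *m v^T)^T by rewrite trmx_mul trmxK.
rewrite mulmxDl -scalemxAl; move: (b *m v^T) (v *m D *m v^T) => p q.
by rewrite !mxE eqxx mulr1n; ring.
Qed.

(** Cholesky factorisation: split off the first row and column, and factor the Schur complement S by
    induction. *)
Lemma gram_factor n (H : 'M[R]_n) : H^T = H -> posdef H -> exists P : 'M[R]_n, H = P^T *m P.
Proof.
elim: n H => [|n IH] H HT Hp; first by exists 0; apply/matrixP => - [].
pose a := @ulsubmx R 1 n 1 n H 0 0; pose b := @ursubmx R 1 n 1 n H.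
pose D := @drsubmx R 1 n 1 n H.
have HE : H = block_mx a%:M b b^T D :> 'M[R]_(1 + n).
  rewrite -[LHS](@submxK R 1 n 1 n) /b; congr block_mx; first exact: mx11_scalar.
  by rewrite trmx_ursub; congr dlsubmx; exact: esym.
have DT : D^T = D by rewrite trmx_drsub; congr drsubmx.
have Hp' x (v : 'rV[R]_n) : (x != 0) || (v != 0) ->
    0 < a * x ^+ 2 + 2 * (x * (b *m v^T) 0 0) + inner D v v.
  move=> xv; rewrite -inner_block -HE; apply: Hp; apply: contraTneq xv => xv0.
  have x0 : x%:M = 0 :> 'M[R]_1 by rewrite -(@row_mxKl R 1 1 n x%:M v) xv0 linear0.
  have -> : v = 0 by rewrite -(@row_mxKr R 1 1 n x%:M v) xv0 linear0.
  have -> : x = 0 by have := congr1 (fun A : 'M[R]_1 => A 0 0) x0; rewrite !mxE eqxx mulr1n.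
  by rewrite !eqxx.
have a0 : 0 < a.
  have := Hp' 1 0; rewrite oner_eq0 trmx0 mulmx0 mxE inner0l => /(_ isT).
  by rewrite expr1n !mulr0 !addr0 mulr1.
pose S := D - a^-1 *: (b^T *m b).
have innS (v : 'rV[R]_n) : inner S v v = inner D v v - a^-1 * ((b *m v^T) 0 0) ^+ 2.
  rewrite /inner mulmxBr mulmxBl -scalemxAr -scalemxAl mulmxA -(mulmxA _ b).
  have -> : v *m b^T = (b *m v^T)^T by rewrite trmx_mul trmxK.
  move: (b *m v^T) (v *m D *m v^T) => p q.
  by rewrite !mxE big_ord1 !mxE expr2.
have ST : S^T = S by rewrite /S linearB /= linearZ /= trmx_mul trmxK DT.
have Sp : posdef S.
  move=> v v0; rewrite innS.
  (* This first coordinate minimises the form for fixed v, and the minimum is the value of the Schur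
     complement at v. *)
  have := Hp' (- (a^-1 * (b *m v^T) 0 0)) v; rewrite v0 orbT => /(_ isT).
  set c := (b *m v^T) 0 0; set d := inner D v v; move: c d => c d.
  have -> // : a * (- (a^-1 * c)) ^+ 2 + 2 * (- (a^-1 * c) * c) + d = d - a^-1 * c ^+ 2.
  by field; rewrite gt_eqF.
have [Q SQ] := IH S ST Sp.
pose P := block_mx (Num.sqrt a)%:M ((Num.sqrt a)^-1 *: b) 0 Q.
have sa : 0 < Num.sqrt a by rewrite sqrtr_gt0.
suff PE : block_mx a%:M b b^T D = P^T *m P by exists P; rewrite HE PE.
rewrite /P tr_block_mx mulmx_block tr_scalar_mx trmx0 !mul0mx !mulmx0 !addr0.
have bT : ((Num.sqrt a)^-1 *: b)^T = (Num.sqrt a)^-1 *: b^T by rewrite linearZ.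
have ss : Num.sqrt a * Num.sqrt a = a by rewrite -expr2 sqr_sqrtr // ltW.
have sV : Num.sqrt a * (Num.sqrt a)^-1 = 1 by rewrite mulfV // gt_eqF.
rewrite bT -SQ; congr block_mx.
- by rewrite mul_scalar_mx scale_scalar_mx ss.
- by rewrite mul_scalar_mx scalerA sV scale1r.
- by rewrite mul_mx_scalar scalerA sV scale1r.
by rewrite -scalemxAl -scalemxAr scalerA -invfM ss addrC subrK.
Qed.

End PositiveForms.

(** * Charts and geodesics *)

Section GeodesicField.
Variables (R : realType) (n : nat) (U : set 'rV[R]_n) (G : 'rV[R]_n -> 'M[R]_n).
Hypothesis U_open : open U.
Hypothesis G_smooth : smooth_on U G.
Hypothesis G_sym : forall x, U x -> (G x)^T = G x.
Hypothesis G_pos : forall x, U x -> posdef (G x).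

(* Geodesics are the integral curves of geoX in (position, velocity) space. *)
Definition geoX (z : 'rV[R]_(n + n)) : 'rV[R]_(n + n) :=
  row_mx (rsubmx z) (- chr G (lsubmx z) (rsubmx z) (rsubmx z)).

Local Notation Uz := [set z : 'rV[R]_(n + n) | U (lsubmx z)].

Lemma geoX_smooth r : Ck r Uz geoX.
Proof.
have oU : open Uz by exact: open_lsubmx.
have Cz (k : 'I_(n + n)) : Ck r Uz (fun z => z 0 k).
  by apply: (Ck_coord oU); exact: Ck_id.
apply: (Ck_mx oU) => i j; rewrite ord1.
case: (fintype.split j) (fintype.splitK j) => k /= <-.
  apply: (@Ck_ext _ _ _ oU _ _ (fun z => z 0 (rshift n k))) => // z _.
  by rewrite row_mxEl mxE.
apply: (@Ck_ext _ _ _ oU _ _ (fun z => -1 * \sum_a \sum_b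
   (z 0 (rshift n a) * z 0 (rshift n b)) * christoffel G a b (lsubmx z) 0 k)).
  move=> z _; rewrite row_mxEr mxE mulN1r /chr summxE; congr (- _).
  apply: eq_bigr => a _; rewrite summxE; apply: eq_bigr => b _.
  by rewrite !mxE.
apply: (Ck_mul oU); first exact: Ck_cst.
apply: (Ck_sum oU) => a; apply: (Ck_sum oU) => b; apply: (Ck_mul oU).
  exact: (Ck_mul oU).
apply: (Ck_lsubmx n U_open (f := fun x => christoffel G a b x 0 k)).
by apply: (Ck_coord U_open); exact: chr_smooth.
Qed.

(** Linearised geodesic equation, read off the line z + s h by comparing the chain rule with the
    product rule for [chr]; symmetry of the symbols merges two velocity terms into the factor 2. *)
Lemma geoX_jacobian (z h : 'rV[R]_(n + n)) : U (lsubmx z) ->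
  h *m 'J geoX z = row_mx (rsubmx h)
    (- (dchr G (lsubmx z) (lsubmx h) (rsubmx z) (rsubmx z) +
        2 *: chr G (lsubmx z) (rsubmx z) (rsubmx h))).
Proof.
move=> Uz0; have [dX _] := geoX_smooth 1.
have z0 : z = z + 0 *: h by rewrite scale0r addr0.
have dl := is_derive_line z h 0.
have dX0 : differentiable geoX (z + 0 *: h) by apply: dX; rewrite /= -z0.
have e1 := is_derive_chain dX0 dl; rewrite diffE_jacobian // -z0 in e1.
apply: is_derive_unique e1 _.
apply: is_derive_row_mx; first exact: is_derive_rsubmx dl.
have Ul : U (lsubmx (z + 0 *: h)) by rewrite -z0.
have := is_derive_chr U_open G_smooth G_pos Ul (is_derive_lsubmx dl)
  (is_derive_rsubmx dl) (is_derive_rsubmx dl).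
rewrite -z0 => e2; apply: (is_derive_eq (is_deriveN e2)).
by rewrite (chrC U_open G_smooth G_sym (rsubmx h)) // -addrA -mulr2n -scaler_nat.
Qed.

End GeodesicField.

Section Charts.
Variables (R : realType) (n : nat) (M : manifold R n).
Implicit Types (i j : atlas M).

Lemma cdom_dom j x : cdom j x -> dom j (psi j x) /\ phi j (psi j x) = x.
Proof. by move=> [p jp <-]; rewrite phiK. Qed.

Lemma dom_cdom j p : dom j p -> cdom j (phi j p).
Proof. by move=> jp; exists p. Qed.

Lemma cdomO j : open (cdom j). Proof. exact: cdom_open. Qed.

Lemma psi_cont j x : cdom j x -> {for x, continuous (psi j)}.
Proof.
move=> jx; have := @psi_continuous R n M j.
by rewrite continuous_open_subspace; [apply; rewrite inE|exact: cdomO].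
Qed.

Lemma phi_cont j p : dom j p -> {for p, continuous (phi j)}.
Proof.
move=> jp; have := @phi_continuous R n M j.
by rewrite continuous_open_subspace; [apply; rewrite inE|exact: dom_open].
Qed.

Definition overlap i j := [set x | cdom i x /\ dom j (psi i x)].

Lemma overlap_open i j : open (overlap i j).
Proof.
have -> : overlap i j = cdom i `&` psi i @^-1` dom j by [].
rewrite openE => x [ix jx]; rewrite /interior; apply: filterI.
  by apply: open_nbhs_nbhs; split=> //; exact: cdomO.
by apply: (psi_cont ix); apply: open_nbhs_nbhs; split=> //; exact: dom_open.
Qed.

End Charts.

(** * Geodesics in phase space and changes of chart *)

Section Phase.
Variables (R : realType) (n : nat) (M : manifold R n) (g : riemannian_metric M).
Implicit Types (i j : atlas M) (gam : R -> M).
Local Notation VF j := (geoX (gram g j)).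

Lemma gramS j : smooth_on (cdom j) (gram g j). Proof. exact: gram_smooth. Qed.
Lemma gramT j x : cdom j x -> (gram g j x)^T = gram g j x. Proof. exact: gram_sym. Qed.
Lemma gramP j x : cdom j x -> posdef (gram g j x). Proof. by move=> jx v; exact: gram_pos. Qed.

Definition phase j gam (t : R) : 'rV[R]_(n + n) :=
  row_mx (phi j (gam t)) (derive1 (phi j \o gam) t).

Lemma is_derive_phase j gam t : geodesic g gam -> dom j (gam t) ->
  is_derive t 1 (phase j gam) (VF j (phase j gam t)).
Proof.
move=> [_ geo] jt; have [d1 d2 eq2] := geo j t jt.
rewrite /geoX /phase row_mxKl row_mxKr; apply: is_derive_row_mx.
  by split; [exact: d1|rewrite -derive1E].
split; first exact: d2.
by rewrite -derive1E; apply/eqP; rewrite -addr_eq0; apply/eqP.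
Qed.

Lemma is_derive_pos j gam t : geodesic g gam -> dom j (gam t) ->
  is_derive t 1 (fun s => phi j (gam s)) (derive1 (phi j \o gam) t).
Proof.
move=> [_ geo] jt; have [d1 d2 eq2] := geo j t jt.
by split; [exact: d1|rewrite -derive1E].
Qed.

Lemma dom_near j gam t : continuous gam -> dom j (gam t) ->
  exists2 e : R, 0 < e & forall s, `|s - t| < e -> dom j (gam s).
Proof.
move=> cg jt; have : nbhs t (gam @^-1` dom j).
  by apply: cg; apply: open_nbhs_nbhs; split=> //; exact: dom_open.
by move=> /near_eps[e e0 He]; exists e.
Qed.

Lemma norm_row_mx_le p q (u : 'rV[R]_p) (v : 'rV[R]_q) (e : R) :
  `|u| <= e -> `|v| <= e -> `|row_mx u v| <= e.
Proof.
move=> ue ve; apply: norm_le_coord => [|i k]; first exact: le_trans ue.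
case: (fintype.split k) (fintype.splitK k) => l /= <-.
  by rewrite row_mxEl (le_trans (norm_coord _ _ _)).
by rewrite row_mxEr (le_trans (norm_coord _ _ _)).
Qed.

Lemma norm_lsubmx_le p q (u : 'rV[R]_(p + q)) : `|lsubmx u| <= `|u|.
Proof. by apply: norm_le_coord => // i k; rewrite mxE norm_coord. Qed.

(* By compactness of a coordinate ball, a geodesic cannot leave a chart before
   its coordinates have travelled: a priori, only its continuity in M is known. *)
Lemma geodesic_confined j z0 (r L : R) : 0 < r -> 0 < L ->
  (forall z, `|z - z0| <= r -> cdom j (lsubmx z)) ->
  (forall z, `|z - z0| <= r -> `|VF j z| <= L) ->
  forall gam a, geodesic g gam -> dom j (gam a) -> `|phase j gam a - z0| < r / 2 ->
  forall t, `|t - a| < r / 2 / L -> dom j (gam t) /\ `|phase j gam t - z0| < r.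
Proof.
move=> r0 L0 zj XL gam a geo ja pa.
have cg : continuous gam by case: geo.
apply: real_induction_open.
- by split=> //; rewrite (lt_trans pa) // half_lt.
- move=> t /andP[t0 tr] H.
  have xj x : `|x - lsubmx z0| <= r -> cdom j x.
    move=> xr; rewrite -(row_mxKl x (rsubmx z0)); apply: zj.
    rewrite -{2}(hsubmxK z0) opp_row_mx add_row_mx subrr.
    by apply: norm_row_mx_le; rewrite ?normr0 // ltW.
  (* C is compact, hence closed in the Hausdorff space M. It contains the positions at times closer
     to [a], hence the position at t, which is therefore in the chart. *)
  pose C := psi j @` [set x | `|x - lsubmx z0| <= r].
  have Cc : closed C.
    apply: compact_closed; first exact: manifold_hausdorff.
    apply: continuous_compact; last exact: cball_compact.
    apply/continuous_in_subspaceT => x; rewrite inE => /xj; exact: psi_cont.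
  have HC s : `|s - a| < `|t - a| -> C (gam s).
    move=> /H[js ps]; exists (phi j (gam s)); last exact: phiK.
    apply: ltW; apply: le_lt_trans ps.
    have -> : phi j (gam s) - lsubmx z0 = lsubmx (phase j gam s - z0).
      by rewrite linearB /= row_mxKl.
    exact: norm_lsubmx_le.
  have jt : dom j (gam t).
    suff [x /xj /cdom_dom[jx _] <-] : C (gam t) by [].
    apply: contrapT => nC.
    have : nbhs t (gam @^-1` (~` C)).
      by apply: cg; apply: open_nbhs_nbhs; split=> //; exact: closed_openC.
    move=> /near_eps[e e0 He].
    (* The factor k yields a time strictly closer to [a] than t, yet within e of t. *)
    pose k := Num.min (1 / 2) (e / 2 / `|t - a|).
    have k0 : 0 < k by rewrite lt_min !divr_gt0.
    have k1 : k < 1 by rewrite gt_min ltr_pdivrMr // mul1r ltr1n.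
    have := He (t - k * (t - a)); rewrite addrAC subrr add0r normrN.
    rewrite normrM (gtr0_norm k0) => /(_ _)/(_ (HC _ _)); apply.
      apply: (@le_lt_trans _ _ (e / 2)).
        by rewrite -ler_pdivlMr // ge_min lexx orbT.
      exact: half_lt.
    have -> : t - k * (t - a) - a = (1 - k) * (t - a) by ring.
    by rewrite normrM ger0_norm ?subr_ge0 ?(ltW k1) // mulrBl mul1r ltrBlDr ltrDl mulr_gt0.
  split=> //.
  have dph s : s = t \/ `|s - a| < `|t - a| ->
      is_derive s 1 (phase j gam) (VF j (phase j gam s)).
    by move=> [->|/H[js _]]; exact: is_derive_phase.
  have bph s : `|s - a| < `|t - a| -> `|VF j (phase j gam s)| <= L.
    by move=> /H[_ ps]; apply: XL; exact: ltW.
  (* The field is bounded only at times strictly closer to [a], hence the mean value inequality on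
     an open interval. *)
  have mv : `|phase j gam t - phase j gam a| <= L * `|t - a|.
    have [at_|ta|ta] := ltgtP a t; last by move: t0; rewrite ta subrr normr0 ltxx.
      rewrite (gtr0_norm (x := t - a)) ?subr_gt0 //.
      apply: (@vec_mvt_oo R _ _ (phase j gam) (fun s => VF j (phase j gam s)) a t L at_) => s /andP[s1 s2].
        have [st|st] := leP t s.
          by apply: dph; left; apply/eqP; rewrite eq_le s2 st.
        by apply: dph; right; rewrite !ger0_norm ?subr_ge0 ?ltrD2r // ltW.
      by apply: bph; rewrite !ger0_norm ?subr_ge0 ?ltrD2r // ltW.
    rewrite distrC (ltr0_norm (x := t - a)) ?subr_lt0 // opprB.
    apply: (@vec_mvt_oo R _ _ (phase j gam) (fun s => VF j (phase j gam s)) t a L ta) => s /andP[s1 s2].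
      have [st|st] := leP s t.
        by apply: dph; left; apply/eqP; rewrite eq_le s1 st.
      by apply: dph; right; rewrite !ler0_norm ?subr_le0 ?ltrN2 ?ltrD2r // ltW.
    by apply: bph; rewrite !ler0_norm ?subr_le0 ?ltrN2 ?ltrD2r // ltW.
  rewrite (le_lt_trans (ler_distD (phase j gam a) _ _)) // (splitr r).
  rewrite ler_ltD // (le_trans mv) // mulrC -ler_pdivlMr // ltW //.
move=> t tr [jt pt].
have [e e0 He] := dom_near cg jt.
have /continuous_epsP cph := is_derive_continuous (is_derive_phase geo jt).
have d0 : 0 < (r - `|phase j gam t - z0|) / 2 by rewrite divr_gt0 // subr_gt0.
have [e' e'0 He'] := cph _ d0.
exists (Num.min e e'); first by rewrite lt_min e0.
move=> s; rewrite lt_min => /andP[se se']; split; first exact: He.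
rewrite (le_lt_trans (ler_distD (phase j gam t) _ _)) //.
have := He' s se'; set A := `|_ s - _|; set B := `|_ - z0| in pt d0 *.
by move: pt; rewrite ler_pdivlMr //; lra.
Qed.

(** Tangent map of the change of charts, acting on position and velocity. *)
Definition transT i j (z : 'rV[R]_(n + n)) : 'rV[R]_(n + n) :=
  row_mx (phi j (psi i (lsubmx z))) (rsubmx z *m 'J (phi j \o psi i) (lsubmx z)).

Lemma transition_diff i j x : overlap i j x -> differentiable (phi j \o psi i) x.
Proof.
by move=> ox; have [dT _] := @transition_smooth R n M i j 1; exact: dT.
Qed.

Lemma transT_smooth i j r : Ck r [set z | overlap i j (lsubmx z)] (transT i j).
Proof.
have oW := @overlap_open R n M i j.
have oU : open [set z : 'rV[R]_(n + n) | overlap i j (lsubmx z)] by exact: open_lsubmx.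
apply: (Ck_mx oU) => i' j'; rewrite ord1.
case: (fintype.split j') (fintype.splitK j') => k /= <-.
  apply: (@Ck_ext _ _ _ oU _ _ (fun z => (phi j \o psi i) (lsubmx z) 0 k)).
    by move=> z _; rewrite row_mxEl.
  apply: (Ck_lsubmx n oW (f := fun x => (phi j \o psi i) x 0 k)).
  by apply: (Ck_coord oW); exact: transition_smooth.
apply: (@Ck_ext _ _ _ oU _ _ (fun z => \sum_l z 0 (rshift n l) *
   partial l (phi j \o psi i) (lsubmx z) 0 k)).
  move=> z Wz; rewrite row_mxEr mxE; apply: eq_bigr => l _; rewrite mxE.
  by rewrite -jacobian_partial ?mxE //; exact: transition_diff.
apply: (Ck_sum oU) => l; apply: (Ck_mul oU).
  by apply: (Ck_coord oU); exact: Ck_id.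
apply: (Ck_lsubmx n oW (f := fun x => partial l (phi j \o psi i) x 0 k)).
by apply: (Ck_coord oW); have [_] := @transition_smooth R n M i j r.+1; apply.
Qed.

Lemma phase_transition i j gam t : geodesic g gam -> dom i (gam t) -> dom j (gam t) ->
  phase j gam t = transT i j (phase i gam t).
Proof.
move=> geo it jt; have cg : continuous gam by case: geo.
have pK : psi i (phi i (gam t)) = gam t by exact: phiK.
have ot : overlap i j (phi i (gam t)) by split; [exact: dom_cdom|rewrite pK].
rewrite /transT /phase row_mxKl row_mxKr pK; congr row_mx.
have h1 := is_derive_chain (transition_diff ot) (is_derive_pos geo it).
rewrite diffE_jacobian in h1; last exact: transition_diff.
apply: is_derive_unique (is_derive_pos geo jt) _.
have [e e0 He] := dom_near cg it.
apply: is_derive_near e0 _ h1 => s /He is_.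
by rewrite /= phiK.
Qed.

End Phase.

(** * Expanding local diffeomorphisms are coverings *)

Section SegmentLifting.
Variables (R : realType) (n : nat) (M : manifold R n).
Variables (E : 'rV[R]_n -> M) (A : atlas M -> 'rV[R]_n -> 'M[R]_n).
Hypothesis E_sdiff : forall v j, dom j (E v) ->
  (exists2 d : R, 0 < d & forall u, `|u - v| < d -> dom j (E u)) /\
  sdiff (fun u => phi j (E u)) v (A j v).
(** One constant C serves all preimages of a coordinate ball; this uniformity is what makes lifts of
    segments exist up to time 1. *)
Hypothesis E_expand : forall j x, cdom j x -> exists r C : R, [/\ 0 < r, 0 < C &
  forall v, dom j (E v) -> `|phi j (E v) - x| <= r ->
    forall w : 'rV[R]_n, `|w| <= C * `|w *m A j v| ].

Lemma E_continuous : continuous E.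
Proof.
move=> v; have [j jv] := atlas_cover (E v).
have [[d d0 Hd] sF] := E_sdiff jv.
have cF : {for v, continuous (fun u => phi j (E u))}.
  exact: differentiable_continuous (sdiff_differentiable sF).1.
have cpsi : {for phi j (E v), continuous (psi j)} by apply: psi_cont; exact: dom_cdom.
have c : {for v, continuous (fun u => psi j (phi j (E u)))}.
  exact: (@continuous_comp _ _ _ (fun u => phi j (E u)) (psi j)).
have nE : \forall u \near v, psi j (phi j (E u)) = E u.
  apply/near_eps; exists d => // u /Hd ju.
  exact: phiK.
have c' := c; rewrite /prop_for /continuous_at phiK // in c'.
exact: (cvg_trans (near_eq_cvg nE) c').
Qed.

Lemma E_loc_inj v : exists2 r : R, 0 < r & forall a b, `|a - v| < r -> `|b - v| < r ->
  E a = E b -> a = b.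
Proof.
have [j jv] := atlas_cover (E v).
have [_ sF] := E_sdiff jv.
have [r [C [r0 C0 HC]]] := E_expand (dom_cdom jv).
have HA := HC v jv; rewrite subrr normr0 in HA.
have [r1 r10 [inj _]] := inverse_function C0 sF (HA (ltW r0)).
exists r1 => // a b ar br ab; apply/eqP; rewrite -subr_eq0 -normr_le0.
by have := inj a b ar br; rewrite ab subrr normr0 mulr0.
Qed.

(* Lift of the segment from xa to x (in the chart j), up to time T. *)
Let lift j v (xa x : 'rV[R]_n) (C T : R) (w : R -> 'rV[R]_n) :=
  [/\ w 0 = v, forall s, 0 <= s <= T -> dom j (E (w s)) /\ phi j (E (w s)) = xa + s *: (x - xa) &
   forall s t, 0 <= s <= T -> 0 <= t <= T -> `|w s - w t| <= C * `|x - xa| * `|s - t|].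

Let chart_ball j xc (r C : R) := [/\ 0 < r, 0 < C, forall x, `|x - xc| < r -> cdom j x &
  forall v, dom j (E v) -> `|phi j (E v) - xc| < r -> forall w : 'rV[R]_n, `|w| <= C * `|w *m A j v|].

(** The radius d depends on v, but the constant 2 C does not. *)
Let chart_inverse j xc r C v : chart_ball j xc r C -> dom j (E v) -> `|phi j (E v) - xc| < r ->
  exists2 d : R, 0 < d & [/\
  forall u, `|u - v| < d -> dom j (E u),
  forall a b, `|a - v| < d -> `|b - v| < d -> `|a - b| <= 2 * C * `|phi j (E a) - phi j (E b)| &
  forall y, 2 * C * `|y - phi j (E v)| < d ->
    exists2 a, `|a - v| <= 2 * C * `|y - phi j (E v)| & phi j (E a) = y].
Proof.
move=> [r0 C0 _ HC] jv vr; have [[d d0 Hd] sF] := E_sdiff jv.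
have [r1 r10 [inj surj]] := inverse_function C0 sF (HC v jv vr).
exists (Num.min d r1); rewrite ?lt_min ?d0 //; split.
- by move=> u; rewrite lt_min => /andP[/Hd].
- by move=> a b; rewrite !lt_min => /andP[_ a1] /andP[_ b1]; exact: inj.
by move=> y; rewrite lt_min => /andP[_ /surj].
Qed.

Let seg_in j xc (r C : R) (xa x : 'rV[R]_n) (s : R) : chart_ball j xc r C ->
  `|xa - xc| < r -> `|x - xc| < r -> 0 <= s <= 1 -> `|xa + s *: (x - xa) - xc| < r.
Proof.
move=> _ h1 h2 s01.
have m1 : `|x - xc| <= Num.max `|x - xc| `|xa - xc| by rewrite le_max lexx.
have m2 : `|xa - xc| <= Num.max `|x - xc| `|xa - xc| by rewrite le_max lexx orbT.
by apply: (le_lt_trans (cball_convex s01 m1 m2)); rewrite gt_max h1 h2.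
Qed.

(* A lift reaching a point near b at a time near S extends past S. *)
Let extend j xc r C v xa x S b : chart_ball j xc r C -> dom j (E b) ->
  `|xa - xc| < r -> `|x - xc| < r -> 0 <= S <= 1 -> phi j (E b) = xa + S *: (x - xa) ->
  exists2 e : R, 0 < e & forall s t w, `|s - S| < e -> `|t - S| < e -> 0 <= s -> s <= t ->
    `|w s - b| < e -> lift j v xa x (2 * C) s w -> exists w', lift j v xa x (2 * C) t w'.
Proof.
move=> cb jb xar xr S01 phib.
have bin : `|phi j (E b) - xc| < r by rewrite phib; exact: (seg_in cb).
have [d d0 [dj inj surj]] := chart_inverse cb jb bin.
have [r0 C0 _ _] := cb.
have C20 : 0 < 2 * C by rewrite mulr_gt0.
pose K := 2 * C * `|x - xa|.
have K0 : 0 <= K by rewrite mulr_ge0 // ltW.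
exists (Num.min d (d / (K + 1))); first by rewrite lt_min d0 divr_gt0 // ltr_wpDl.
move=> s t w; rewrite !lt_min => /andP[_ sS] /andP[_ tS] s0 st /andP[wb _] [w0 Hw Lw].
have ex u : exists a, s <= u <= t -> `|a - b| < d /\ phi j (E a) = xa + u *: (x - xa).
  have [ut|ut] := pselect (s <= u <= t); last by exists 0.
  have uS : `|u - S| < d / (K + 1).
    move: sS tS ut; rewrite !ltr_norml => /andP[? ?] /andP[? ?] /andP[? ?].
    by apply/andP; split; lra.
  have yd : 2 * C * `|xa + u *: (x - xa) - phi j (E b)| < d.
    rewrite phib opprD addrACA subrr add0r -scalerBl normrZ mulrCA -/K mulrC.
    have : (K + 1) * `|u - S| < d by rewrite mulrC -ltr_pdivlMr // ltr_wpDl.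
    by apply: le_lt_trans; rewrite ler_wpM2r // lerDl.
  have [a ab Ea] := surj _ yd; exists a => _; split=> //.
  exact: le_lt_trans yd.
pose h u := projT1 (cid (ex u)).
have Hh u : s <= u <= t -> `|h u - b| < d /\ phi j (E (h u)) = xa + u *: (x - xa).
  by rewrite /h; case: cid.
have hs : h s = w s.
  have [|hb hE] := Hh s; first by rewrite lexx st.
  have [|_ wE] := Hw s; first by rewrite s0 lexx.
  apply/eqP; rewrite -subr_eq0 -normr_le0.
  by have := inj _ _ hb wb; rewrite hE wE subrr normr0 mulr0.
pose w' u := if u <= s then w u else h u.
have Lh u u' : s <= u <= t -> s <= u' <= t -> `|h u - h u'| <= K * `|u - u'|.
  move=> ut u't; have [hb hE] := Hh u ut; have [hb' hE'] := Hh u' u't.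
  apply: (le_trans (inj _ _ hb hb')); rewrite hE hE' opprD addrACA subrr add0r -scalerBl.
  by rewrite normrZ mulrCA mulrC.
have Lw' u u' : 0 <= u -> u <= u' -> u' <= t -> `|w' u - w' u'| <= K * `|u - u'|.
  move=> u0 uu' u't; rewrite /w'.
  have [us|su] := leP u s; have [u's|su'] := leP u' s.
  - by apply: Lw; rewrite ?u0 ?us ?u's ?(le_trans u0).
  - rewrite (le_trans (ler_distD (w s) _ _)) //.
    have h1 : `|w u - w s| <= K * `|u - s| by apply: Lw; rewrite ?u0 ?us ?s0 ?lexx.
    have h2 : `|w s - h u'| <= K * `|s - u'|.
      by rewrite -hs; apply: Lh; rewrite ?lexx ?st ?(ltW su') ?u't.
    apply: (le_trans (lerD h1 h2)); rewrite -mulrDr ler_wpM2l //.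
    rewrite !ler0_norm ?subr_le0 ?(ltW su') //; lra.
  - by move: (lt_le_trans su uu'); rewrite ltNge u's.
  - by apply: Lh; rewrite ?(ltW su) ?(ltW su') ?u't ?(le_trans uu').
exists w'; split.
- by rewrite /w' s0.
- move=> u /andP[u0 ut]; rewrite /w'; have [us|su] := leP u s.
    by apply: Hw; rewrite u0.
  have [|hb hE] := Hh u; first by rewrite ltW.
  by split=> //; exact: dj.
move=> u u' /andP[u0 ut] /andP[u'0 u't]; have [uu'|/ltW u'u] := leP u u'.
  exact: Lw'.
by rewrite distrC (distrC u); exact: Lw'.
Qed.

(** The common Lipschitz constant keeps the end points of partial lifts in one compact ball around
    v. As s tends to S they cannot all stay away from the points over the segment at time S, and
    near such a point [extend] carries the lift to S and beyond. *)
Let lift_exists j xc r C v x : chart_ball j xc r C -> dom j (E v) ->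
  `|phi j (E v) - xc| < r -> `|x - xc| < r ->
  exists w, lift j v (phi j (E v)) x (2 * C) 1 w.
Proof.
move=> cb jv xar xr; set xa := phi j (E v).
have [r0 C0 _ _] := cb.
have K0 : 0 <= 2 * C * `|x - xa| by rewrite mulr_ge0 // mulr_ge0 // ltW.
pose Q (T : R) := exists w, lift j v xa x (2 * C) T w.
apply: (@real_induction R Q 0 1) => //; last by rewrite ler01 lexx.
- exists (fun=> v); split=> // [s|s t].
    move=> /andP[s0 s0']; have -> : s = 0 by apply/eqP; rewrite eq_le s0 s0'.
    by rewrite scale0r addr0.
  by move=> _ _; rewrite subrr normr0 mulr_ge0.
- move=> S /andP[S0 S1] HQ.
  (* Compactness is used in covering form: each b of the ball has a neighbourhood in which any lift
     that ends there at a time close to S yields Q S. *)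
  pose P s b := forall w, 0 <= s < S -> w s = b -> lift j v xa x (2 * C) s w -> Q S.
  have S01 : 0 <= S <= 1 by rewrite ltW.
  have cov b : [set b | `|b - v| <= 2 * C * `|x - xa| + 1] b ->
      \forall b' \near b & s \near S, P s b'.
    move=> _.
    have [[jb Eb]|nb] := pselect (dom j (E b) /\ phi j (E b) = xa + S *: (x - xa)).
      have [e e0 He] := extend v cb jb xar xr S01 Eb.
      exists (ball b e, ball S e); first by split; exact: nbhsx_ballx.
      move=> [b' s] /= []; rewrite -ball_normE /ball /= => bb' Ss w /andP[s0 sS] wb' lw.
      apply: (He s S w) => //; rewrite ?subrr ?normr0 // 1?distrC //; first exact: ltW.
      by rewrite wb'.
    (* Here b does not lie over the point of the segment at time S: by Hausdorff separation no lift
       ends near b at times near S, and P holds vacuously. *)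
    have qne : E b <> psi j (xa + S *: (x - xa)).
      move=> Eb; apply: nb; rewrite Eb; apply: cdom_dom.
      have [_ _ cd _] := cb; apply: cd; exact: (seg_in cb).
    have [[V W] /= [/set_mem Vb /set_mem Wq] VW] : exists2 AB,
        (E b \in AB.1 /\ psi j (xa + S *: (x - xa)) \in AB.2) &
        [/\ open AB.1, open AB.2 & AB.1 `&` AB.2 == set0].
      have := @manifold_hausdorff R n M; rewrite open_hausdorff => H.
      by apply: H; apply/eqP.
    have [oV oW /eqP VW0] := VW.
    have nV : nbhs b (E @^-1` V) by apply: E_continuous; exact: open_nbhs_nbhs.
    have cs : {for S, continuous (fun s : R => psi j (xa + s *: (x - xa)))}.
      apply: (@continuous_comp _ _ _ (fun s : R => xa + s *: (x - xa)) (psi j)).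
        exact: is_derive_continuous (is_derive_line xa (x - xa) S).
      apply: psi_cont; have [_ _ cd _] := cb; apply: cd; exact: (seg_in cb).
    have nW : nbhs S ((fun s : R => psi j (xa + s *: (x - xa))) @^-1` W).
      by apply: cs; exact: open_nbhs_nbhs.
    exists (E @^-1` V, (fun s : R => psi j (xa + s *: (x - xa))) @^-1` W) => //.
    move=> [b' s] /= [Vb' Ws] w /andP[s0 sS] wb' [_ Hw _].
    have [|jw Ew] := Hw s; first by rewrite s0 lexx.
    have : (V `&` W) (E b').
      by split=> //; move: Ws; rewrite -Ew phiK // wb'.
    by rewrite VW0.
  have := (@compact_near_coveringP _ _).1 (@cball_compact R n v (2 * C * `|x - xa| + 1)) R (nbhs S) P.
  move=> /(_ (nbhs_filter S) cov) /near_eps[e e0 He].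
  pose s := Num.max 0 (S - e / 2).
  have sS : 0 <= s < S by rewrite le_max lexx gt_max S0 ltrBlDr ltrDl divr_gt0.
  have [w lw] := HQ s sS.
  apply: (He s _ (w s) _ w) => //.
    rewrite /ball /= ltr_norml.
    have : S - e / 2 <= s by rewrite le_max lexx orbT.
    by move: sS => /andP[_ h1] h2; apply/andP; split; lra.
  have [w0 _ Lw] := lw; have /andP[s0 sS'] := sS.
  rewrite /= -{1}w0; have := Lw s 0; rewrite s0 !lexx subr0 => /(_ isT isT) /le_trans; apply.
  rewrite ger0_norm // ler_wpDr // ler_piMr //.
  by rewrite (le_trans (ltW sS')).
move=> S /andP[S0 S1] HQ.
have [|w lw] := HQ S; first by rewrite S0 lexx.
have [w0 Hw Lw] := lw; have [|jw Ew] := Hw S; first by rewrite S0 lexx.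
have S01 : 0 <= S <= 1 by rewrite S0 ltW.
have [e e0 He] := extend v cb jw xar xr S01 Ew.
exists e => // t /andP[St te]; apply: (He S t w) => //; rewrite ?subrr ?normr0 //; last exact: ltW.
by rewrite ger0_norm ?subr_ge0 ?(ltW St) // ltrBlDl.
Qed.

(** The section sends q' to the end of the lift of the coordinate segment from E v to q'. U comes
    from the coordinate ball alone, not from v. *)
Lemma covering_section (q : M) : exists2 U : set M, open U /\ U q &
  forall v, U (E v) -> exists s : M -> 'rV[R]_n, s (E v) = v /\
    forall q', U q' -> E (s q') = q' /\ {for q', continuous s}.
Proof.
have [j jq] := atlas_cover q.
have [r1 [C [r10 C0 HC]]] := E_expand (dom_cdom jq).
set xc := phi j q in HC.
have [r2 r20 Hr2] := open_cball (@cdomO R n M j) (dom_cdom jq); rewrite -/xc in Hr2.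
pose r := Num.min r1 r2.
have cb : chart_ball j xc r C.
  split; rewrite ?lt_min ?r10 //.
    by move=> x; rewrite lt_min => /andP[_ x2]; apply: Hr2; exact: ltW.
  by move=> v jv; rewrite lt_min => /andP[v1 _]; apply: HC => //; exact: ltW.
have r0 : 0 < r by case: cb.
pose U := [set q' | dom j q' /\ `|phi j q' - xc| < r].
exists U.
  split; last by split=> //; rewrite subrr normr0.
  rewrite openE => q' [jq' q'r]; rewrite /interior.
  have n1 : nbhs q' (dom j) by apply: open_nbhs_nbhs; split=> //; exact: dom_open.
  have n2 : nbhs q' (phi j @^-1` ball (phi j q') (r - `|phi j q' - xc|)).
    by apply: (phi_cont jq'); apply: nbhsx_ballx; rewrite subr_gt0.
  apply: filterS (filterI n1 n2) => p [jp]; rewrite /= -ball_normE /ball_ /= => pr.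
  split=> //; rewrite (le_lt_trans (ler_distD (phi j q') _ _)) //.
  by rewrite -ltrBrDr distrC.
move=> v [jv vr]; set xa := phi j (E v) in vr *.
have ex x : exists w, `|x - xc| < r -> lift j v xa x (2 * C) 1 w.
  have [xr|xr] := pselect (`|x - xc| < r); last by exists (fun=> 0).
  by have [w lw] := lift_exists cb jv vr xr; exists w.
pose w x := projT1 (cid (ex x)).
have Hw x : `|x - xc| < r -> lift j v xa x (2 * C) 1 (w x) by rewrite /w; case: cid.
have one : 0 <= (1 : R) <= 1 by rewrite ler01 lexx.
exists (fun q' => w (phi j q') 1); split.
  (* The segment from xa to itself has Lipschitz bound 0, so its lift stays at v. *)
  have [w0 _ Lw] := Hw _ vr; apply/eqP; rewrite -subr_eq0 -normr_le0 -[in X in _ - X]w0.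
  have z1 : 0 <= (0 : R) <= 1 by rewrite lexx ler01.
  by have := Lw 1 0 one z1; rewrite -/xa (subrr xa) normr0 mulr0 mul0r.
move=> q' [jq' q'r]; split.
  have [_ Ew _] := Hw _ q'r; have [jw] := Ew 1 one.
  by rewrite scale1r subrKC => h; rewrite -(phiK jw) h phiK.
set xh := phi j q' in q'r *.
pose cl (t : R) := clip 0 1 t.
have cl01 t : 0 <= cl t <= 1 by exact: clip_in.
have cl_lip t t' : `|cl t - cl t'| <= `|t - t'| by exact: clip_lip.
(* Comparison of two lifts at time t, propagated in t. The constant 2 C does not deteriorate,
   because each step reapplies the local inverse bound instead of compounding it; only e shrinks. *)
pose P t := exists2 e : R, 0 < e & forall x, `|x - xc| < r -> `|x - xh| < e ->
  `|w x (cl t) - w xh (cl t)| <= 2 * C * `|x - xh|.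
have C20 : 0 < 2 * C by rewrite mulr_gt0.
have P1 : P 1.
  apply: (@loc_const_induction R P 0).
    exists 1 => // x xr _; have -> : cl 0 = 0 by rewrite /cl clip_id ?lexx ?ler01.
    have [-> _ _] := Hw x xr; have [-> _ _] := Hw xh q'r.
    by rewrite subrr normr0 mulr_ge0 // ltW.
  move=> t0; set b := w xh (cl t0).
  have [_ Eb _] := Hw xh q'r; have [jb phib] := Eb _ (cl01 t0).
  have bin : `|phi j (E b) - xc| < r by rewrite phib; exact: (seg_in cb).
  have [d d0 [dj inj _]] := chart_inverse cb jb bin.
  pose K := 2 * C * (2 * r) + 1.
  have K0 : 0 < K by rewrite ltr_wpDl // !mulr_ge0 // ltW.
  have LK x t t' : `|x - xc| < r -> `|w x (cl t) - w x (cl t')| <= K * `|t - t'|.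
    move=> xr; have [_ _ Lw] := Hw x xr.
    apply: (le_trans (Lw _ _ (cl01 t) (cl01 t'))).
    apply: ler_pM => //; first by rewrite mulr_ge0 // ltW.
    rewrite /K ler_wpDr // ler_wpM2l ?(ltW C20) //.
    rewrite (le_trans (ler_distD xc _ _)) // mulr2n mulrDl mul1r.
    by rewrite lerD ?(ltW xr) // distrC ltW.
  (* Between s and u a lift moves by at most d / 4; adding d / 4 between the two lifts and d / 8
     from b keeps all points within d of b. *)
  exists (d / 8 / K); first by rewrite !divr_gt0.
  move=> s u sK uK [e e0 He].
  exists (Num.min e (d / 4 / (2 * C))); first by rewrite lt_min e0 !divr_gt0.
  move=> x xr; rewrite lt_min => /andP[xe xd].
  have h1 : `|w xh (cl s) - b| < d / 8.
    by apply: (le_lt_trans (LK _ _ _ q'r)); rewrite mulrC -ltr_pdivlMr.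
  have h2 : `|w xh (cl u) - b| < d / 8.
    by apply: (le_lt_trans (LK _ _ _ q'r)); rewrite mulrC -ltr_pdivlMr.
  have h3 : `|w x (cl s) - w xh (cl s)| < d / 4.
    by apply: (le_lt_trans (He x xr xe)); rewrite mulrC -ltr_pdivlMr.
  have h4 : `|w x (cl u) - w x (cl s)| <= d / 4.
    apply: (le_trans (LK _ _ _ xr)).
    have : `|u - s| <= d / 8 / K + d / 8 / K.
      rewrite (le_trans (ler_distD t0 _ _)) // lerD ?(ltW uK) //.
      by rewrite distrC ltW.
    have -> : d / 8 / K + d / 8 / K = d / 4 / K by field; rewrite gt_eqF.
    by rewrite ler_pdivlMr // mulrC.
  have h5 : `|w x (cl u) - b| < d.
    rewrite (le_lt_trans (ler_distD (w x (cl s)) _ _)) //.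
    have : `|w x (cl s) - b| <= `|w x (cl s) - w xh (cl s)| + `|w xh (cl s) - b|.
      by rewrite -[in leLHS](subrKA (w xh (cl s))) ler_normD.
    by move: h1 h3 h4; lra.
  have h6 : `|w xh (cl u) - b| < d by apply: (lt_trans h2); lra.
  apply: (le_trans (inj _ _ h5 h6)); rewrite ler_wpM2l ?(ltW C20) //.
  have [_ Ex _] := Hw x xr; have [_ ->] := Ex _ (cl01 u); have [_ ->] := Eb _ (cl01 u).
  have -> : xa + cl u *: (x - xa) - (xa + cl u *: (xh - xa)) = cl u *: (x - xh).
    by apply/rowP => i; rewrite !mxE; ring.
  have /andP[c0 c1] := cl01 u.
  by rewrite normrZ ger0_norm // ler_piMl.
have cl1 : cl 1 = 1 by rewrite /cl clip_id ?lexx ?ler01.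
have [e e0 He] := P1; rewrite cl1 in He.
apply: (@continuous_comp _ _ _ (phi j) (fun x => w x 1)); first exact: phi_cont.
apply/continuous_epsP => e' e'0.
exists (Num.min (Num.min e (r - `|xh - xc|)) (e' / (2 * C))).
  by rewrite !lt_min e0 subr_gt0 q'r divr_gt0.
move=> y; rewrite !lt_min => /andP[/andP[ye yr] ye'].
apply: (le_trans (He y _ ye)).
  by rewrite (le_lt_trans (ler_distD xh _ _)) // -ltrBrDr.
by rewrite mulrC -ler_pdivlMr // ltW.
Qed.

End SegmentLifting.

(** * Jacobi fields and the exponential map *)

Section ExponentialMap.
Variables (R : realType) (n : nat) (M : manifold R n) (g : riemannian_metric M).
Variables (gam : 'rV[R]_n -> R -> M) (i0 : atlas M) (p : M).
Hypothesis geo : forall v, geodesic g (gam v).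
Hypothesis i0p : dom i0 p.
Hypothesis gam0 : forall v, gam v 0 = p.
Hypothesis gam'0 : forall v, derive1 (phi i0 \o gam v) 0 = v.
Local Notation VF j := (geoX (gram g j)).

(** The first clause gives the second its meaning: at time t the nearby geodesics all lie in the
    chart j. *)
Definition regular_at v0 t (j : atlas M) :=
  (exists2 d : R, 0 < d & forall v, `|v - v0| < d -> dom j (gam v t)) /\
  exists D, sdiff (fun v => phase j (gam v) t) v0 D.

Lemma regular_dom v0 t j : regular_at v0 t j -> dom j (gam v0 t).
Proof. by move=> [[d d0 H] _]; apply: H; rewrite subrr normr0. Qed.

Lemma sdiff_lsubmx d a b (F : 'rV[R]_d -> 'rV[R]_(a + b)) x D :
  sdiff F x D -> sdiff (fun v => lsubmx (F v)) x (lsubmx D).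
Proof.
move=> sF e e0; have [r r0 H] := sF e e0; exists r => // y z yr zr.
apply: le_trans (H y z yr zr).
have -> : lsubmx (F y) - lsubmx (F z) - (y - z) *m lsubmx D =
    lsubmx (F y - F z - (y - z) *m D).
  by rewrite !linearB /= -[in RHS](hsubmxK D) mul_mx_row row_mxKl.
exact: norm_lsubmx_le.
Qed.

Lemma regular_change v0 t i j : regular_at v0 t i -> dom j (gam v0 t) -> regular_at v0 t j.
Proof.
move=> ri jt; have it := regular_dom ri; case: ri => [[d1 d10 Hd1] [D sD]].
have ot : overlap i j (lsubmx (phase i (gam v0) t)).
  by rewrite /phase row_mxKl; split; [exact: dom_cdom|rewrite phiK].
have [r1 [C [r10 C0 HC]]] := sdiff_lipschitz sD.
have /near_eps[e e0 He] : \forall z \near phase i (gam v0) t, overlap i j (lsubmx z).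
  apply: open_nbhs_nbhs; split=> //.
  by apply: open_lsubmx; exact: overlap_open.
pose d := Num.min d1 (Num.min r1 (e / C)).
have d0 : 0 < d by rewrite !lt_min d10 r10 divr_gt0.
have ov v : `|v - v0| < d -> overlap i j (lsubmx (phase i (gam v) t)).
  rewrite !lt_min => /and3P[v1 v2 v3]; apply: He.
  apply: le_lt_trans (HC v v0 v2 _) _.
    by rewrite subrr normr0.
  by rewrite mulrC -ltr_pdivlMr.
have dv v : `|v - v0| < d -> dom i (gam v t) /\ dom j (gam v t).
  move=> vd; have := ov v vd; move: vd; rewrite !lt_min => /and3P[/Hd1 iv _ _].
  by rewrite /phase row_mxKl => -[_]; rewrite phiK.
split; first by exists d => // v /dv[].
exists (D *m 'J (transT i j) (phase i (gam v0) t)).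
have sT : sdiff (transT i j) (phase i (gam v0) t) ('J (transT i j) (phase i (gam v0) t)).
  pose W := [set z : 'rV[R]_(n + n) | overlap i j (lsubmx z)].
  have oW : open W by apply: open_lsubmx; exact: overlap_open.
  exact: (Ck1_sdiff oW (@transT_smooth R n M i j 1) ot).
apply: sdiff_ext d0 _ (sdiff_comp sD sT) => v /dv[iv jv].
by rewrite /= -(phase_transition (geo v) iv jv).
Qed.

(** e depends on t0 but not on the time s at which regularity is known; propagation in time relies
    on this uniformity. The rest is confinement in a phase ball followed by [ode_dependence]. *)
Lemma local_flow v0 t0 j : dom j (gam v0 t0) ->
  exists2 e : R, 0 < e & forall s, `|s - t0| < e -> regular_at v0 s j ->
  exists D : R -> 'M[R]_(n, n + n), forall t, `|t - t0| < e ->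
    [/\ regular_at v0 t j, sdiff (fun v => phase j (gam v) t) v0 (D t) &
        is_derive t 1 D (D t *m 'J (VF j) (phase j (gam v0) t))].
Proof.
move=> jt; pose z0 := phase j (gam v0) t0.
have oU : open [set z : 'rV[R]_(n + n) | cdom j (lsubmx z)].
  by apply: open_lsubmx; exact: cdomO.
have CX : Ck 1 [set z : 'rV[R]_(n + n) | cdom j (lsubmx z)] (VF j).
  by apply: geoX_smooth; [exact: cdomO|exact: gramS|exact: gramP].
have Uz0 : cdom j (lsubmx z0) by rewrite /z0 /phase row_mxKl; exact: dom_cdom.
have [r r0 [zj dX cX]] := Ck1_near oU CX Uz0.
have [L L0 [X_lin X_lip X_bnd A_bnd A_cont]] := C1_compact dX cX.
pose tau := r / 2 / L; have tau0 : 0 < tau by rewrite !divr_gt0.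
have /continuous_epsP cph := is_derive_continuous (is_derive_phase (geo v0) jt).
have r4 : 0 < r / 4 by rewrite divr_gt0.
have [e1 e10 He1] := cph _ r4.
have [e2 e20 He2] := dom_near (proj1 (geo v0)) jt.
pose e := Num.min (tau / 2) (Num.min e1 e2).
exists e; first by rewrite !lt_min e10 e20 divr_gt0.
move=> s; rewrite !lt_min => /and3P[s1 s2 s3] [[d1 d10 Hd1] [D0 sD0]].
have [r1 [C [r10 C0 HC]]] := sdiff_lipschitz sD0.
(* At time s the phase of gam v is within r / 4 of that of gam v0, itself within r / 4 of z0: this
   is the starting condition r / 2 of [geodesic_confined]. *)
pose d := Num.min d1 (Num.min r1 (r / 4 / C)).
have d0 : 0 < d by rewrite !lt_min d10 r10 !divr_gt0.
have conf v t : `|v - v0| < d -> `|t - s| < tau ->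
    dom j (gam v t) /\ `|phase j (gam v) t - z0| < r.
  rewrite !lt_min => /and3P[v1 v2 v3] ts.
  apply: (geodesic_confined r0 L0 zj X_bnd (geo v) (Hd1 v v1)) ts.
  rewrite -(subrKA (phase j (gam v0) s)).
  have -> : r / 2 = r / 4 + r / 4 by field.
  apply: le_lt_trans (ler_normD _ _) _; apply: ltr_leD; last exact: He1.
  apply: le_lt_trans (HC v v0 v2 _) _; first by rewrite subrr normr0.
  by rewrite mulrC -ltr_pdivlMr.
have near_s t : `|t - t0| < e -> `|t - s| < tau.
  rewrite lt_min => /andP[t1 _]; rewrite -(subrKA t0) (splitr tau).
  by apply: le_lt_trans (ler_normD _ _) _; apply: ltrD => //; rewrite distrC.
have [||D [_ HD]] := @ode_dependence R n (n + n) (VF j) (fun z => 'J (VF j) z)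
    [set z | `|z - z0| <= r] (fun v t => phase j (gam v) t) v0 s tau L d D0 tau0 d0 (ltW L0)
    X_lin X_lip X_bnd A_bnd A_cont _ _ sD0.
- by move=> v t vd ts; have [_ /ltW] := conf v t vd ts.
- by move=> v t vd ts; have [jv _] := conf v t vd ts; exact: is_derive_phase.
exists D => t /near_s ts; have [sD dD] := HD t ts; split=> //.
by split; [exists d => // v vd; have [] := conf v t vd ts|exists (D t)].
Qed.

Lemma sdiff_phase0 v0 : sdiff (fun v => phase i0 (gam v) 0) v0 (row_mx 0 1%:M).
Proof.
apply: sdiff_ext (ltr01) _ (sdiff_linear _ _ (row_mx (phi i0 p) 0)) => v _.
by rewrite /phase gam0 gam'0 mul_mx_row mulmx0 mulmx1 add_row_mx add0r addr0.
Qed.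

Lemma regular0 v0 : regular_at v0 0 i0.
Proof.
split; first by exists 1 => // v _; rewrite gam0.
by exists (row_mx 0 1%:M); exact: sdiff_phase0.
Qed.

Lemma regular_all v0 t j : dom j (gam v0 t) -> regular_at v0 t j.
Proof.
(* P quantifies over all charts, since the chart used around t need not be the one in which
   regularity is asked. *)
move: t j; pose P t := forall j, dom j (gam v0 t) -> regular_at v0 t j.
suff : forall t, P t by [].
apply: (@loc_const_induction R P 0).
  by move=> j; apply: regular_change; exact: regular0.
move=> t; have [j jt] := atlas_cover (gam v0 t).
have [e e0 He] := local_flow jt.
have [e' e'0 He'] := dom_near (proj1 (geo v0)) jt.
exists (Num.min e e'); first by rewrite lt_min e0.
move=> s u; rewrite !lt_min => /andP[s1 s2] /andP[u1 u2] Ps i iu.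
have [D HD] := He s s1 (Ps j (He' s s2)).
by have [ru _ _] := HD u u1; exact: regular_change ru iu.
Qed.

Lemma flow_derivative v0 t0 j : dom j (gam v0 t0) ->
  exists2 e : R, 0 < e & exists D : R -> 'M[R]_(n, n + n), forall t, `|t - t0| < e ->
    [/\ dom j (gam v0 t), sdiff (fun v => phase j (gam v) t) v0 (D t) &
        is_derive t 1 D (D t *m 'J (VF j) (phase j (gam v0) t))].
Proof.
move=> jt; have [e e0 He] := local_flow jt; exists e => //.
have [|D HD] := He t0 _ (regular_all jt); first by rewrite subrr normr0.
by exists D => t /HD[rt sD dD]; split=> //; exact: regular_dom rt.
Qed.

Hypothesis CH : cartan_hadamard g.
Local Notation Gr := (gram g).

(* jac j v w is (J, J') in the chart j for the Jacobi field J along gam v that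
   is the variation of gam v in the direction w; covJ is the covariant derivative
   of J along gam v. *)
Definition jac j v w t : 'rV[R]_(n + n) := w *m 'J (fun u => phase j (gam u) t) v.
Local Notation posi j v t := (phi j (gam v t)).
Local Notation vel j v t := (rsubmx (phase j (gam v) t)).
Local Notation Jf j v w t := (lsubmx (jac j v w t)).
Local Notation Kf j v w t := (rsubmx (jac j v w t)).
Definition covJ j v w t : 'rV[R]_n := Kf j v w t + chr (Gr j) (posi j v t) (vel j v t) (Jf j v w t).

Lemma sdiff_phase j v t : dom j (gam v t) ->
  sdiff (fun u => phase j (gam u) t) v ('J (fun u => phase j (gam u) t) v).
Proof.
move=> jt; have [_ [D sD]] := regular_all jt.
by have [_ ->] := sdiff_differentiable sD.
Qed.

Lemma sdiff_pos j v t : dom j (gam v t) ->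
  sdiff (fun u => posi j u t) v (lsubmx ('J (fun u => phase j (gam u) t) v)).
Proof.
move=> /sdiff_phase /sdiff_lsubmx; apply: sdiff_ext ltr01 _ => u _.
by rewrite /phase row_mxKl.
Qed.

Lemma JfE j v w t : Jf j v w t = w *m lsubmx ('J (fun u => phase j (gam u) t) v).
Proof. by rewrite /jac -[in LHS](hsubmxK ('J _ v)) mul_mx_row row_mxKl. Qed.

Lemma phase_lsub j v t : lsubmx (phase j (gam v) t) = posi j v t.
Proof. by rewrite /phase row_mxKl. Qed.

Lemma jac_deriv j v w t0 : dom j (gam v t0) ->
  exists2 e : R, 0 < e & forall t, `|t - t0| < e -> dom j (gam v t) /\
    is_derive t 1 (jac j v w) (jac j v w t *m 'J (VF j) (phase j (gam v) t)).
Proof.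
move=> jt; have [e e0 [D HD]] := flow_derivative jt.
exists e => // t te; have [jt' sD dD] := HD t te; split=> //.
have DE s : `|s - t0| < e -> jac j v w s = w *m D s.
  by move=> /HD[_ sDs _]; rewrite /jac (sdiff_differentiable sDs).2.
rewrite DE // -mulmxA.
have te' : 0 < e - `|t - t0| by rewrite subr_gt0.
apply: (is_derive_near te' (f := fun s => w *m D s)) => [s st|].
  rewrite DE // (le_lt_trans (ler_distD t _ _)) //.
  by rewrite -ltrBrDr.
apply: is_derive_mx => i k; rewrite mxE.
have -> : (fun s => (w *m D s) i k) = (fun s => \sum_l w i l * D s l k).
  by apply/funext => s; rewrite mxE.
apply: is_derive_sumf => l.
apply: (is_derive_eq (is_derive_mulf (is_derive_cst (w i l) t 1) (is_derive_coord l k dD))).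
by rewrite mul0r add0r.
Qed.

Lemma jac_ode j v w t : dom j (gam v t) ->
  is_derive t 1 (fun s => Jf j v w s) (Kf j v w t) /\
  is_derive t 1 (fun s => Kf j v w s)
   (- (dchr (Gr j) (posi j v t) (Jf j v w t) (vel j v t) (vel j v t) +
       2 *: chr (Gr j) (posi j v t) (vel j v t) (Kf j v w t))).
Proof.
move=> jt; have [e e0 H] := jac_deriv w jt.
have [|_ dj] := H t; first by rewrite subrr normr0.
have cj : cdom j (lsubmx (phase j (gam v) t)) by rewrite phase_lsub; exact: dom_cdom.
rewrite (geoX_jacobian (@cdomO R n M j) (@gramS R n M g j) (@gramT R n M g j)
  (@gramP R n M g j) _ cj) in dj.
rewrite phase_lsub in dj.
have := is_derive_lsubmx dj; rewrite row_mxKl => h1.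
by have := is_derive_rsubmx dj; rewrite row_mxKr => h2.
Qed.

Lemma vel_ode j v t : dom j (gam v t) ->
  is_derive t 1 (fun s => posi j v s) (vel j v t) /\
  is_derive t 1 (fun s => vel j v s) (- chr (Gr j) (posi j v t) (vel j v t) (vel j v t)).
Proof.
move=> jt; have := is_derive_phase (geo v) jt; rewrite /geoX phase_lsub => d; split.
  have := is_derive_lsubmx d; rewrite row_mxKl.
  by congr is_derive; apply/funext => s; rewrite phase_lsub.
by have := is_derive_rsubmx d; rewrite row_mxKr.
Qed.

(** Jacobi equation: the left-hand side is the second covariant derivative of J along the
    geodesic. *)
Lemma covJ_ode j v w t : dom j (gam v t) ->
  exists2 c' : 'rV[R]_n, is_derive t 1 (covJ j v w) c' &
   c' + chr (Gr j) (posi j v t) (vel j v t) (covJ j v w t) =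
   - curvature (Gr j) (posi j v t) (Jf j v w t) (vel j v t) (vel j v t).
Proof.
move=> jt; have [dJ dK] := jac_ode w jt; have [dx dy] := vel_ode jt.
have cj := dom_cdom jt.
have dch := is_derive_chr (@cdomO R n M j) (@gramS R n M g j) (@gramP R n M g j) cj dx dy dJ.
eexists; first exact: is_deriveD dK dch.
exact: (jacobi_cov (@cdomO R n M j) (@gramS R n M g j) (@gramT R n M g j) _ _ _ cj).
Qed.

(* The scalars |J|^2, <velocity, J>, |velocity|^2 and <DJ, J> do not depend on
   the chart, so an arbitrary one is picked at each time. *)
Let ch v t := projT1 (cid (atlas_cover (gam v t))).
Let chP v t : dom (ch v t) (gam v t). Proof. by rewrite /ch; case: cid. Qed.

Lemma gram_change i j v t (a b : 'rV[R]_n) : dom i (gam v t) -> dom j (gam v t) ->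
  inner (Gr j (posi j v t)) (a *m 'J (phi j \o psi i) (posi i v t))
     (b *m 'J (phi j \o psi i) (posi i v t)) = inner (Gr i (posi i v t)) a b.
Proof.
move=> it jt; have := @gram_transition _ _ _ g i j (posi i v t) (dom_cdom it).
rewrite phiK // => /(_ jt) /= ->.
by rewrite /inner /= phiK // trmx_mul !mulmxA.
Qed.

Lemma vel_change i j v t : dom i (gam v t) -> dom j (gam v t) ->
  vel j v t = vel i v t *m 'J (phi j \o psi i) (posi i v t).
Proof.
by move=> it jt; rewrite (phase_transition (geo v) it jt) /transT row_mxKr phase_lsub.
Qed.

(** Both sides come from strict derivatives in v of the position at time t, and such a derivative is
    unique. *)
Lemma Jf_change i j v w t : dom i (gam v t) -> dom j (gam v t) ->
  Jf j v w t = Jf i v w t *m 'J (phi j \o psi i) (posi i v t).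
Proof.
move=> it jt; apply: (etrans (JfE j v w t)); apply: esym.
apply: (etrans (f_equal (mulmx^~ _) (JfE i v w t))).
apply: (etrans (esym (mulmxA _ _ _))); apply: (f_equal (mulmx w)).
have ot : overlap i j (posi i v t) by split; [exact: dom_cdom|rewrite phiK].
have sT := Ck1_sdiff (@overlap_open R n M i j) (@transition_smooth R n M i j 1) ot.
have [[d d0 Hd] _] := regular_all it.
have s1 := sdiff_comp (sdiff_pos it) sT.
have s2 : sdiff (fun u => posi j u t) v
    (lsubmx ('J (fun u => phase i (gam u) t) v) *m 'J (phi j \o psi i) (posi i v t)).
  by apply: sdiff_ext d0 _ s1 => u /Hd iu; rewrite /= phiK.
by apply: (etrans (esym (sdiff_differentiable s2).2)); exact: (sdiff_differentiable (sdiff_pos jt)).2.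
Qed.

Definition normJ v w t := inner (Gr (ch v t) (posi (ch v t) v t))
  (Jf (ch v t) v w t) (Jf (ch v t) v w t).
Definition velJ v w t := inner (Gr (ch v t) (posi (ch v t) v t))
  (vel (ch v t) v t) (Jf (ch v t) v w t).
Definition speed v t := inner (Gr (ch v t) (posi (ch v t) v t))
  (vel (ch v t) v t) (vel (ch v t) v t).

Lemma normJE j v w t : dom j (gam v t) ->
  normJ v w t = inner (Gr j (posi j v t)) (Jf j v w t) (Jf j v w t).
Proof. by move=> jt; rewrite (Jf_change w (chP v t) jt) gram_change. Qed.

Lemma velJE j v w t : dom j (gam v t) ->
  velJ v w t = inner (Gr j (posi j v t)) (vel j v t) (Jf j v w t).
Proof.
by move=> jt; rewrite (Jf_change w (chP v t) jt) (vel_change (chP v t) jt) gram_change.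
Qed.

Lemma speedE j v t : dom j (gam v t) ->
  speed v t = inner (Gr j (posi j v t)) (vel j v t) (vel j v t).
Proof. by move=> jt; rewrite (vel_change (chP v t) jt) gram_change. Qed.

(** The chart picked by [ch] may jump with time; near t it is replaced by a fixed one, in which the
    derivative is taken. *)
Let localize (W : normedModType R) (f : R -> W) (h : atlas M -> R -> W) v t (df : W) :
  (forall j s, dom j (gam v s) -> f s = h j s) ->
  forall j, dom j (gam v t) -> is_derive t 1 (h j) df -> is_derive t 1 f df.
Proof.
move=> fh j jt; have [e e0 He] := dom_near (proj1 (geo v)) jt.
by apply: is_derive_near e0 _ => s /He js; rewrite (fh j).
Qed.

Lemma inner_cov j v t (u u' z z' : _) : dom j (gam v t) ->
  is_derive t 1 u u' -> is_derive t 1 z z' ->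
  is_derive t 1 (fun s => inner (Gr j (posi j v s)) (u s) (z s))
    (inner (Gr j (posi j v t)) (u' + chr (Gr j) (posi j v t) (vel j v t) (u t)) (z t) +
     inner (Gr j (posi j v t)) (u t) (z' + chr (Gr j) (posi j v t) (vel j v t) (z t))).
Proof.
move=> jt du dz; have [dx _] := vel_ode jt.
apply: (is_derive_inner_cov (@cdomO R n M j) (@gramS R n M g j) (@gramT R n M g j)
   (@gramP R n M g j)) => //.
exact: dom_cdom.
Qed.

Lemma innerS j v t (a b : 'rV[R]_n) : dom j (gam v t) ->
  inner (Gr j (posi j v t)) a b = inner (Gr j (posi j v t)) b a.
Proof. by move=> jt; apply: innerC; apply: gramT; exact: dom_cdom. Qed.

Lemma normJ_deriv j v w t : dom j (gam v t) -> is_derive t 1 (normJ v w)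
  (2 * inner (Gr j (posi j v t)) (covJ j v w t) (Jf j v w t)).
Proof.
move=> jt; apply: (localize (h := fun j s => inner (Gr j (posi j v s)) (Jf j v w s) (Jf j v w s))
  _ jt); first by move=> *; exact: normJE.
have [dJ _] := jac_ode w jt.
apply: (is_derive_eq (inner_cov jt dJ dJ)).
by rewrite (innerS (Jf j v w t)) // -/(covJ j v w t) mulr2n mulrDl mul1r.
Qed.

Definition psiJ v w t := inner (Gr (ch v t) (posi (ch v t) v t))
  (covJ (ch v t) v w t) (Jf (ch v t) v w t).

(** <DJ, J> is half the derivative of |J|^2, which is already independent of the chart; this
    bypasses a transformation law for DJ. *)
Lemma psiJE j v w t : dom j (gam v t) ->
  psiJ v w t = inner (Gr j (posi j v t)) (covJ j v w t) (Jf j v w t).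
Proof.
move=> jt; have := is_derive_unique (normJ_deriv w jt) (normJ_deriv w (chP v t)).
by move/(mulfI (_ : (2 : R) != 0)) => ->.
Qed.

Lemma psiJ_deriv j v w t : dom j (gam v t) -> is_derive t 1 (psiJ v w)
  (inner (Gr j (posi j v t)) (covJ j v w t) (covJ j v w t) -
   inner (Gr j (posi j v t))
     (curvature (Gr j) (posi j v t) (Jf j v w t) (vel j v t) (vel j v t)) (Jf j v w t)).
Proof.
move=> jt; apply: (localize (h := fun j s => inner (Gr j (posi j v s)) (covJ j v w s) (Jf j v w s))
  _ jt); first by move=> *; exact: psiJE.
have [dJ _] := jac_ode w jt; have [c' dc E] := covJ_ode w jt.
apply: (is_derive_eq (inner_cov jt dc dJ)).
by rewrite E innerNl -/(covJ j v w t) addrC.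
Qed.

Lemma psiJ_ineq j v w t l : dom j (gam v t) ->
  2 * l * psiJ v w t - l ^+ 2 * normJ v w t <=
  inner (Gr j (posi j v t)) (covJ j v w t) (covJ j v w t) -
   inner (Gr j (posi j v t))
     (curvature (Gr j) (posi j v t) (Jf j v w t) (vel j v t) (vel j v t)) (Jf j v w t).
Proof.
move=> jt; rewrite (psiJE w jt) (normJE w jt).
have jc := dom_cdom jt.
have sec := curvature_le0 (@gramT R n M g j) (@gramP R n M g j) (CH (i := j)) (Jf j v w t) (vel j v t) jc.
have S := innerS (Jf j v w t) (covJ j v w t) jt.
have := posdef_ge0 (covJ j v w t - l *: Jf j v w t) (@gramP R n M g j _ jc).
move: (covJ j v w t) S => C S.
rewrite !(innerDl, innerDr, innerNl, innerNr, innerZl, innerZr) S.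
by move: sec; lra.
Qed.

Local Notation x0 := (phi i0 p).

Lemma jac0 v w : jac i0 v w 0 = row_mx 0 w.
Proof.
have s := sdiff_phase0 v.
by rewrite /jac (sdiff_differentiable s).2 mul_mx_row mulmx0 mulmx1.
Qed.

Lemma phase0 v : phase i0 (gam v) 0 = row_mx x0 v.
Proof. by rewrite /phase gam0 gam'0. Qed.

(** [sturm] applies with c the square norm of w at p, because at time 0 the field J vanishes and DJ
    equals w. *)
Lemma jacobi_comparison v w :
  normJ v w 1 <= psiJ v w 1 /\ inner (Gr i0 x0) w w <= normJ v w 1.
Proof.
have i00 : dom i0 (gam v 0) by rewrite gam0.
pose psi' t := inner (Gr (ch v t) (posi (ch v t) v t)) (covJ (ch v t) v w t) (covJ (ch v t) v w t) -
   inner (Gr (ch v t) (posi (ch v t) v t)) (curvature (Gr (ch v t)) (posi (ch v t) v t)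
     (Jf (ch v t) v w t) (vel (ch v t) v t) (vel (ch v t) v t)) (Jf (ch v t) v w t).
apply: (@sturm R (normJ v w) (psiJ v w) psi').
- by move=> t _; apply: normJ_deriv; exact: chP.
- by move=> t _; apply: psiJ_deriv; exact: chP.
- by move=> t l _; apply: psiJ_ineq; exact: chP.
- by rewrite (normJE w i00) jac0 row_mxKl inner0l.
- by rewrite (psiJE w i00) jac0 row_mxKl inner0r.
apply: (etrans (is_derive_unique (psiJ_deriv w (chP v 0)) (psiJ_deriv w i00))).
have z c : chr (Gr i0) x0 c 0 = 0 by have := chrZr (Gr i0) x0 0 c 0; rewrite !scale0r.
by rewrite /covJ jac0 row_mxKl row_mxKr gam0 phase0 row_mxKr z addr0 inner0r subr0.
Qed.

Lemma speed_const v t : speed v t = inner (Gr i0 x0) v v.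
Proof.
have ds (s : R) : is_derive s 1 (speed v) 0.
  have js := chP v s.
  apply: (localize (h := fun j s => inner (Gr j (posi j v s)) (vel j v s) (vel j v s)) _ js).
    by move=> *; exact: speedE.
  have [_ dy] := vel_ode js.
  by apply: (is_derive_eq (inner_cov js dy dy)); rewrite addNr inner0l inner0r addr0.
have cst (a b : R) : a <= b -> speed v a = speed v b.
  move=> ab.
  have := @real_mvt_le R (speed v) (fun=> 0) a b 0 ab (fun s _ => ds s) (fun s _ => lexx 0).
  have := @real_mvt_ge R (speed v) (fun=> 0) a b 0 ab (fun s _ => ds s) (fun s _ => lexx 0).
  by move: (speed v a) (speed v b) => x y; lra.
have -> : inner (Gr i0 x0) v v = speed v 0.
  have i00 : dom i0 (gam v 0) by rewrite gam0.
  by rewrite (speedE i00) gam0 phase0 row_mxKr.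
by have [/cst<-|/ltW/cst] := leP 0 t.
Qed.

(** <velocity, J> vanishes at time 0 and has derivative <velocity, DJ>, the velocity being parallel.
    The latter is half the derivative at r = 0 of |v + r w|^2, that is <v, w>. *)
Lemma gauss_lemma v w : velJ v w 1 = inner (Gr i0 x0) v w.
Proof.
have ds (s : R) : is_derive s 1 (velJ v w) (inner (Gr i0 x0) v w).
  have js := chP v s; set j := ch v s in js.
  have [dJ _] := jac_ode w js; have [_ dy] := vel_ode js.
  apply: (localize (h := fun j s => inner (Gr j (posi j v s)) (vel j v s) (Jf j v w s)) _ js).
    by move=> *; exact: velJE.
  apply: (is_derive_eq (inner_cov js dy dJ)); rewrite addNr inner0l add0r -/(covJ j v w s).
  (* The speed of gam (v + r w) is |v + r w|: differentiate it at r = 0. *)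
  have dl := is_derive_line v w 0.
  have v0 : v + 0 *: w = v by rewrite scale0r addr0.
  have [[d d0 Hd] _] := regular_all js.
  have sph := sdiff_phase js; rewrite -{1}v0 in sph.
  have dph := sdiff_curve sph dl; rewrite -/(jac j v w s) in dph.
  have dpos : is_derive (0 : R) 1 (fun r => posi j (v + r *: w) s) (Jf j v w s).
    have := is_derive_lsubmx dph; congr is_derive; apply/funext => r.
    by rewrite /= phase_lsub.
  have dvel : is_derive (0 : R) 1 (fun r => vel j (v + r *: w) s) (Kf j v w s).
    exact: is_derive_rsubmx dph.
  have cj : cdom j (posi j (v + 0 *: w) s) by rewrite v0; exact: dom_cdom.
  have h1 := is_derive_inner_cov (@cdomO R n M j) (@gramS R n M g j) (@gramT R n M g j)
   (@gramP R n M g j) cj dpos dvel dvel.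
  rewrite v0 in h1.
  have h2 : is_derive (0 : R) 1 (fun r => inner (Gr i0 x0) (v + r *: w) (v + r *: w))
      (inner (Gr i0 x0) v w + inner (Gr i0 x0) v w).
    apply: (is_derive_eq (is_derive_inner dl dl (is_derive_cst (Gr i0 x0) (0 : R) 1))).
    have z (a b : 'rV[R]_n) : inner 0 a b = 0 by rewrite /inner mulmx0 mul0mx mxE.
    by rewrite z v0 add0r /= (innerC w) //; apply: gramT; exact: dom_cdom.
  (* Symmetry of the connection: the covariant derivative of the velocity in r is the covariant
     derivative of J in time. *)
  have cE : Kf j v w s + chr (Gr j) (posi j v s) (Jf j v w s) (vel j v s) = covJ j v w s.
    apply: (f_equal (fun x => Kf j v w s + x)).
    by apply: (chrC (@cdomO R n M j) (@gramS R n M g j) (@gramT R n M g j)); exact: dom_cdom.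
  rewrite cE in h1.
  have w0 : 0 < d / (`|w| + 1) by rewrite divr_gt0 // ltr_wpDl.
  have near r : `|r - 0| < d / (`|w| + 1) ->
      inner (Gr j (posi j (v + r *: w) s)) (vel j (v + r *: w) s) (vel j (v + r *: w) s) =
      inner (Gr i0 x0) (v + r *: w) (v + r *: w).
    move=> rd; have rv : `|v + r *: w - v| < d.
      rewrite addrAC subrr add0r normrZ; move: rd; rewrite subr0 ltr_pdivlMr ?ltr_wpDl //.
      by apply: le_lt_trans; rewrite ler_wpM2l // lerDl.
    by apply: (etrans (esym (speedE (Hd _ rv)))); exact: speed_const.
  have := is_derive_unique (is_derive_near w0 near h1) h2.
  have := innerS (covJ j v w s) (vel j v s) js.
  move: (inner _ (covJ j v w s) _) (inner _ _ (covJ j v w s)) (inner _ v w) => a b c.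
  by move=> ->; lra.
have := @real_mvt_le R (velJ v w) _ 0 1 _ ler01 (fun s _ => ds s) (fun s _ => lexx _).
have := @real_mvt_ge R (velJ v w) _ 0 1 _ ler01 (fun s _ => ds s) (fun s _ => lexx _).
have z : velJ v w 0 = 0.
  have i00 : dom i0 (gam v 0) by rewrite gam0.
  by rewrite (velJE w i00) jac0 row_mxKl inner0r.
rewrite z; move: (velJ v w 1) (inner (Gr i0 x0) v w) => x y; lra.
Qed.

Definition exp_map v := gam v 1.

Definition dexp j v : 'M[R]_n := lsubmx ('J (fun u => phase j (gam u) 1) v).

Lemma exp_sdiff v j : dom j (exp_map v) ->
  (exists2 d : R, 0 < d & forall u, `|u - v| < d -> dom j (exp_map u)) /\
  sdiff (fun u => phi j (exp_map u)) v (dexp j v).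
Proof.
move=> jv; have [ex _] := regular_all jv.
by split; [exact: ex|exact: (sdiff_pos jv)].
Qed.

(** [jacobi_comparison] bounds w at p by its image under the derivative, in metric norms. Passing to
    coordinate norms costs a constant at p and a bound of the Gram matrices on a compact ball around
    x, both independent of v. *)
Lemma exp_expand j x : cdom j x -> exists r C : R, [/\ 0 < r, 0 < C &
  forall v, dom j (exp_map v) -> `|phi j (exp_map v) - x| <= r ->
    forall w : 'rV[R]_n, `|w| <= C * `|w *m dexp j v| ].
Proof.
move=> jx.
have jx0 := dom_cdom i0p.
have [C0 C00 HC0] := posdef_lower_bound (gramT g jx0) (gramP g jx0).
have [r r0 rc] := open_cball (@cdomO R n M j) jx.
have cG y : `|y - x| <= r -> {for y, continuous (gram g j)}.
  by move=> yr; exact: (@gramS R n M g j 0%N y (rc y yr)).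
have [B B0 HB] := compact_bound (@cball_compact R n x r) cG.
pose K := C0 * (n%:R ^+ 2 * B).
have K0 : 0 <= K by rewrite mulr_ge0 ?(ltW C00) // mulr_ge0 ?exprn_ge0 // ltW.
exists r, (K + 1); split; rewrite ?ltr_wpDl // => v jv vr w.
have [_ H1] := jacobi_comparison v w.
rewrite (normJE w jv) JfE -/(dexp j v) in H1.
set z := w *m dexp j v in H1 *.
have H2 : `|w| ^+ 2 <= K * `|z| ^+ 2.
  apply: (le_trans (HC0 w)); rewrite /K -mulrA ler_wpM2l ?(ltW C00) //.
  apply: (le_trans H1); apply: (le_trans (inner_le_norm _ _)).
  by rewrite ler_wpM2r ?exprn_ge0 // ler_wpM2l ?exprn_ge0 // HB.
have z0 : 0 <= `|z| by [].
(* K <= (K + 1)^2 spares a square root of K. *)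
rewrite -(@ler_pXn2r _ 2) ?nnegrE ?mulr_ge0 ?addr_ge0 //.
apply: (le_trans H2); rewrite exprMn ler_wpM2r ?exprn_ge0 //.
by rewrite sqrrD1 -addrA ler_wpDl ?sqr_ge0 // mulr2n -addrA lerDl addr_ge0.
Qed.

Hypothesis M_sc : simply_connected R M.

Lemma exp_continuous : continuous exp_map.
Proof. exact: (E_continuous exp_sdiff). Qed.

Lemma exp_section (q : M) : exists2 U : set M, open U /\ U q &
  forall v, U (exp_map v) -> exists s : M -> 'rV[R]_n, s (exp_map v) = v /\
    forall q', U q' -> exp_map (s q') = q' /\ {for q', continuous s}.
Proof. exact: (covering_section exp_sdiff exp_expand). Qed.

Lemma exp_injective : injective exp_map.
Proof.
exact: (covering_injective exp_continuous (E_loc_inj exp_sdiff exp_expand) exp_section M_sc).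
Qed.

Lemma exp_surjective q : exists v, exp_map v = q.
Proof. exact: (covering_surjective exp_section M_sc). Qed.

Definition log_map q := projT1 (cid (exp_surjective q)).

Lemma log_mapK q : exp_map (log_map q) = q.
Proof. by rewrite /log_map; case: cid. Qed.

(** Near q there is a continuous section, which global injectivity identifies with [log_map]. *)
Lemma log_continuous : continuous log_map.
Proof.
move=> q; have [U [oU Uq] HU] := exp_section q.
have [|s [_ Hs]] := HU (log_map q); first by rewrite log_mapK.
have nU : \forall q' \near q, s q' = log_map q'.
  have nU : nbhs q U by exact: open_nbhs_nbhs.
  apply: filterS nU => q' Uq'; apply: exp_injective.
  by rewrite log_mapK; have [] := Hs q' Uq'.
have [_ c] := Hs q Uq.
rewrite /prop_for /continuous_at -(nbhs_singleton nU) in c *.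
exact: (cvg_trans (near_eq_cvg nU) c).
Qed.

Variable L : M -> 'rV[R]_n.
Hypothesis LK : forall q, gam (L q) 1 = q.
Hypothesis L_cont : continuous L.

Definition sqdist q := inner (gram g i0 (phi i0 p)) (L q) (L q).

(** Velocity on arrival at q of the geodesic that leaves p at time 0 and reaches q at time 1; by the
    Gauss lemma, half the gradient of [sqdist]. *)
Definition radial j q : 'rV[R]_n := rsubmx (phase j (gam (L q)) 1).

(** w selects the Jacobi field that ends at the velocity y' of the curve; it exists because
    expansion makes the derivative of [exp_map] invertible. *)
Lemma log_deriv j (c : R -> M) (y' : 'rV[R]_n) (t : R) : dom j (c t) ->
  {for t, continuous c} -> is_derive t 1 (fun s => phi j (c s)) y' ->
  exists2 w, is_derive t 1 (fun s => L (c s)) w & lsubmx (jac j (L (c t)) w 1) = y'.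
Proof.
move=> jc cc dy; have jL : dom j (exp_map (L (c t))) by rewrite /exp_map LK.
have [r [C [r0 C0 HC]]] := exp_expand (dom_cdom jc).
have HD := HC _ jL; rewrite {1}/exp_map LK subrr normr0 in HD.
have {}HD := HD (ltW r0).
have [_ sF] := exp_sdiff jL.
exists (y' *m invmx (dexp j (L (c t)))); last first.
  by rewrite JfE -/(dexp j _) mulmxKV //; exact: expanding_unitmx HD.
apply: (@is_derive_inverse R n _ _ C (fun s => L (c s)) y' t C0 sF HD).
  by apply: (@continuous_comp _ _ _ c L) => //; exact: L_cont.
have -> // : (fun u => phi j (exp_map u)) \o (fun s => L (c s)) = (fun s => phi j (c s)).
by apply/funext => s; rewrite /= /exp_map LK.
Qed.

Lemma sqdist_deriv j (c : R -> M) (y' : 'rV[R]_n) (t : R) : dom j (c t) ->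
  {for t, continuous c} -> is_derive t 1 (fun s => phi j (c s)) y' ->
  is_derive t 1 (fun s => sqdist (c s))
    (2 * inner (gram g j (phi j (c t))) (radial j (c t)) y').
Proof.
move=> jc cc dy; have jL : dom j (gam (L (c t)) 1) by rewrite LK.
have [w dL Jw] := log_deriv jc cc dy.
have GT := gramT g (dom_cdom i0p).
have := gauss_lemma (L (c t)) w.
rewrite (velJE w jL) Jw LK -/(radial j (c t)) => ->.
have dG := is_derive_cst (gram g i0 (phi i0 p)) t (1 : R).
apply: (is_derive_eq (is_derive_inner dL dL dG)).
by rewrite (innerC w _ GT); move: (inner _ _ w) => a; rewrite /inner mulmx0 mul0mx mxE; ring.
Qed.

(** By symmetry of the symbols, K plus the Christoffel term is DJ at time 1 for the Jacobi field J
    ending at y', so the bound is <DJ, J> >= |J|^2 from [jacobi_comparison]. *)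
Lemma radial_deriv j (c : R -> M) (y' : 'rV[R]_n) (t : R) : dom j (c t) ->
  {for t, continuous c} -> is_derive t 1 (fun s => phi j (c s)) y' ->
  exists2 K, is_derive t 1 (fun s => radial j (c s)) K &
   inner (gram g j (phi j (c t))) y' y' <= inner (gram g j (phi j (c t)))
     (K + chr (gram g j) (phi j (c t)) y' (radial j (c t))) y'.
Proof.
move=> jc cc dy; have jL : dom j (gam (L (c t)) 1) by rewrite LK.
have [w dL Jw] := log_deriv jc cc dy.
exists (rsubmx (jac j (L (c t)) w 1)).
  exact: is_derive_rsubmx (sdiff_curve (sdiff_phase jL) dL).
have [H _] := jacobi_comparison (L (c t)) w.
move: H; rewrite (normJE w jL) (psiJE w jL).
rewrite /covJ Jw LK -/(radial j (c t)).
have -> // := chrC (@cdomO R n M j) (@gramS R n M g j) (@gramT R n M g j) (radial j (c t)) y' (dom_cdom jc).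
Qed.

(** Half the second derivative of [sqdist] along c is <D radial, y'> + <radial, Dy'>; [radial_deriv]
    bounds the first term below by |y'|^2. *)
Lemma sqdist_max_curve j (c : R -> M) (y' : R -> 'rV[R]_n) (y'' : 'rV[R]_n) (d : R) : 0 < d ->
  (forall s : R, `|s| < d -> [/\ dom j (c s), {for s, continuous c} &
     is_derive s 1 (fun s => phi j (c s)) (y' s)]) ->
  is_derive (0 : R) 1 y' y'' ->
  (forall s : R, `|s| < d -> sqdist (c s) <= sqdist (c 0)) ->
  let G := gram g j (phi j (c 0)) in
  inner G (radial j (c 0)) (y' 0) = 0 /\
  inner G (y' 0) (y' 0) +
   inner G (radial j (c 0)) (y'' + chr (gram g j) (phi j (c 0)) (y' 0) (y' 0)) <= 0.
Proof.
move=> d0 Hc dy' cmax G.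
have z0 : `|0 : R| < d by rewrite normr0.
have [j0 c0 dy0] := Hc 0 z0.
have [K dK HK] := radial_deriv j0 c0 dy0.
have dI := is_derive_inner_cov (@cdomO R n M j) (@gramS R n M g j) (@gramT R n M g j)
  (@gramP R n M g j) (dom_cdom j0) dy0 dK dy'.
have d2 := is_derive_mulf (is_derive_cst (2 : R) (0 : R) 1) dI.
have dk (s : R) : `|s| < d -> is_derive s 1 (fun s => sqdist (c s))
    (2 * inner (gram g j (phi j (c s))) (radial j (c s)) (y' s)).
  by move=> sd; have [js cs dys] := Hc s sd; exact: sqdist_deriv.
have [k1 k2] := second_derivative_test d0 dk d2 cmax.
split.
  by apply: (@mulfI R 2); rewrite ?pnatr_eq0 // mulr0.
move: k2; rewrite mul0r add0r pmulr_rle0 // => k2.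
by apply: le_trans k2; rewrite lerD2r.
Qed.

End ExponentialMap.

(** * Minimal immersions *)

Section Immersion.
Variables (R : realType) (k n : nat) (N : manifold R k) (M : manifold R n).
Variables (f : N -> M) (i : atlas N) (j : atlas M).
Hypothesis f_imm : immersion f.
Local Notation F := (local_rep f i j).

Lemma local_dom_open : open (local_dom f i j).
Proof.
have [cf _] := f_imm.
rewrite openE => x [ix jx]; rewrite /interior.
have nx : nbhs x (cdom i) by apply: open_nbhs_nbhs; split=> //; exact: cdomO.
have cfp : {for x, continuous (f \o psi i)}.
  by apply: continuous_comp; [exact: psi_cont|exact: cf].
have nf : nbhs x ((f \o psi i) @^-1` dom j).
  by apply: cfp; apply: open_nbhs_nbhs; split=> //; exact: dom_open.
by apply: filterS (filterI nx nf) => y [].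
Qed.

(** Images of straight coordinate lines serve as test curves: their acceleration in the chart of M
    is the second derivative of F in direction e. *)
Lemma local_rep_curve x e : local_dom f i j x ->
  exists2 d : R, 0 < d & (forall s : R, `|s| < d -> [/\ local_dom f i j (x + s *: e),
    {for s, continuous (fun s : R => f (psi i (x + s *: e)))} &
    is_derive s 1 (fun s : R => F (x + s *: e)) (e *m 'J F (x + s *: e))]) /\
  is_derive (0 : R) 1 (fun s : R => e *m 'J F (x + s *: e))
    (\sum_a \sum_b (e 0 a * e 0 b) *: partial a (partial b F) x).
Proof.
move=> Ux; have [cf FF] := f_imm; have [sF _] := FF i j.
have [dF p1] := sF 2%N.
have cl s : {for s, continuous (fun s : R => x + s *: e)}.
  exact: is_derive_continuous (is_derive_line x e s).
have /near_eps[d d0 Hd] : nbhs (0 : R) ((fun s : R => x + s *: e) @^-1` local_dom f i j).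
  by apply: cl; rewrite scale0r addr0; apply: open_nbhs_nbhs; split=> //; exact: local_dom_open.
exists d => //; split.
  move=> s sd; have Us : local_dom f i j (x + s *: e) by apply: Hd; rewrite subr0.
  split=> //.
    apply: (@continuous_comp _ _ _ (fun s : R => x + s *: e) (f \o psi i)); first exact: cl.
    by apply: continuous_comp; [apply: psi_cont; case: Us|exact: cf].
  have := is_derive_chain (dF _ Us) (is_derive_line x e s).
  by rewrite diffE_jacobian //; exact: dF.
have E z : local_dom f i j z -> \sum_b e 0 b *: partial b F z = e *m 'J F z.
  by move=> Uz; rewrite -(diffE_jacobian _ (dF z Uz)) (diff_sum_partial _ (dF z Uz)).
apply: (@is_derive_near R _ (fun s : R => \sum_b e 0 b *: partial b F (x + s *: e)) _ _ 0 d d0).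
  by move=> s; rewrite subr0 => sd; apply: E; apply: Hd; rewrite subr0.
rewrite exchange_big /=; apply: is_derive_sumf => b.
have dp : differentiable (partial b F) (x + 0 *: e) by rewrite scale0r addr0; have [d1 _] := p1 b; exact: d1.
have := is_derive_chain dp (is_derive_line x e 0).
rewrite (diff_sum_partial _ dp) scale0r addr0 => h.
have -> : \sum_(a < k) (e 0 a * e 0 b) *: partial a (partial b F) x =
    e 0 b *: \sum_a e 0 a *: partial a (partial b F) x.
  by rewrite scaler_sumr; apply: eq_bigr => a _; rewrite scalerA mulrC.
exact: is_deriveZ.
Qed.

End Immersion.

(** * Trace of the second fundamental form *)

Section Trace.
Variables (R : realType) (k n : nat) (G : 'rV[R]_n -> 'M[R]_n) (F : 'rV[R]_k -> 'rV[R]_n).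
Variables (x : 'rV[R]_k) (eta : 'rV[R]_n).
Local Notation J := ('J F x).
Local Notation IG := (induced_gram G F x).
Local Notation H := (invmx IG).

(** Second fundamental form before projection to the normal space. *)
Let W a b : 'rV[R]_n := partial a (partial b F) x + chr G (F x) (row a J) (row b J).

Lemma inner_induced e : inner IG e e = inner (G (F x)) (e *m J) (e *m J).
Proof. by rewrite /inner /induced_gram trmx_mul !mulmxA. Qed.

Lemma chr_suml m (X : 'I_m -> 'rV[R]_n) y w :
  chr G y (\sum_a X a) w = \sum_a chr G y (X a) w.
Proof.
apply: (@big_morph _ _ (chr G y ^~ w) 0 +%R 0 +%R); first by move=> ? ?; exact: chrDl.
by have := chrZl G y 0 0 w; rewrite !scale0r.
Qed.

(** As eta is orthogonal to the tangent space, the projection in [normal_part] does not change inner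
    products with it; k > 0 makes the factor 1 / k invertible. *)
Lemma mean_curvature_inner : (0 < k)%N -> mean_curvature G F x = 0 ->
  (forall a, inner (G (F x)) eta (row a J) = 0) ->
  \sum_a \sum_b H a b * inner (G (F x)) eta (W a b) = 0.
Proof.
move=> k0 mc eJ.
have np w : inner (G (F x)) eta (normal_part G F x w) = inner (G (F x)) eta w.
  rewrite /normal_part innerDr innerNr mulmx_sum_row inner_sumr big1 ?subr0 // => a _.
  by rewrite innerZr eJ mulr0.
have := congr1 (inner (G (F x)) eta) mc; rewrite /mean_curvature innerZr inner0r => /eqP.
rewrite mulf_eq0 invr_eq0 pnatr_eq0 -leqn0 leqNgt k0 /= => /eqP eta_II; rewrite -[RHS]eta_II.
rewrite inner_sumr; apply: eq_bigr => a _; rewrite inner_sumr; apply: eq_bigr => b _.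
rewrite innerZr np /W; congr (_ * inner _ _ (_ + _)).
by rewrite /chr; apply: eq_bigr => c _; apply: eq_bigr => d _; rewrite !mxE.
Qed.

(** The rows of a matrix P with P^T P the inverse Gram matrix form an orthonormal basis for the
    induced metric. Summed over them, the second term becomes the vanishing trace, which forces P =
    0, impossible for k > 0. *)
Lemma hessian_trace : (0 < k)%N -> (G (F x))^T = G (F x) -> posdef (G (F x)) -> row_free J ->
  mean_curvature G F x = 0 ->
  ~ (forall e : 'rV[R]_k, inner (G (F x)) eta (e *m J) = 0 /\
   inner (G (F x)) (e *m J) (e *m J) + inner (G (F x)) eta
     (\sum_a \sum_b (e 0 a * e 0 b) *: partial a (partial b F) x +
      chr G (F x) (e *m J) (e *m J)) <= 0).
Proof.
move=> k0 GT Gp fJ mc He.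
have eJ a : inner (G (F x)) eta (row a J) = 0 by rewrite rowE; exact: (He _).1.
have tr0 := mean_curvature_inner k0 mc eJ.
have IGT : IG^T = IG by rewrite /induced_gram !trmx_mul trmxK GT mulmxA.
have IGp : posdef IG.
  move=> e e0; rewrite inner_induced; apply: Gp; apply: contra e0 => /eqP eJ0.
  by apply/eqP/(row_free_inj fJ); rewrite eJ0 mul0mx.
have IGu := posdef_unit IGp.
have HT : H^T = H by rewrite trmx_inv IGT.
have Hp : posdef H.
  move=> v v0; have -> : inner H v v = inner IG (v *m H) (v *m H).
    by rewrite /inner trmx_mul HT -(mulmxA v H IG) mulVmx // mulmx1 mulmxA.
  by apply: IGp; apply: contra v0 => /eqP vH; rewrite -(mulmxKV IGu v) vH mul0mx.
have [P HP] := gram_factor HT Hp.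
have HE a b : H a b = \sum_m P m a * P m b.
  by rewrite HP mxE; apply: eq_bigr => m _; rewrite mxE.
have chrE (e : 'rV[R]_k) : \sum_a \sum_b (e 0 a * e 0 b) *: partial a (partial b F) x +
     chr G (F x) (e *m J) (e *m J) = \sum_a \sum_b (e 0 a * e 0 b) *: W a b.
  rewrite mulmx_sum_row chr_suml -big_split; apply: eq_bigr => a _ /=.
  rewrite chr_sumr -big_split; apply: eq_bigr => b _ /=.
  by rewrite chrZl chrZr scalerA scalerDr.
have le0 m : inner IG (row m P) (row m P) +
    \sum_a \sum_b (P m a * P m b) * inner (G (F x)) eta (W a b) <= 0.
  have [_] := He (row m P); rewrite chrE inner_induced inner_sumr.
  congr (_ + _ <= _); apply: eq_bigr => a _; rewrite inner_sumr.
  by apply: eq_bigr => b _; rewrite innerZr !mxE.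
have sum0 : \sum_m inner IG (row m P) (row m P) <= 0.
  have := sumr_le0 _ (fun m (_ : true) => le0 m).
  move=> /(_ (index_enum _)); rewrite big_split /= [X in _ + X <= _](_ : _ = 0) ?addr0 //.
  rewrite -[RHS]tr0 exchange_big; apply: eq_bigr => a _.
  rewrite exchange_big; apply: eq_bigr => b _.
  by rewrite HE mulr_suml.
have P0 : P = 0.
  apply/row_matrixP => m; rewrite row0; apply/eqP; apply: contraTT isT => m0.
  have h := IGp _ m0.
  have : inner IG (row m P) (row m P) <= 0.
    apply: le_trans sum0; rewrite (bigD1 m) //= lerDl; apply: sumr_ge0 => l _.
    exact: posdef_ge0.
  by rewrite leNgt h.
have := mulVmx IGu; rewrite HP P0 mulmx0 mul0mx => /matrixP/(_ (Ordinal k0) (Ordinal k0)).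
by rewrite !mxE eqxx => /eqP; rewrite eq_sym oner_eq0.
Qed.

End Trace.

Theorem theorem35 (R : realType) (n : nat) (M : manifold R n)
    (g : riemannian_metric M) :
  simply_connected R M -> complete_metric g -> cartan_hadamard g ->
  ~ exists (k : nat) (N : manifold R k) (f : N -> M),
      (1 <= k)%N /\ [set: N] !=set0 /\ connected [set: N] /\
      compact [set: N] /\ immersion f /\ minimal g f.
Proof.
move=> M_sc M_complete CH [k [N [f [k0 [N0 [_ [cN [f_imm f_min]]]]]]]].
have [q0 _] := N0; have [i0 i0p] := atlas_cover (f q0); set p := f q0 in i0p.
pose gam v := projT1 (cid (M_complete i0 (phi i0 p) v (dom_cdom i0p))).
have gamP v : [/\ geodesic g (gam v), gam v 0 = p & derive1 (phi i0 \o gam v) 0 = v].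
  by rewrite /gam; case: cid => c [] /=; rewrite phiK.
have geo v : geodesic g (gam v) by case: (gamP v).
have gam0 v : gam v 0 = p by case: (gamP v).
have gam'0 v : derive1 (phi i0 \o gam v) 0 = v by case: (gamP v).
pose L := log_map geo i0p gam0 gam'0 CH M_sc.
have LK q : gam (L q) 1 = q by exact: (log_mapK geo i0p gam0 gam'0 CH M_sc).
have cL : continuous L by exact: (@log_continuous R n M g gam i0 p geo i0p gam0 gam'0 CH M_sc).
pose h q := sqdist g i0 p L (f q).
have [cf _] := f_imm.
have ch : {within [set: N], continuous h}.
  apply: continuous_subspaceT => q; apply: (@continuous_comp _ _ _ f); first exact: cf.
  by apply: (@continuous_comp _ _ _ L (fun u => inner (gram g i0 (phi i0 p)) u u));
    [exact: cL|exact: continuous_inner].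
have [q _ qmax] := compact_EVT_max N0 cN ch.
have [i iq] := atlas_cover q; have [j jq] := atlas_cover (f q).
pose x := phi i q.
have Ux : local_dom f i j x by split; [exact: dom_cdom|rewrite /x phiK].
have fx : f (psi i x) = f q by rewrite /x phiK.
have jx : cdom j (local_rep f i j x) by rewrite /local_rep /= fx; exact: dom_cdom.
have [_ /(_ i j)[_ Fr]] := f_imm.
(* At the maximum q the radial field is taken as eta, and each tangent vector e is tested along the
   coordinate line through x. *)
apply: (hessian_trace (eta := radial gam L j (f q)) k0 (gramT g jx) (gramP g jx)
  (Fr x Ux) (f_min i j x Ux)) => e.
have [d d0 [Hd d2]] := local_rep_curve f_imm e Ux.
have Hc (s : R) : `|s| < d -> [/\ dom j (f (psi i (x + s *: e))),
    {for s, continuous (fun s : R => f (psi i (x + s *: e)))} &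
    is_derive s 1 (fun s : R => phi j (f (psi i (x + s *: e))))
      (e *m 'J (local_rep f i j) (x + s *: e))].
  by move=> /Hd[[_ js] cs ds]; split.
have cmax (s : R) : `|s| < d -> sqdist g i0 p L (f (psi i (x + s *: e))) <=
    sqdist g i0 p L (f (psi i (x + 0 *: e))).
  by move=> _; rewrite scale0r addr0 /x phiK //; apply: qmax; rewrite inE.
have := sqdist_max_curve geo i0p gam0 gam'0 CH LK cL d0 Hc d2 cmax.
by rewrite /= scale0r addr0 fx -[phi j (f q)]/(phi j (f q)) -fx.
Qed.
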